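(* Let $c>0$ be a constant and let $SB$ be the Segal-Bargmann transform $SB[f](z)=\int_{\mathbb{R}}\mathcal{A}(z,u)f(u)\,du$, $f\in L_2(\mathbb{R})$, $z\in\mathbb{C}$, with kernel $\mathcal{A}(z,u)=c\,e^{-\frac{u^2}{2}+\sqrt2uz-\frac{z^2}{2}}$. Equip its range $SB(L_2(\mathbb{R}))$ with the inner product $\langle\varphi,\psi\rangle_{SB}=\langle f,g\rangle_{L_2(\mathbb{R})}$, where $f,g\in L_2(\mathbb{R})$ are chosen such that $SB(f)=\varphi$ and $SB(g)=\psi$. Then: (i) $SB$ is a unitary transform from $L_2(\mathbb{R})$ to $SB(L_2(\mathbb{R}))$, i.e. an isomorphism between $L_2(\mathbb{R})$ and $SB(L_2(\mathbb{R}))$ that preserves the inner product. (ii) $(SB(L_2(\mathbb{R})),\langle\cdot,\cdot\rangle_{SB})$ is a reproducing kernel Hilbert space. (iii) $SB(L_2(\mathbb{R}))$ and the Bargmann space $\mathbb{B}$ have the same reproducing kernel. (iv) $SB(L_2(\mathbb{R}))=\mathbb{B}$.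
   Context: The Bargmann space $\mathbb{B}$ is the Hilbert space of entire functions $\varphi:\mathbb{C}\to\mathbb{C}$ with $\int_{\mathbb{C}}|\varphi(z)|^2e^{-|z|^2}dx\,dy<\infty$ and inner product $\langle\varphi,\psi\rangle=\frac1\pi\int_{\mathbb{C}}\varphi(z)\overline{\psi(z)}e^{-|z|^2}dx\,dy$, $z=x+iy$. A reproducing kernel Hilbert space on a set $E$ (here $E=\mathbb{C}$) is a Hilbert space $\mathcal{H}$ of functions $E\to\mathbb{C}$ for which every evaluation $\varphi\mapsto\varphi(z)$, $z\in E$, is bounded; its reproducing kernel is $K(z,w)=k_w(z)$, where $k_w\in\mathcal{H}$ is the element with $\varphi(w)=\langle\varphi,k_w\rangle$ for all $\varphi\in\mathcal{H}$. The transform $SB$ is injective, so $\langle\cdot,\cdot\rangle_{SB}$ is well defined.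
   Formalization: Claim (iii) fails unless c = π^{-1/4}: the kernel of SB(L_2(R)) is c²√π e^{z w̄}, that of B is e^{z w̄}. The formal (iii) asserts equal kernels for c = π^{-1/4} and, for every c > 0, equality up to the factor c²√π. *)

(* Defs.v *)
From HB Require Import structures.
From mathcomp Require Import all_boot all_order all_algebra.
From mathcomp Require Import complex.
From mathcomp Require Import all_classical all_reals all_analysis.

Set Implicit Arguments.
Unset Strict Implicit.
Unset Printing Implicit Defensive.

Import Order.TTheory GRing.Theory Num.Theory.
Import numFieldNormedType.Exports.

Local Open Scope classical_set_scope.
Local Open Scope ring_scope.
Local Open Scope complex_scope.

Definition abs {R : realType} (z : R[i]) : R := ComplexField.Normc.normc z.

Definition cexp {R : realType} (z : R[i]) : R[i] :=
  (expR (complex.Re z) * cos (complex.Im z)) +i*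
  (expR (complex.Re z) * sin (complex.Im z)).

Definition cintegral {R : realType} d (T : measurableType d)
    (mu : {measure set T -> \bar R}) (f : T -> R[i]) : R[i] :=
  (\int[mu]_x complex.Re (f x)) +i* (\int[mu]_x complex.Im (f x)).

Definition plane_measure {R : realType} :
    {measure set (measurableTypeR R * measurableTypeR R) -> \bar R} :=
  (@lebesgue_measure R \x @lebesgue_measure R)%E.

(* Complex vector spaces of functions E -> C with an inner product that is
   linear in its first argument; values of [ip] off [car] are irrelevant. *)
Record funSpace (R : realType) (E : Type) := FunSpace {
  car : set (E -> R[i]);
  ip : (E -> R[i]) -> (E -> R[i]) -> R[i] }.

Section FunctionSpaces.
Variables (R : realType) (E : Type).
Implicit Types (H : funSpace R E) (phi psi chi : E -> R[i]).

Definition hnorm H phi : R := Num.sqrt (complex.Re (ip H phi phi)).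

Definition vector_subspace H : Prop :=
  car H (fun=> 0) /\
  forall a phi psi, car H phi -> car H psi ->
    car H (fun z => a * phi z + psi z).

(* [0 <= ip H phi phi] in R[i] says that the number is real and nonnegative. *)
Definition inner_product H : Prop :=
  [/\ (forall a phi psi chi, car H phi -> car H psi -> car H chi ->
        ip H (fun z => a * phi z + psi z) chi
        = a * ip H phi chi + ip H psi chi),
      (forall phi psi, car H phi -> car H psi ->
        ip H phi psi = (ip H psi phi)^*),
      (forall phi, car H phi -> 0 <= ip H phi phi) &
      (forall phi, car H phi -> ip H phi phi = 0 -> phi = (fun=> 0))].

Definition complete H : Prop :=
  forall u : nat -> E -> R[i],
    (forall n, car H (u n)) ->
    (forall e : R, 0 < e -> exists N : nat, forall m n : nat,
       (N <= m)%N -> (N <= n)%N -> hnorm H (fun z => u m z - u n z) < e) ->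
    exists2 phi, car H phi &
      hnorm H (fun z => u n z - phi z) @[n --> \oo] --> (0 : R).

Definition hilbert_space H : Prop :=
  [/\ vector_subspace H, inner_product H & complete H].

Definition rkhs H : Prop :=
  hilbert_space H /\
  forall z, exists M : R, forall phi, car H phi -> abs (phi z) <= M * hnorm H phi.

Definition reproducing_kernel H (K : E -> E -> R[i]) : Prop :=
  rkhs H /\
  forall w, car H (fun z => K z w) /\
    forall phi, car H phi -> phi w = ip H phi (fun z => K z w).

Definition same_reproducing_kernel H1 H2 : Prop :=
  exists K, reproducing_kernel H1 K /\ reproducing_kernel H2 K.

End FunctionSpaces.

(* Square-integrable representatives: the elements of L_2(R) are the classes
   of these functions modulo almost everywhere equality. *)
Definition L2 {R : realType} : set (R -> R[i]) :=
  [set f | [/\ measurable_fun setT (fun u => complex.Re (f u)),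
               measurable_fun setT (fun u => complex.Im (f u)) &
               (\int[@lebesgue_measure R]_u ((abs (f u)) ^+ 2)%:E < +oo)%E]].

Definition L2ip {R : realType} (f g : R -> R[i]) : R[i] :=
  cintegral (@lebesgue_measure R) (fun u => f u * (g u)^*).

Definition ae_equal {R : realType} (f g : R -> R[i]) : Prop :=
  {ae (@lebesgue_measure R), forall u, f u = g u}.

(* [T], given on representatives, induces a linear bijection from L_2(R) onto
   [H] that preserves the inner product. *)
Definition L2_unitary {R : realType} (E : Type)
    (T : (R -> R[i]) -> E -> R[i]) (H : funSpace R E) : Prop :=
  [/\ (forall f g, L2 f -> L2 g -> (T f = T g <-> ae_equal f g)),
      T @` L2 = car H,
      (forall a f g, L2 f -> L2 g ->
        T (fun u => a * f u + g u) = (fun z => a * T f z + T g z)) &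
      (forall f g, L2 f -> L2 g -> ip H (T f) (T g) = L2ip f g)].

Definition SBkernel {R : realType} (c : R) (z : R[i]) (u : R) : R[i] :=
  c%:C * cexp (- (u ^+ 2 / 2)%:C + (Num.sqrt 2 * u)%:C * z - z ^+ 2 / 2).

Definition SB {R : realType} (c : R) (f : R -> R[i]) (z : R[i]) : R[i] :=
  cintegral (@lebesgue_measure R) (fun u => SBkernel c z u * f u).

(* Some f in L_2(R) with SB f = phi; unique up to a.e. equality. *)
Definition SBpreimage {R : realType} (c : R) (phi : R[i] -> R[i]) : R -> R[i] :=
  xget (fun=> 0) [set f | L2 f /\ SB c f = phi].

Definition SBspace {R : realType} (c : R) : funSpace R R[i] :=
  FunSpace (SB c @` L2)
    (fun phi psi => L2ip (SBpreimage c phi) (SBpreimage c psi)).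

(* [derivable] over the field R[i] is complex differentiability. *)
Definition entire {R : realType} (phi : R[i] -> R[i]) : Prop :=
  forall z : R[i], derivable (phi : R[i]^o -> R[i]^o) z 1.

Definition bargmann {R : realType} : funSpace R R[i] :=
  FunSpace
    [set phi | entire phi /\
       (\int[plane_measure]_p
          ((abs (phi (p.1 +i* p.2))) ^+ 2 * expR (- (p.1 ^+ 2 + p.2 ^+ 2)))%:E
        < +oo)%E]
    (fun phi psi => (pi^-1)%:C * cintegral plane_measure
       (fun p => phi (p.1 +i* p.2) * (psi (p.1 +i* p.2))^* *
                 (expR (- (p.1 ^+ 2 + p.2 ^+ 2)))%:C)).

(* Main.v *)
Require Import Defs.
From HB Require Import structures.
From mathcomp Require Import all_boot all_order all_algebra.
From mathcomp Require Import complex.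
From mathcomp Require Import all_classical all_reals all_analysis.
From mathcomp Require Import measurable_realfun ring lra.
Import Order.TTheory GRing.Theory Num.Theory.
Import numFieldNormedType.Exports.

Set Implicit Arguments.
Unset Strict Implicit.
Unset Printing Implicit Defensive.

Local Open Scope classical_set_scope.
Local Open Scope ring_scope.
Local Open Scope complex_scope.

(* SBspace c and the Bargmann space, once the inner product of the former is
   multiplied by r = c^2 sqrt(pi), are Hilbert spaces with the same reproducing
   kernel exp(z conj(w)), and a reproducing kernel determines its space.

   Gaussian integrals give the kernel of SBspace c: SB f w is the inner product
   of f with conj(A(w, .)), and SB maps the latter to r exp(z conj(w)).
   Injectivity of SB, on which the inner product rests, is uniqueness of the
   Fourier transform, since on the imaginary axis SB f is that of
   exp(-u^2/2) f(u) up to a factor without zeros.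

   On the Bargmann space, the integral of phi(z) s exp(-s|z-w|^2) does not
   depend on s >= 1, by Green's formula for entire phi, and tends to pi phi(w)
   as s grows; s = 1 is the reproducing property. It is complete
   because a Hilbert space contains every function of a pre-Hilbert space with
   the same kernel, with a norm at most as large: a Cauchy sequence of Bargmann
   functions thus converges pointwise to some SB f, which is entire, and Fatou's
   lemma gives convergence in norm. *)

(** * Complex numbers *)

(** Neither power series nor orthonormal bases occur: once both kernels are computed, the rest is
    Hilbert space theory. [entire] gives complex differentiability at each point, without continuity
    of the derivative, and this dictates the form of Green's formula: the functions are merely
    differentiable, and only the divergence is continuous. That suffices, because the d-bar
    derivative of [phi * k] is [phi] times that of [k], so the derivative of an entire [phi] never
    enters. The order of the argument avoids a circle. Definiteness of the Bargmann inner product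
    rests on the reproducing property, and completeness on the comparison with the range of [SB]; so
    the comparison must make do with completeness of one of the two spaces, hence the notions
    [prehilbert] and [kernel_of]. The factor [c ^+ 2 * Num.sqrt pi] appears because the inner
    product of the range is carried over from [L2], which makes its kernel quadratic in [c], while
    the Bargmann kernel does not involve [c]. It is 1 precisely for c = pi^(-1/4). *)

Section complex_numbers.
Variable R : realType.
Implicit Types (z w : R[i]) (a b x y : R).
Local Notation Re := (@complex.Re R).
Local Notation Im := (@complex.Im R).

Lemma complex_ext z w : Re z = Re w -> Im z = Im w -> z = w.
Proof. by case: z w => a b [c d] /= -> ->. Qed.

Lemma complex_eta z : Re z +i* Im z = z.
Proof. by case: z. Qed.

Lemma Re_add z w : Re (z + w) = Re z + Re w.
Proof. by case: z w => a b [c d]. Qed.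
Lemma Im_add z w : Im (z + w) = Im z + Im w.
Proof. by case: z w => a b [c d]. Qed.
Lemma Re_opp z : Re (- z) = - Re z.
Proof. by case: z. Qed.
Lemma Im_opp z : Im (- z) = - Im z.
Proof. by case: z. Qed.
Lemma Re_mul z w : Re (z * w) = Re z * Re w - Im z * Im w.
Proof. by case: z w => a b [c d]. Qed.
Lemma Im_mul z w : Im (z * w) = Re z * Im w + Im z * Re w.
Proof. by case: z w => a b [c d]. Qed.
Lemma Re_conj z : Re (conjc z) = Re z.
Proof. by case: z. Qed.
Lemma Im_conj z : Im (conjc z) = - Im z.
Proof. by case: z. Qed.
Lemma Re_real a : Re a%:C = a. Proof. by []. Qed.
Lemma Im_real a : Im a%:C = 0. Proof. by []. Qed.
Lemma Re_0 : Re 0 = 0. Proof. by []. Qed.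
Lemma Im_0 : Im 0 = 0. Proof. by []. Qed.
Lemma Re_1 : Re 1 = 1. Proof. by []. Qed.
Lemma Im_1 : Im 1 = 0. Proof. by []. Qed.

Lemma Re_mk a b : Re (a +i* b) = a. Proof. by []. Qed.
Lemma Im_mk a b : Im (a +i* b) = b. Proof. by []. Qed.

Lemma numconjE z : Num.conj z = conjc z.
Proof. by []. Qed.
Lemma conjCD z w : conjc (z + w) = (conjc z) + (conjc w).
Proof. exact: (rmorphD conjc). Qed.
Lemma conjCM z w : conjc (z * w) = (conjc z) * (conjc w).
Proof. exact: (rmorphM conjc). Qed.
Definition ReImE := (Re_mk, Im_mk, Re_add, Im_add, Re_opp, Im_opp, Re_mul, Im_mul, Re_conj,
  Im_conj, Re_real, Im_real, Re_0, Im_0, Re_1, Im_1).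

Lemma realCB a b : (a - b)%:C = a%:C - b%:C.
Proof. exact: (rmorphB (real_complex R)). Qed.
Lemma realCM a b : (a * b)%:C = a%:C * b%:C.
Proof. exact: (rmorphM (real_complex R)). Qed.

Lemma realCE a z : a%:C * z = (a * Re z) +i* (a * Im z).
Proof. by apply: complex_ext; rewrite !ReImE; ring. Qed.

Lemma half_real z : z / 2 = (2^-1)%:C * z.
Proof.
have -> : (2 : R[i]) = (2 : R)%:C by rewrite rmorph_nat.
by rewrite mulrC -fmorphV.
Qed.

Lemma abs_ge0 z : 0 <= abs z.
Proof. by case: z => a b; rewrite /abs /= sqrtr_ge0. Qed.

Lemma sqr_abs z : abs z ^+ 2 = Re z ^+ 2 + Im z ^+ 2.
Proof. by case: z => a b; rewrite /abs /= sqr_sqrtr // addr_ge0 // sqr_ge0. Qed.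

Lemma abs_def z : abs z = Num.sqrt (Re z ^+ 2 + Im z ^+ 2).
Proof. by case: z. Qed.

Lemma absE z : `|z| = (abs z)%:C.
Proof. by rewrite normc_def abs_def. Qed.

Lemma absM z w : abs (z * w) = abs z * abs w.
Proof. exact: ComplexField.Normc.normcM. Qed.

Lemma abs_triangle z w : abs (z + w) <= abs z + abs w.
Proof. exact: le_normcD. Qed.

Lemma absN z : abs (- z) = abs z.
Proof. by rewrite !abs_def !ReImE !sqrrN. Qed.

Lemma abs_subC z w : abs (z - w) = abs (w - z).
Proof. by rewrite -absN opprB. Qed.

Lemma abs_dist_le z w : `|abs z - abs w| <= abs (z - w).
Proof.
have h1 := abs_triangle (z - w) w; have h2 := abs_triangle (w - z) z.
rewrite !subrK in h1 h2; rewrite abs_subC in h2.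
by rewrite ler_norml; apply/andP; split; lra.
Qed.

Lemma absJ z : abs (conjc z) = abs z.
Proof. by rewrite !abs_def !ReImE sqrrN. Qed.

Lemma abs_real a : abs a%:C = `|a|.
Proof. by rewrite abs_def !ReImE expr0n addr0 sqrtr_sqr. Qed.

Lemma abs0 : abs (0 : R[i]) = 0.
Proof. by rewrite (abs_real 0) normr0. Qed.

Lemma abs_eq0 z : abs z = 0 -> z = 0.
Proof. by move=> h; apply/eqP; rewrite -normr_eq0 absE h. Qed.

Lemma abs_gt0 z : z != 0 -> 0 < abs z.
Proof.
by move=> z0; rewrite lt_def abs_ge0 andbT; apply: contra z0 => /eqP /abs_eq0 ->.
Qed.

Lemma absV z : abs z^-1 = (abs z)^-1.
Proof. exact: ComplexField.Normc.normcV. Qed.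

Lemma Re_le_abs z : `|Re z| <= abs z.
Proof. by rewrite abs_def -sqrtr_sqr ler_wsqrtr // lerDl sqr_ge0. Qed.

Lemma Im_le_abs z : `|Im z| <= abs z.
Proof. by rewrite abs_def -sqrtr_sqr ler_wsqrtr // lerDr sqr_ge0. Qed.

Lemma abs_le_ReIm z : abs z <= `|Re z| + `|Im z|.
Proof.
rewrite -[z in leLHS]complex_eta.
have -> : Re z +i* Im z = (Re z)%:C + (Im z)%:C * 'i.
  by apply: complex_ext; rewrite !ReImE; ring.
apply: (le_trans (abs_triangle _ _)).
rewrite absM !abs_real lerD2l (_ : abs 'i = 1) ?mulr1 //.
by rewrite abs_def /= expr0n expr1n add0r sqrtr1.
Qed.

Lemma mul_conj z : z * (conjc z) = (abs z ^+ 2)%:C.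
Proof. by apply: complex_ext; rewrite !ReImE ?sqr_abs; ring. Qed.

Lemma ge0_complexP z : 0 <= z -> z = (Re z)%:C /\ 0 <= Re z.
Proof.
rewrite lecE /= => /andP[/eqP im0 re0]; split=> //.
by apply: complex_ext.
Qed.

Lemma cexpD z w : cexp (z + w) = cexp z * cexp w.
Proof.
case: z w => a b [c d]; apply: complex_ext; rewrite ReImE /= expRD ?cosD ?sinD; ring.
Qed.

Lemma cexp0 : cexp (0 : R[i]) = 1.
Proof. by apply: complex_ext; rewrite /= expR0 ?cos0 ?sin0 mul1r. Qed.

Lemma abs_cexp z : abs (cexp z) = expR (Re z).
Proof.
by rewrite abs_def /= !exprMn -mulrDr cos2Dsin2 mulr1 sqrtr_sqr ger0_norm ?expR_ge0.
Qed.

Lemma cexpJ z : cexp (conjc z) = conjc (cexp z).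
Proof. by case: z => a b; apply: complex_ext; rewrite /= ?cosN ?sinN ?mulrN. Qed.

Lemma cexp_real a : cexp a%:C = (expR a)%:C.
Proof. by apply: complex_ext; rewrite /= ?cos0 ?sin0 ?mulr1 ?mulr0. Qed.

End complex_numbers.

(** * Spaces with a reproducing kernel *)

Section reproducing_kernels.
Variables (R : realType) (E : Type).
Implicit Types (H : funSpace R E) (phi psi chi s t : E -> R[i]) (K : E -> E -> R[i]).

Definition lincomb (a : R[i]) phi psi : E -> R[i] := fun z => a * phi z + psi z.

Definition sqnorm H phi : R := complex.Re (ip H phi phi).

Definition prehilbert H := vector_subspace H /\ inner_product H.

(** Completeness is kept apart and boundedness of the evaluations is left to Cauchy-Schwarz, so that
    this can be established for the Bargmann space before it is known to be complete. *)
Definition kernel_of H K := forall w, car H (fun z => K z w) /\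
  forall phi, car H phi -> phi w = ip H phi (fun z => K z w).

Lemma lincombBE phi psi : (fun z => phi z - psi z) = lincomb (-1) psi phi.
Proof. by apply/funext => z; rewrite /lincomb mulN1r addrC. Qed.

(** The discriminant bound behind Cauchy-Schwarz: the choice [a = - t%:C * conjc c] leaves a real
    quadratic polynomial in [t]. It is stated for bare numbers because it serves a second time with
    [D] the excess of a squared distance over its infimum. *)
Lemma quadratic_nonneg_le (A D : R) (c : R[i]) : 0 <= A ->
  (forall a : R[i], 0 <= abs a ^+ 2 * A + 2 * complex.Re (a * c) + D) ->
  abs c ^+ 2 <= A * D.
Proof.
move=> A0 h.
have test (t : R) : 0 <= t ^+ 2 * abs c ^+ 2 * A - 2 * t * abs c ^+ 2 + D.
  have := h (- t%:C * conjc c).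
  rewrite absM absN abs_real absJ exprMn -normrX ger0_norm ?sqr_ge0//.
  by rewrite sqr_abs !ReImE; congr (0 <= _); ring.
have c0 := sqr_ge0 (abs c).
have [A_gt0|] := ltrP 0 A.
  have := test A^-1.
  rewrite (_ : _ + D = (A * D - abs c ^+ 2) / A); last by field; rewrite gt_eqF.
  by rewrite pmulr_lge0 ?invr_gt0// subr_ge0.
move=> A_le0; have A_0 : A = 0 by apply/eqP; rewrite eq_le A_le0.
rewrite A_0 mul0r.
have D0 : 0 <= D by have := test 0 => *; lra.
rewrite leNgt; apply/negP => c_gt0.
(* With [A = 0] the polynomial is linear in [t]; this [t] gives it the value -1. *)
pose t := (D + 1) / (2 * abs c ^+ 2).
have tE : 2 * t * abs c ^+ 2 = D + 1.
  by rewrite /t; field; apply: contraTneq c_gt0 => ->; rewrite expr0n ltxx.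
by have := test t; rewrite tE A_0 mulr0 => *; lra.
Qed.

Section prehilbert_theory.
Variable H : funSpace R E.
Hypothesis HH : prehilbert H.

Lemma car_lincomb a phi psi : car H phi -> car H psi -> car H (lincomb a phi psi).
Proof. by case: HH => -[_ +] _; apply. Qed.

Lemma car_zero : car H (fun=> 0).
Proof. by case: HH => -[]. Qed.

Lemma ip_lincombl a phi psi chi : car H phi -> car H psi -> car H chi ->
  ip H (lincomb a phi psi) chi = a * ip H phi chi + ip H psi chi.
Proof. by case: HH => _ [+ _ _ _]; apply. Qed.

Lemma ip_conj phi psi : car H phi -> car H psi -> ip H phi psi = conjc (ip H psi phi).
Proof. by case: HH => _ [_ + _ _]; apply. Qed.

Lemma ip_lincombr a phi psi chi : car H phi -> car H psi -> car H chi ->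
  ip H chi (lincomb a phi psi) = conjc a * ip H chi phi + ip H chi psi.
Proof.
move=> Hp Hs Hc; rewrite ip_conj ?ip_lincombl//; last exact: car_lincomb.
by rewrite conjCD conjCM (ip_conj Hp Hc) (ip_conj Hs Hc) !conjcK.
Qed.

Lemma ip_sqnorm phi : car H phi -> ip H phi phi = (sqnorm H phi)%:C.
Proof. by case: HH => _ [_ _ h _] /h /ge0_complexP[]. Qed.

Lemma sqnorm_ge0 phi : car H phi -> 0 <= sqnorm H phi.
Proof. by case: HH => _ [_ _ h _] /h /ge0_complexP[]. Qed.

Lemma sqr_hnorm phi : car H phi -> hnorm H phi ^+ 2 = sqnorm H phi.
Proof. by move=> /sqnorm_ge0 h; rewrite sqr_sqrtr. Qed.

Lemma sqnorm_lincomb a phi psi : car H phi -> car H psi ->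
  sqnorm H (lincomb a phi psi) =
  abs a ^+ 2 * sqnorm H phi + 2 * complex.Re (a * ip H phi psi) + sqnorm H psi.
Proof.
move=> Hp Hs; rewrite {1}/sqnorm ip_lincombl//; last exact: car_lincomb.
rewrite !ip_lincombr// (ip_conj Hs Hp) !ip_sqnorm//.
by rewrite sqr_abs !ReImE; ring.
Qed.

Lemma cauchy_schwarz phi psi : car H phi -> car H psi ->
  abs (ip H phi psi) ^+ 2 <= sqnorm H phi * sqnorm H psi.
Proof.
move=> Hp Hs; apply: quadratic_nonneg_le => [|a]; first exact: sqnorm_ge0.
by rewrite -sqnorm_lincomb//; apply/sqnorm_ge0/car_lincomb.
Qed.

Lemma sqnorm_sub_expand phi psi : car H phi -> car H psi ->
  sqnorm H (lincomb (-1) psi phi) =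
  sqnorm H phi - 2 * complex.Re (ip H phi psi) + sqnorm H psi.
Proof.
move=> Hp Hs; rewrite sqnorm_lincomb// absN (abs_real 1) normr1 (ip_conj Hs Hp).
by rewrite !ReImE; ring.
Qed.

Lemma kernel_of_rkhs K : complete H -> kernel_of H K -> reproducing_kernel H K.
Proof.
move=> cH kH; split=> //; split; first by case: HH => *; split.
move=> w; have [Kw rep] := kH w.
exists (hnorm H (fun z => K z w)) => phi Hphi.
rewrite rep// -(ler_pXn2r (n := 2))// ?nnegrE ?abs_ge0 ?mulr_ge0 ?sqrtr_ge0//.
by rewrite exprMn !sqr_hnorm// mulrC cauchy_schwarz.
Qed.

End prehilbert_theory.

Inductive kernel_span K : (E -> R[i]) -> Prop :=
| kernel_span0 : kernel_span K (fun=> 0)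
| kernel_spanD a w s : kernel_span K s ->
    kernel_span K (lincomb a (fun z => K z w) s).

Lemma kernel_span_lincomb K a s t :
  kernel_span K s -> kernel_span K t -> kernel_span K (lincomb a s t).
Proof.
move=> + Kt; elim=> [|b w {}s _ ih].
  by rewrite (_ : lincomb _ _ _ = t)//; apply/funext => z; rewrite /lincomb mulr0 add0r.
rewrite (_ : lincomb _ _ _ = lincomb (a * b) (fun z => K z w) (lincomb a s t)).
  exact: kernel_spanD.
by apply/funext => z; rewrite /lincomb; ring.
Qed.

Lemma kernel_span_car H K s : prehilbert H -> kernel_of H K ->
  kernel_span K s -> car H s.
Proof.
move=> HH kH; elim=> [|a w {}s _ ih]; first exact: car_zero.
by apply: car_lincomb => //; case: (kH w).
Qed.

(** Against a kernel function the inner product is a value of [phi], so both spaces give the same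
    number; linearity extends this to the span. *)
Lemma ip_kernel_span_eq H1 H2 K phi s : prehilbert H1 -> prehilbert H2 ->
  kernel_of H1 K -> kernel_of H2 K -> car H1 phi -> car H2 phi ->
  kernel_span K s -> ip H1 phi s = ip H2 phi s.
Proof.
move=> HH1 HH2 k1 k2 p1 p2; elim=> [|a w {}s Ks ih].
  (* Writing 0 as [phi - phi] makes its inner product with [phi] vanish by linearity. *)
  have e : (fun=> 0) = lincomb (-1) phi phi.
    by apply/funext => z; rewrite /lincomb mulN1r addNr.
  rewrite e !ip_lincombr//.
  by rewrite (_ : conjc (-1) = -1) ?mulN1r ?addNr// (rmorphN1 conjc).
have [w1 r1] := k1 w; have [w2 r2] := k2 w.
rewrite (ip_lincombr HH1) ?(ip_lincombr HH2)//; first by rewrite -r1// -r2// ih.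
  exact: (kernel_span_car HH2 k2).
exact: (kernel_span_car HH1 k1).
Qed.

Lemma cvg_hnorm_sqnorm H (u : nat -> E -> R[i]) psi : prehilbert H ->
  (forall n, car H (u n)) -> car H psi ->
  hnorm H (fun z => u n z - psi z) @[n --> \oo] --> (0 : R) ->
  forall e : R, 0 < e -> exists N, forall n, (N <= n)%N ->
    sqnorm H (lincomb (-1) psi (u n)) < e.
Proof.
move=> HH Hu Hpsi /cvgrPdist_lt cv e e0.
have se : 0 < Num.sqrt e by rewrite sqrtr_gt0.
have [N _ hN] := cv _ se; exists N => n Nn.
have Hn : car H (lincomb (-1) psi (u n)) by exact: car_lincomb.
have := hN n Nn; rewrite /= lincombBE sub0r normrN ger0_norm ?sqrtr_ge0// => lt.
rewrite -sqr_hnorm// -[ltRHS](sqr_sqrtr (ltW e0)).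
by rewrite ltr_pXn2r// nnegrE sqrtr_ge0.
Qed.

(* The best approximations of phi in H2 from the span of the kernels form a
   Cauchy sequence, whose limit exists in the complete space H1; since the
   evaluations are continuous, the limit agrees with phi at every point. *)
Theorem kernel_inclusion H1 H2 K phi : prehilbert H1 -> complete H1 ->
  prehilbert H2 -> kernel_of H1 K -> kernel_of H2 K ->
  car H2 phi -> car H1 phi /\ sqnorm H1 phi <= sqnorm H2 phi.
Proof.
move=> HH1 cH1 HH2 k1 k2 p2.
pose J s := sqnorm H2 (lincomb (-1) s phi).
pose S := [set J s | s in kernel_span K].
have span1 := kernel_span_car HH1 k1; have span2 := kernel_span_car HH2 k2.
have J0 s : kernel_span K s -> 0 <= J s.
  by move=> Ks; apply: sqnorm_ge0 => //; apply: car_lincomb => //; exact: span2.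
have lbS : has_lbound S by exists 0 => _ [s Ks <-]; exact: J0.
have hS : has_inf S by split=> //; exists (J (fun=> 0)), (fun=> 0) => //; exact: kernel_span0.
pose d := inf S.
have dJ s : kernel_span K s -> d <= J s by move=> Ks; apply: ge_inf => //; exists s.
have /choice[u uP] : forall n : nat, exists s,
    kernel_span K s /\ J s < d + n.+1%:R^-1.
  move=> n.
  have n0 : 0 < n.+1%:R^-1 :> R by rewrite invr_gt0.
  have [_ [s Ks <-] lt] := inf_adherent n0 hS.
  by exists s.
have Ku n : kernel_span K (u n) by case: (uP n).
have uJ n : J (u n) <= d + n.+1%:R^-1 by apply/ltW; case: (uP n).
have u1 n := span1 _ (Ku n); have u2 n := span2 _ (Ku n).
(* Parallelogram identity: the midpoint of [u m] and [u n] lies in the span, so its squared distance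
   to [phi] is at least [d], while those of [u m] and [u n] exceed [d] by at most the
   reciprocals. *)
have cauchy m n : sqnorm H1 (lincomb (-1) (u n) (u m)) <=
    2 * m.+1%:R^-1 + 2 * n.+1%:R^-1.
  have Kmn : kernel_span K (lincomb (-1) (u n) (u m)) by exact: kernel_span_lincomb.
  (* The minimisation takes place in [H2] and the limit in [H1]; this transfer is possible because
     differences of the approximations stay in the span. *)
  rewrite /sqnorm (ip_kernel_span_eq HH1 HH2 k1 k2)//; last 2 first.
    exact: span1.
    exact: span2.
  pose mid := lincomb 2^-1 (u m) (lincomb (2^-1 - 1) (u n) (u n)).
  have Kmid : kernel_span K mid by do 2 apply: kernel_span_lincomb => //.
  have xm : car H2 (lincomb (-1) (u m) phi) by exact: car_lincomb.
  have xn : car H2 (lincomb (-1) (u n) phi) by exact: car_lincomb.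
  have e1 : lincomb (-1) (u n) (u m) =
      lincomb (-1) (lincomb (-1) (u m) phi) (lincomb (-1) (u n) phi).
    by apply/funext => z; rewrite /lincomb; ring.
  have e2 : lincomb 1 (lincomb (-1) (u m) phi) (lincomb (-1) (u n) phi) =
      lincomb 1 (lincomb (-1) mid phi) (lincomb (-1) mid phi).
    by apply/funext => z; rewrite /mid /lincomb; field.
  have xmid : car H2 (lincomb (-1) mid phi) by apply: car_lincomb => //; exact: span2.
  have := dJ _ Kmid; have := uJ m; have := uJ n.
  have := sqnorm_lincomb HH2 1 xm xn.
  rewrite e2 (sqnorm_lincomb HH2 1 xmid xmid) (ip_sqnorm HH2 xmid).
  rewrite -/(sqnorm H2 _) e1 (sqnorm_lincomb HH2 (-1) xm xn) absN (abs_real 1) normr1.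
  rewrite !mul1r mulN1r Re_opp Re_real -!/(J _) !expr1n !mul1r.
  move: (J _) (J _) (J _) (complex.Re _) (m.+1%:R^-1) (n.+1%:R^-1) => *; lra.
have small (e : R) : 0 < e -> exists N : nat, forall n, (N <= n)%N -> n.+1%:R^-1 < e.
  move=> e0; have [N _ hN] := near_infty_natSinv_lt (PosNum e0).
  by exists N => n Nn; exact: hN.
have [psi psi1 cv] : exists2 psi, car H1 psi &
    hnorm H1 (fun z => u n z - psi z) @[n --> \oo] --> (0 : R).
  apply: cH1 => // e e0.
  have e4 : 0 < e ^+ 2 / 4 by rewrite divr_gt0// exprn_gt0.
  have [N hN] := small _ e4.
  exists N => m n Nm Nn; rewrite lincombBE.
  have c1 : car H1 (lincomb (-1) (u n) (u m)) by exact: car_lincomb.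
  rewrite -(ltr_pXn2r (n := 2))// ?nnegrE ?sqrtr_ge0 ?(ltW e0)// sqr_hnorm//.
  have := cauchy m n; have := hN m Nm; have := hN n Nn.
  by move: (m.+1%:R^-1) (n.+1%:R^-1) (sqnorm _ _) (e ^+ 2) => *; lra.
have {}cv := cvg_hnorm_sqnorm HH1 u1 psi1 cv.
(* [u n w] tends to [psi w] by continuity of the evaluation in [H1] ([b1]), and to [phi w] by near
   minimality of the approximations in [H2] ([b2]). *)
have psiE : psi = phi.
  apply/funext => w; have [w1 r1] := k1 w; have [w2 r2] := k2 w.
  set kw := fun z => K z w in w1 r1 w2 r2.
  have Kkw : kernel_span K (lincomb 1 kw (fun=> 0)).
    exact/kernel_spanD/kernel_span0.
  pose M1 := sqnorm H1 kw + 1; pose M2 := sqnorm H2 kw + 1.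
  have M1_gt0 : 0 < M1 by rewrite ltr_wpDl// sqnorm_ge0.
  have M2_gt0 : 0 < M2 by rewrite ltr_wpDl// sqnorm_ge0.
  apply/eqP; rewrite -subr_eq0; apply/eqP/abs_eq0/eqP; rewrite eq_le abs_ge0 andbT.
  apply/ler_addgt0Pr => e e0; rewrite add0r.
  have [N1 hN1] := cv _ (divr_gt0 (exprn_gt0 2 (divr_gt0 e0 (ltr0n R 2))) M1_gt0).
  have [N2 hN2] := small _ (divr_gt0 (exprn_gt0 2 (divr_gt0 e0 (ltr0n R 2))) M2_gt0).
  pose n := maxn N1 N2.
  have /hN1 h1 : (N1 <= n)%N by exact: leq_maxl.
  have /hN2 h2 : (N2 <= n)%N by exact: leq_maxr.
  have b1 : abs (u n w - psi w) <= e / 2.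
    have c1 : car H1 (lincomb (-1) psi (u n)) by exact: car_lincomb.
    rewrite -(ler_pXn2r (n := 2))// ?nnegrE ?abs_ge0 ?divr_ge0 ?(ltW e0)//.
    rewrite (_ : u n w - psi w = lincomb (-1) psi (u n) w); last first.
      by rewrite -lincombBE.
    rewrite (r1 _ c1) (le_trans (cauchy_schwarz HH1 c1 w1))//.
    rewrite ltr_pdivlMr// in h1.
    apply: (le_trans _ (ltW h1)); rewrite ler_wpM2l ?sqnorm_ge0//.
    by rewrite lerDl.
  have b2 : abs (phi w - u n w) <= e / 2.
    have c2 : car H2 (lincomb (-1) (u n) phi) by exact: car_lincomb.
    rewrite -(ler_pXn2r (n := 2))// ?nnegrE ?abs_ge0 ?divr_ge0 ?(ltW e0)//.
    rewrite (_ : phi w - u n w = lincomb (-1) (u n) phi w); last first.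
      by rewrite -lincombBE.
    rewrite (r2 _ c2) (ip_conj HH2 c2 w2) absJ.
    (* Changing [u n] by multiples of [kw] stays in the span and cannot bring the squared distance
       below [d], so [phi - u n] is nearly orthogonal to [kw]. *)
    have q := @quadratic_nonneg_le (sqnorm H2 kw) (J (u n) - d)
      (ip H2 kw (lincomb (-1) (u n) phi)) (sqnorm_ge0 HH2 w2).
    apply: (le_trans (q _)) => [a|].
      rewrite addrA -sqnorm_lincomb// subr_ge0.
      rewrite (_ : lincomb a _ _ =
        lincomb (-1) (lincomb (-a) (lincomb 1 kw (fun=> 0)) (u n)) phi); last first.
        by apply/funext => z; rewrite /lincomb; ring.
      by apply: dJ; exact: kernel_span_lincomb.
    rewrite ltr_pdivlMr// in h2.
    apply: (le_trans _ (ltW h2)); rewrite mulrC ler_pM//.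
    - by rewrite subr_ge0 dJ.
    - exact: sqnorm_ge0.
    - by rewrite lerBlDl.
    - by rewrite lerDl.
  rewrite (_ : psi w - phi w = - (u n w - psi w) - (phi w - u n w)); last by ring.
  by rewrite (le_trans (abs_triangle _ _))// !absN [leRHS]splitr lerD.
subst psi; split=> //.
(* When the squared norm of [u N - phi] is expanded in both spaces, all terms but the squared norms
   of [phi] coincide; one expansion is below [e], the other is nonnegative. *)
apply/ler_addgt0Pr => e e0.
have [N hN] := cv _ e0; have {hN} := hN N (leqnn N).
rewrite sqnorm_sub_expand//; have := J0 _ (Ku N); rewrite /J sqnorm_sub_expand//.
have -> : ip H1 (u N) phi = conjc (ip H2 phi (u N)).
  by rewrite (ip_conj HH1)// (ip_kernel_span_eq HH1 HH2 k1 k2).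
have -> : sqnorm H1 (u N) = sqnorm H2 (u N).
  by rewrite /sqnorm (ip_kernel_span_eq HH1 HH2 k1 k2).
by rewrite Re_conj => *; lra.
Qed.

(** The inclusion in both directions gives equal norms as well, and polarization recovers the inner
    product. *)
Theorem kernel_unique_space H1 H2 K : prehilbert H1 -> complete H1 ->
  prehilbert H2 -> complete H2 -> kernel_of H1 K -> kernel_of H2 K ->
  car H1 = car H2 /\
  forall phi psi, car H1 phi -> car H1 psi -> ip H1 phi psi = ip H2 phi psi.
Proof.
move=> HH1 c1 HH2 c2 k1 k2.
have sub12 phi : car H1 phi -> car H2 phi.
  by move=> h; case: (kernel_inclusion HH2 c2 HH1 k2 k1 h).
have sub21 phi : car H2 phi -> car H1 phi.
  by move=> h; case: (kernel_inclusion HH1 c1 HH2 k1 k2 h).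
have sqE phi : car H1 phi -> sqnorm H1 phi = sqnorm H2 phi.
  move=> h; apply/eqP; rewrite eq_le.
  have [_ ->] := kernel_inclusion HH1 c1 HH2 k1 k2 (sub12 _ h).
  by have [_ ->] := kernel_inclusion HH2 c2 HH1 k2 k1 h.
split; first by apply/seteqP; split.
move=> phi psi h1 h2.
have polar a : complex.Re (a * ip H1 phi psi) = complex.Re (a * ip H2 phi psi).
  have h := car_lincomb HH1 a h1 h2.
  have := sqE _ h; rewrite !sqnorm_lincomb//; [|exact: sub12|exact: sub12].
  by rewrite !sqE// => *; lra.
apply: complex_ext; first by have := polar 1; rewrite !mul1r.
by have := polar 'i; rewrite !Re_mul /= !mul0r !mul1r !sub0r => /oppr_inj.
Qed.

End reproducing_kernels.

(** * Integrable and square-integrable functions *)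

Section real_integrable.
Context d (T : measurableType d) (R : realType) (mu : {measure set T -> \bar R}).
Implicit Types (f g : T -> R) (D : set T).

Definition rintegrable D f := mu.-integrable D (EFin \o f).

Lemma rintegrable_measurable D f : measurable D -> rintegrable D f -> measurable_fun D f.
Proof. by move=> mD /integrableP[/measurable_EFinP]. Qed.

Lemma rintegrable_le D f g : measurable D -> measurable_fun D f -> rintegrable D g ->
  (forall x, D x -> `|f x| <= g x) -> rintegrable D f.
Proof.
move=> mD mf ig fg; apply: le_integrable ig => //; first exact/measurable_EFinP.
by move=> x Dx /=; rewrite lee_fin (le_trans (fg x Dx))// ler_norm.
Qed.

Lemma rintegrableD D f g : measurable D -> rintegrable D f -> rintegrable D g ->
  rintegrable D (fun x => f x + g x).
Proof. by move=> mD intf intg; exact: (integrableD mD intf intg). Qed.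

Lemma rintegrableZ D a f : measurable D -> rintegrable D f ->
  rintegrable D (fun x => a * f x).
Proof. by move=> mD intf; exact: (integrableZl mD a intf). Qed.

Lemma rintegrableN D f : measurable D -> rintegrable D f ->
  rintegrable D (fun x => - f x).
Proof.
move=> mD intf; have := rintegrableZ (-1) mD intf; rewrite /rintegrable.
by congr (integrable _ _ _); apply/funext => x /=; rewrite mulN1r.
Qed.

Lemma rintegrableB D f g : measurable D -> rintegrable D f -> rintegrable D g ->
  rintegrable D (fun x => f x - g x).
Proof. by move=> mD intf intg; apply: rintegrableD => //; exact: rintegrableN. Qed.

Lemma rintegrable_norm D f : rintegrable D f -> rintegrable D (fun x => `|f x|).
Proof. by move=> /integrable_norm; rewrite /rintegrable. Qed.

Lemma eq_rintegrable D f g : measurable D -> (forall x, D x -> f x = g x) ->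
  rintegrable D f -> rintegrable D g.
Proof.
move=> mD fg; apply: eq_integrable => // x; rewrite inE => Dx /=.
by rewrite fg.
Qed.

Lemma rintegrable0 D : rintegrable D (fun=> 0).
Proof. exact: integrable0. Qed.

Lemma RintegralN D f : measurable D -> rintegrable D f ->
  \int[mu]_(x in D) (- f x) = - \int[mu]_(x in D) f x.
Proof.
move=> mD intf; rewrite -mulN1r -RintegralZl//.
by apply: eq_Rintegral => x _; rewrite mulN1r.
Qed.

Lemma ae_eq_Rintegral f g : measurable_fun setT f -> measurable_fun setT g ->
  {ae mu, forall x, f x = g x} ->
  \int[mu]_x f x = \int[mu]_x g x.
Proof.
move=> mf mg fg; congr fine; apply: ae_eq_integral => //; try exact/measurable_EFinP.
by apply: filterS fg => x /= -> _.
Qed.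

Lemma rintegral_lty f : measurable_fun setT f -> (forall x, 0 <= f x) ->
  (\int[mu]_x (f x)%:E < +oo)%E -> rintegrable setT f.
Proof.
move=> mf f0 flt; apply/integrableP; split; first exact/measurable_EFinP.
by under eq_integral do rewrite /= ger0_norm//.
Qed.

Lemma rintegrable_lty f : rintegrable setT f -> (\int[mu]_x (f x)%:E < +oo)%E.
Proof. exact: integrable_lty. Qed.

Lemma rintegrableE f : rintegrable setT f ->
  (\int[mu]_x (f x)%:E)%E = (\int[mu]_x f x)%:E.
Proof. by move=> intf; rewrite fineK//; exact: integrable_fin_num. Qed.

End real_integrable.

Section complex_integrable.
Context d (T : measurableType d) (R : realType) (mu : {measure set T -> \bar R}).
Implicit Types (f g : T -> R[i]).

Definition cmeasurable f := measurable_fun setT (fun x => complex.Re (f x)) /\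
  measurable_fun setT (fun x => complex.Im (f x)).

Definition cintegrable f := rintegrable mu setT (fun x => complex.Re (f x)) /\
  rintegrable mu setT (fun x => complex.Im (f x)).

Lemma cmeasurableD f g : cmeasurable f -> cmeasurable g ->
  cmeasurable (fun x => f x + g x).
Proof.
move=> [f1 f2] [g1 g2]; split.
  under eq_fun do rewrite Re_add; exact: measurable_funD.
under eq_fun do rewrite Im_add; exact: measurable_funD.
Qed.

Lemma cmeasurableM f g : cmeasurable f -> cmeasurable g ->
  cmeasurable (fun x => f x * g x).
Proof.
move=> [f1 f2] [g1 g2]; split.
  under eq_fun do rewrite Re_mul.
  by apply: measurable_funB; exact: measurable_funM.
under eq_fun do rewrite Im_mul.
by apply: measurable_funD; exact: measurable_funM.
Qed.

Lemma cmeasurable_cst (a : R[i]) : cmeasurable (fun=> a).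
Proof. by split; exact: measurable_cst. Qed.

Lemma cmeasurableN f : cmeasurable f -> cmeasurable (fun x => - f x).
Proof.
move=> mf; have := cmeasurableM (cmeasurable_cst (-1)) mf.
by congr cmeasurable; apply/funext => x; rewrite mulN1r.
Qed.

Lemma cmeasurableB f g : cmeasurable f -> cmeasurable g ->
  cmeasurable (fun x => f x - g x).
Proof. by move=> mf mg; apply: cmeasurableD => //; exact: cmeasurableN. Qed.

Lemma cmeasurableJ f : cmeasurable f -> cmeasurable (fun x => conjc (f x)).
Proof.
move=> [f1 f2]; split; first by under eq_fun do rewrite Re_conj.
under eq_fun do rewrite Im_conj; exact: measurableT_comp.
Qed.

Lemma cmeasurable_real (f : T -> R) : measurable_fun setT f ->
  cmeasurable (fun x => (f x)%:C).
Proof. by move=> mf; split => //; exact: measurable_cst. Qed.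

Lemma cmeasurable_abs f : cmeasurable f -> measurable_fun setT (fun x => abs (f x)).
Proof.
move=> [f1 f2]; under eq_fun do rewrite abs_def.
apply: (measurableT_comp (continuous_measurable_fun (@sqrt_continuous R))).
by apply: measurable_funD; exact: measurable_funX.
Qed.

Lemma cmeasurable_cexp f : cmeasurable f -> cmeasurable (fun x => cexp (f x)).
Proof.
move=> [f1 f2]; split=> /=.
  apply: measurable_funM; first exact: (measurableT_comp (@measurable_expR R)).
  exact: (measurableT_comp (continuous_measurable_fun (@continuous_cos R))).
apply: measurable_funM; first exact: (measurableT_comp (@measurable_expR R)).
exact: (measurableT_comp (continuous_measurable_fun (@continuous_sin R))).
Qed.

Lemma cintegrable_measurable f : cintegrable f -> cmeasurable f.
Proof.
by move=> [f1 f2]; split; [exact: rintegrable_measurable f1|exact: rintegrable_measurable f2].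
Qed.

Lemma cintegrable_le f (h : T -> R) : cmeasurable f -> rintegrable mu setT h ->
  (forall x, abs (f x) <= h x) -> cintegrable f.
Proof.
move=> [f1 f2] ih fh; split; apply: rintegrable_le ih _ => // x _.
  exact: le_trans (Re_le_abs _) (fh x).
exact: le_trans (Im_le_abs _) (fh x).
Qed.

Lemma cintegrable_abs f : cintegrable f -> rintegrable mu setT (fun x => abs (f x)).
Proof.
move=> If; have [f1 f2] := If.
have := rintegrableD measurableT (rintegrable_norm f1) (rintegrable_norm f2).
move/(rintegrable_le measurableT); apply.
  exact/cmeasurable_abs/cintegrable_measurable.
by move=> x _; rewrite ger0_norm ?abs_ge0// abs_le_ReIm.
Qed.

Lemma cintegrableD f g : cintegrable f -> cintegrable g ->
  cintegrable (fun x => f x + g x).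
Proof.
move=> [f1 f2] [g1 g2]; split.
  under eq_fun do rewrite Re_add; exact: rintegrableD.
under eq_fun do rewrite Im_add; exact: rintegrableD.
Qed.

Lemma cintegrableZ a f : cintegrable f -> cintegrable (fun x => a * f x).
Proof.
move=> [f1 f2]; split.
  under eq_fun do rewrite Re_mul; apply: rintegrableB => //; exact: rintegrableZ.
under eq_fun do rewrite Im_mul; apply: rintegrableD => //; exact: rintegrableZ.
Qed.

Lemma eq_cintegral f g : (forall x, f x = g x) -> cintegral mu f = cintegral mu g.
Proof. by move=> fg; congr cintegral; apply/funext. Qed.

Lemma cintegralD f g : cintegrable f -> cintegrable g ->
  cintegral mu (fun x => f x + g x) = cintegral mu f + cintegral mu g.
Proof.
move=> [f1 f2] [g1 g2]; apply: complex_ext; rewrite ReImE /cintegral !(Re_mk, Im_mk).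
  under eq_Rintegral do rewrite Re_add; exact: RintegralD.
under eq_Rintegral do rewrite Im_add; exact: RintegralD.
Qed.

Lemma cintegralZ a f : cintegrable f ->
  cintegral mu (fun x => a * f x) = a * cintegral mu f.
Proof.
move=> [f1 f2]; apply: complex_ext; rewrite ReImE /cintegral !(Re_mk, Im_mk).
  under eq_Rintegral do rewrite Re_mul.
  by rewrite RintegralB ?RintegralZl//; exact: rintegrableZ.
under eq_Rintegral do rewrite Im_mul.
by rewrite RintegralD ?RintegralZl//; exact: rintegrableZ.
Qed.

Lemma cintegralB f g : cintegrable f -> cintegrable g ->
  cintegral mu (fun x => f x - g x) = cintegral mu f - cintegral mu g.
Proof.
move=> If Ig; rewrite -mulN1r -cintegralZ// -cintegralD//; last exact: cintegrableZ.
by apply: eq_cintegral => x; rewrite mulN1r.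
Qed.

Lemma cintegralJ f : cintegrable f ->
  cintegral mu (fun x => conjc (f x)) = conjc (cintegral mu f).
Proof.
move=> [f1 f2]; apply: complex_ext; rewrite ReImE /cintegral !(Re_mk, Im_mk).
  by under eq_Rintegral do rewrite Re_conj.
by under eq_Rintegral do rewrite Im_conj; rewrite RintegralN.
Qed.

Lemma cintegral_real (f : T -> R) :
  cintegral mu (fun x => (f x)%:C) = (\int[mu]_x f x)%:C.
Proof.
by apply: complex_ext; rewrite /cintegral //= Rintegral_cst// mul0r.
Qed.

(* Rotating the integral to the positive real axis reduces this to the real
   part of the integrand. *)
Lemma abs_cintegral_le f : cintegrable f ->
  abs (cintegral mu f) <= \int[mu]_x abs (f x).
Proof.
move=> If; set I := cintegral mu f.
have [I0|I0] := eqVneq I 0.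
  by rewrite I0 abs0; apply: Rintegral_ge0 => x _; exact: abs_ge0.
have I_gt0 := abs_gt0 I0.
have iJ : cintegrable (fun x => conjc I * f x) by exact: cintegrableZ.
rewrite -(ler_pM2l I_gt0) -expr2 -(Re_real (_ ^+ 2)) -mul_conj mulrC /I -cintegralZ//.
rewrite -/I /cintegral Re_mk -RintegralZl//; last exact: cintegrable_abs.
apply: le_Rintegral => //.
- by case: iJ.
- by apply: rintegrableZ => //; exact: cintegrable_abs.
- move=> x _; rewrite (le_trans (ler_norm _))// (le_trans (Re_le_abs _))//.
  by rewrite absM absJ.
Qed.

Lemma ae_eq_cintegral f g : cmeasurable f -> cmeasurable g ->
  {ae mu, forall x, f x = g x} -> cintegral mu f = cintegral mu g.
Proof.
move=> [f1 f2] [g1 g2] fg; apply: complex_ext; rewrite /cintegral !(Re_mk, Im_mk).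
  by apply: ae_eq_Rintegral => //; apply: filterS fg => x ->.
by apply: ae_eq_Rintegral => //; apply: filterS fg => x ->.
Qed.

End complex_integrable.

(** * Square-integrable functions, their limits and completeness *)

Section square_integrable.
Context d (T : measurableType d) (R : realType) (mu : {measure set T -> \bar R}).
Implicit Types (f g : T -> R[i]) (u : nat -> T -> R[i]).

(** Stated over an arbitrary measure space: it is used on the line for the domain of [SB], and on
    the plane for Bargmann functions multiplied by the root of the Gaussian weight. *)
Definition L2fun f := cmeasurable f /\ rintegrable mu setT (fun x => abs (f x) ^+ 2).

Definition L2prod f g := cintegral mu (fun x => f x * conjc (g x)).

(** The square of the distance in mean square; without the root it can be compared directly with
    integrals. *)
Definition L2dist f g := \int[mu]_x (abs (f x - g x) ^+ 2).

Lemma L2funP f : L2fun f <-> cmeasurable f /\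
  (\int[mu]_x (abs (f x) ^+ 2)%:E < +oo)%E.
Proof.
split=> -[mf intf]; split=> //; first exact: rintegrable_lty.
apply: rintegral_lty => // [|x]; last exact: sqr_ge0.
exact/measurable_funX/cmeasurable_abs.
Qed.

Lemma L2fun_le f (h : T -> R) : cmeasurable f -> rintegrable mu setT h ->
  (forall x, abs (f x) ^+ 2 <= h x) -> L2fun f.
Proof.
move=> mf ih fh; split=> //; apply: rintegrable_le ih _ => //.
  exact/measurable_funX/cmeasurable_abs.
by move=> x _; rewrite ger0_norm ?sqr_ge0.
Qed.

Lemma L2fun_lincomb a f g : L2fun f -> L2fun g -> L2fun (fun x => a * f x + g x).
Proof.
move=> [mf If] [mg Ig].
apply: (@L2fun_le _ (fun x => 2 * abs a ^+ 2 * abs (f x) ^+ 2 + 2 * abs (g x) ^+ 2)).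
- by apply: cmeasurableD => //; apply: cmeasurableM => //; exact: cmeasurable_cst.
- by apply: rintegrableD => //; exact: rintegrableZ.
- move=> x; have := abs_triangle (a * f x) (g x); rewrite absM.
  have := abs_ge0 (a * f x + g x).
  move: (abs (a * f x + g x)) (abs a) (abs (f x)) (abs (g x)) => p q r s p0 h.
  have := sqr_ge0 (q * r - s); nra.
Qed.

Lemma L2fun0 : L2fun (fun=> 0).
Proof.
split; first exact: cmeasurable_cst.
by under eq_fun do rewrite abs0 expr0n; exact: rintegrable0.
Qed.

Lemma L2funB f g : L2fun f -> L2fun g -> L2fun (fun x => f x - g x).
Proof.
move=> Lf Lg; have := L2fun_lincomb (-1) Lg Lf.
by congr L2fun; apply/funext => x; rewrite mulN1r addrC.
Qed.

Lemma L2fun_abs_mul f g : L2fun f -> L2fun g ->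
  rintegrable mu setT (fun x => abs (f x) * abs (g x)).
Proof.
move=> [mf If] [mg Ig]; apply: rintegrable_le (rintegrableD _ If Ig) _ => //.
  by apply: measurable_funM; exact: cmeasurable_abs.
move=> x _; rewrite ger0_norm ?mulr_ge0 ?abs_ge0//.
move: (abs (f x)) (abs (g x)) => p q.
have := sqr_ge0 (p - q); have := sqr_ge0 p; have := sqr_ge0 q; nra.
Qed.

Lemma L2fun_mul f g : L2fun f -> L2fun g -> cintegrable mu (fun x => f x * g x).
Proof.
move=> Lf Lg; apply: cintegrable_le (L2fun_abs_mul Lf Lg) _.
  by case: Lf Lg => mf _ [mg _]; exact: cmeasurableM.
by move=> x; rewrite absM.
Qed.

Lemma L2funJ f : L2fun f -> L2fun (fun x => conjc (f x)).
Proof.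
move=> [mf If]; split; first exact: cmeasurableJ.
by under eq_fun do rewrite absJ.
Qed.

Lemma L2prod_integrable f g : L2fun f -> L2fun g ->
  cintegrable mu (fun x => f x * conjc (g x)).
Proof. by move=> Lf Lg; apply: L2fun_mul => //; exact: L2funJ. Qed.

Lemma L2prod_lincombl a f g h : L2fun f -> L2fun g -> L2fun h ->
  L2prod (fun x => a * f x + g x) h = a * L2prod f h + L2prod g h.
Proof.
move=> Lf Lg Lh; have If := L2prod_integrable Lf Lh; have Ig := L2prod_integrable Lg Lh.
rewrite /L2prod -cintegralZ// -cintegralD//; last exact: cintegrableZ.
by apply: eq_cintegral => x; ring.
Qed.

Lemma L2prod_conj f g : L2fun f -> L2fun g -> L2prod f g = conjc (L2prod g f).
Proof.
move=> Lf Lg; rewrite /L2prod -cintegralJ; last exact: L2prod_integrable.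
by apply: eq_cintegral => x; rewrite conjCM conjcK mulrC.
Qed.

Lemma L2prod_self f : L2prod f f = (\int[mu]_x abs (f x) ^+ 2)%:C.
Proof.
by rewrite -cintegral_real; apply: eq_cintegral => x; rewrite mul_conj.
Qed.

Lemma L2prod_eq0 f : L2fun f -> L2prod f f = 0 -> {ae mu, forall x, f x = 0}.
Proof.
move=> [mf If]; rewrite L2prod_self => -[int0].
have mF : measurable_fun setT (EFin \o (fun x => abs (f x) ^+ 2)).
  exact/measurable_EFinP/measurable_funX/cmeasurable_abs.
have [+ _] := ae_eq_integral_abs mu measurableT mF.
have -> : (\int[mu]_x `|(EFin \o (fun x => abs (f x) ^+ 2)%R) x| = 0)%E.
  under eq_integral do rewrite /= ger0_norm ?sqr_ge0//.
  by rewrite rintegrableE// int0.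
move=> /(_ erefl); apply: filterS => x /(_ I)[/eqP].
by rewrite sqrf_eq0 => /eqP /abs_eq0.
Qed.

Lemma measurable_fun_limn_einf (F : nat -> T -> \bar R) :
  (forall n, measurable_fun setT (F n)) ->
  measurable_fun setT (fun x => limn_einf (F ^~ x)).
Proof.
move=> mF.
rewrite (_ : (fun _ => _) = fun x => (- limn_esup (-%E \o F ^~ x))%E); last first.
  by apply/funext => x; rewrite limn_esupN oppeK.
apply: measurableT_comp => //.
apply: (measurable_fun_limn_esup (f := fun n x => (- F n x)%E)) => n.
exact: measurableT_comp.
Qed.

Lemma limn_einf_le_near (v : nat -> \bar R) (e : \bar R) N :
  (forall n, (N <= n)%N -> (v n <= e)%E) -> (limn_einf v <= e)%E.
Proof.
move=> ve; rewrite limn_einf_lim; apply: lime_le; first exact: is_cvg_einfs.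
apply: nearW => n; apply: le_trans (ve (maxn n N) (leq_maxr _ _)).
by apply: ereal_inf_lbound; exists (maxn n N) => //=; exact: leq_maxl.
Qed.

Definition L2cauchy u := forall e : R, 0 < e -> exists N : nat, forall m n,
  (N <= m)%N -> (N <= n)%N -> L2dist (u m) (u n) < e.

Lemma cvg_abs_sqr_sub (a : R[i]) (v : nat -> R[i]) l :
  abs (v k - l) @[k --> \oo] --> (0 : R) ->
  abs (a - v k) ^+ 2 @[k --> \oo] --> abs (a - l) ^+ 2.
Proof.
move=> cv; suff h : abs (a - v k) @[k --> \oo] --> abs (a - l).
  by rewrite expr2; apply: cvgM.
apply/cvgrPdist_lt => e e0; move/cvgrPdist_lt : cv => /(_ e e0).
apply: filterS => k; rewrite sub0r normrN (ger0_norm (abs_ge0 _)).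
apply: le_lt_trans; apply: (le_trans (abs_dist_le _ _)).
by rewrite (_ : a - l - (a - v k) = v k - l)//; ring.
Qed.

(** For fixed [n], [abs (u n x - f x) ^+ 2] is almost everywhere the limit of the same expression
    with [u (s k)] in place of [f], and Fatou's lemma bounds its integral by the Cauchy condition.
    The limit function is given in advance, because in the Bargmann space it has to be a prescribed
    entire function. *)
Theorem L2_limit u (s : nat -> nat) f : (forall n, L2fun (u n)) -> L2cauchy u ->
  (forall k, (k <= s k)%N) -> cmeasurable f ->
  {ae mu, forall x, abs (u (s k) x - f x) @[k --> \oo] --> (0 : R)} ->
  L2fun f /\ forall e : R, 0 < e -> exists N : nat, forall n, (N <= n)%N ->
    L2dist (u n) f < e.
Proof.
move=> Lu cu sk mf aef.
have mdist n g : cmeasurable g -> measurable_fun setT (fun x => (abs (u n x - g x) ^+ 2)%:E).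
  move=> mg; apply/measurable_EFinP/measurable_funX/cmeasurable_abs.
  by apply: cmeasurableB => //; case: (Lu n).
have mu_ k : cmeasurable (u k) by case: (Lu k).
have key (e : R) : 0 < e -> exists N : nat, forall n, (N <= n)%N ->
    (\int[mu]_x (abs (u n x - f x) ^+ 2)%:E <= e%:E)%E.
  move=> e0; have [N hN] := cu e e0; exists N => n Nn.
  pose F k x := (abs (u n x - u (s k) x) ^+ 2)%:E.
  have mF k : measurable_fun setT (F k) by exact: mdist.
  have F0 k x : (0 <= F k x)%E by rewrite lee_fin sqr_ge0.
  have -> : (\int[mu]_x (abs (u n x - f x) ^+ 2)%:E =
             \int[mu]_x limn_einf (F ^~ x))%E.
    apply: ge0_ae_eq_integral => //.
    - exact: mdist.
    - exact: measurable_fun_limn_einf.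
    - by move=> x _; rewrite lee_fin sqr_ge0.
    - move=> x _; rewrite limn_einf_lim; apply: lime_ge; first exact: is_cvg_einfs.
      apply: nearW => k; apply: le_ereal_inf_tmp => _ [m /= _ <-]; exact: F0.
    - apply: filterS aef => x cvx _; apply/esym; apply: (cvg_limn_einf_sup _).1.
      by apply: cvg_EFin; [exact: nearW|exact: cvg_abs_sqr_sub].
  apply: le_trans (fatou mu measurableT mF (fun k x _ => F0 k x)) _.
  apply: (@limn_einf_le_near _ _ N) => k Nk.
  rewrite rintegrableE; last by case: (L2funB (Lu n) (Lu (s k))).
  by rewrite lee_fin ltW// hN// (leq_trans Nk).
have LB n N : (forall n, (N <= n)%N -> (\int[mu]_x (abs (u n x - f x) ^+ 2)%:E < +oo)%E) ->
    (N <= n)%N -> L2fun (fun x => u n x - f x).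
  by move=> h Nn; apply/L2funP; split; [exact: cmeasurableB|exact: h].
have fin e n : (\int[mu]_x (abs (u n x - f x) ^+ 2)%:E <= e%:E)%E ->
    L2fun (fun x => u n x - f x).
  move=> h; apply/L2funP; split; first exact: cmeasurableB.
  exact: le_lt_trans h (ltry _).
split.
  have [N hN] := key 1 ltr01; have h := fin _ _ (hN N (leqnn N)).
  have := L2funB (Lu N) h; congr L2fun; apply/funext => x; ring.
(* Fatou's lemma yields a weak inequality, hence the half. *)
move=> e e0; have [N hN] := key _ (divr_gt0 e0 (ltr0n R 2)); exists N => n Nn.
have h := hN n Nn; have [_ int] := fin _ _ h.
rewrite rintegrableE// lee_fin in h.
by rewrite (le_lt_trans h)// ltr_pdivrMr// ltr_pMr// ltr1n.
Qed.

(* Along a subsequence with quickly decreasing increments the weighted sum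
   of their squares is integrable, so that the increments are almost everywhere
   dominated by a geometric sequence. *)
Theorem riesz_fischer u : (forall n, L2fun (u n)) -> L2cauchy u ->
  exists2 f, L2fun f & forall e : R, 0 < e -> exists N : nat, forall n,
    (N <= n)%N -> L2dist (u n) f < e.
Proof.
move=> Lu cu.
(* The rates are matched: squared increments with integrals below 8^-k, weighted by 4^k, have
   integrals at most 2^-k. Where the weighted sum is finite, it bounds the k-th increment by a
   multiple of 2^-k. *)
have e8 k : 0 < (8^-1 : R) ^+ k by rewrite exprn_gt0.
have /choice[N hN] : forall k, exists N : nat, forall m n,
    (N <= m)%N -> (N <= n)%N -> L2dist (u m) (u n) < 8^-1 ^+ k.
  by move=> k; exact: cu.
(* The partial sums make the indices monotone and at least [N k]; the summand [k] makes them tend to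
   infinity. *)
pose s k := (k + \sum_(i < k.+1) N i)%N.
have sk k : (k <= s k)%N by exact: leq_addr.
have sN k : (N k <= s k)%N by rewrite /s big_ord_recr /= addnA leq_addl.
have sS k : (s k <= s k.+1)%N.
  by rewrite /s [X in (_ <= _ + X)%N]big_ord_recr; apply: leq_add => //; exact: leq_addr.
pose g k x := abs (u (s k.+1) x - u (s k) x).
have mu_ k : cmeasurable (u k) by case: (Lu k).
have intg k : rintegrable mu setT (fun x => g k x ^+ 2).
  by case: (L2funB (Lu (s k.+1)) (Lu (s k))).
have g8 k : \int[mu]_x (g k x ^+ 2) < 8^-1 ^+ k.
  by apply: hN; [exact: leq_trans (sN k) (sS k)|exact: sN].
pose F k x := (4 ^+ k * g k x ^+ 2)%:E.
have mF k : measurable_fun setT (F k).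
  by have := rintegrableZ (4 ^+ k) measurableT (intg k) => /measurable_int.
have F0 k x : (0 <= F k x)%E by rewrite lee_fin mulr_ge0// ?sqr_ge0// exprn_ge0.
pose G x := (\sum_(0 <= k <oo) F k x)%E.
have G0 x : (0 <= G x)%E by apply: nneseries_ge0 => *; exact: F0.
have mG : measurable_fun setT G.
  by apply: ge0_emeasurable_sum => // *; exact: F0.
have intF k : (\int[mu]_x F k x <= (2^-1 ^+ k)%:E)%E.
  rewrite rintegrableE; last exact: rintegrableZ.
  rewrite lee_fin RintegralZl//; last exact: intg.
  rewrite (_ : 2^-1 ^+ k = 4 ^+ k * 8^-1 ^+ k); last first.
    by rewrite -exprMn; congr (_ ^+ _); field.
  by rewrite ler_wpM2l ?exprn_ge0// ltW.
have intG : mu.-integrable setT G.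
  apply/integrableP; split => //.
  under eq_integral do rewrite gee0_abs//.
  rewrite integral_nneseries//.
  apply: (@le_lt_trans _ _ (\sum_(0 <= k <oo) (2^-1 ^+ k)%:E)%E).
    by apply: lee_nneseries => [k _ _|k _]; [exact: integral_ge0|exact: intF].
  rewrite (_ : (\sum_(0 <= k <oo) _)%E = (1 / (1 - 2^-1))%:E) ?ltry//.
  apply/cvg_lim => //; rewrite (_ : (fun _ => _) = EFin \o series (geometric 1 2^-1)).
    apply: cvg_EFin; first exact: nearW.
    by apply: cvg_geometric_series; rewrite ger0_norm// invf_lt1// ltr1n.
  apply/funext => n /=; rewrite sumEFin; congr EFin; apply: eq_bigr => i _.
  by rewrite /geometric /= mul1r.
(* The upper limit is measurable without any knowledge of convergence; where it is infinite, which
   happens on a null set only, [fine] returns 0. *)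
pose f x := (fine (limn_esup (fun k => (complex.Re (u (s k) x))%:E))) +i*
            (fine (limn_esup (fun k => (complex.Im (u (s k) x))%:E))).
have mf : cmeasurable f.
  split; apply: measurableT_comp => //; apply: measurable_fun_limn_esup => k.
    by apply/measurable_EFinP; case: (mu_ (s k)).
  by apply/measurable_EFinP; case: (mu_ (s k)).
suff ae_cvg : {ae mu, forall x, abs (u (s k) x - f x) @[k --> \oo] --> (0 : R)}.
  by have [Lf cf] := L2_limit Lu cu sk mf ae_cvg; exists f.
apply: filterS (integrable_ae measurableT intG) => x /(_ I) fin.
have gle k : g k x <= Num.sqrt (fine (G x)) * 2^-1 ^+ k.
  have : (F k x <= G x)%E.
    apply: le_trans (nneseries_lim_ge k.+1 _); last by move=> *; exact: F0.
    by rewrite big_nat_recr//= leeDr// sume_ge0.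
  move=> le0; have {le0} le1 : 4 ^+ k * g k x ^+ 2 <= fine (G x).
    by rewrite -lee_fin fineK.
  rewrite -(ler_pXn2r (n := 2))// ?nnegrE ?abs_ge0 ?mulr_ge0 ?sqrtr_ge0 ?exprn_ge0//.
  rewrite exprMn sqr_sqrtr ?fine_ge0 ?G0//.
  rewrite (_ : (2^-1 ^+ k) ^+ 2 = (4 ^+ k)^-1); last first.
    by rewrite -exprM mulnC exprM -exprVn; congr (_ ^+ _); field.
  by rewrite ler_pdivlMr ?exprn_gt0// mulrC.
have cvg_part (v : nat -> R) : (forall k, `|v k.+1 - v k| <= g k x) ->
    v k - fine (limn_esup (fun k => (v k)%:E)) @[k --> \oo] --> (0 : R).
  move=> vg; have cv : cvgn v.
    have -> : v = (fun k => v 0%N + series (telescope v) k).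
      by apply/funext => k; rewrite /series/= telescope_sumr// addrC subrK.
    apply: is_cvgD; first exact: is_cvg_cst.
    apply: normed_cvg; apply: series_le_cvg; last first.
    - apply: (@is_cvg_geometric_series _ (Num.sqrt (fine (G x))) 2^-1).
      by rewrite ger0_norm// invf_lt1// ltr1n.
    - by move=> k; rewrite /telescope; apply: le_trans (vg k) (gle k).
    - by move=> k; rewrite /= mulr_ge0 ?sqrtr_ge0 ?exprn_ge0.
    - by move=> k; exact: normr_ge0.
  have -> : limn_esup (fun k => (v k)%:E) = (limn v)%:E.
    by apply: (cvg_limn_einf_sup _).2; apply: cvg_EFin => //; exact: nearW.
  by rewrite /= -(subrr (limn v)); apply: cvgB => //; exact: cvg_cst.
have cRe := cvg_part (fun k => complex.Re (u (s k) x)).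
have cIm := cvg_part (fun k => complex.Im (u (s k) x)).
have {}cRe : `|complex.Re (u (s k) x - f x)| @[k --> \oo] --> (0 : R).
  rewrite -(normr0 R); apply: cvg_norm; under eq_fun do rewrite Re_add Re_opp.
  by apply: cRe => k; rewrite -Re_opp -Re_add; exact: Re_le_abs.
have {}cIm : `|complex.Im (u (s k) x - f x)| @[k --> \oo] --> (0 : R).
  rewrite -(normr0 R); apply: cvg_norm; under eq_fun do rewrite Im_add Im_opp.
  by apply: cIm => k; rewrite -Im_opp -Im_add; exact: Im_le_abs.
have cv : `|complex.Re (u (s k) x - f x)| + `|complex.Im (u (s k) x - f x)|
    @[k --> \oo] --> (0 : R) by rewrite -[X in _ --> X]addr0; exact: cvgD.
apply: squeeze_cvgr (cvg_cst (0 : R)) cv.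
by apply: nearW => k; rewrite abs_ge0 abs_le_ReIm.
Qed.

End square_integrable.

Section exhaustion.
Context d (T : measurableType d) (R : realType) (mu : {measure set T -> \bar R}).

Lemma Rintegral_ae_dominated_cvg (f : nat -> T -> R) (l g : T -> R) :
  (forall n, measurable_fun setT (f n)) -> measurable_fun setT l ->
  {ae mu, forall x, f n x @[n --> \oo] --> l x} ->
  rintegrable mu setT g -> (forall n x, `|f n x| <= g x) ->
  rintegrable mu setT l /\ \int[mu]_x f n x @[n --> \oo] --> \int[mu]_x l x.
Proof.
move=> mf ml fl ig fg.
have [] := @dominated_convergence _ _ _ mu _ measurableT
  (fun n => EFin \o f n) (EFin \o l) (EFin \o g).
- by move=> n; exact/measurable_EFinP.
- exact/measurable_EFinP.
- by apply: filterS fl => x fx _; apply: cvg_EFin; [exact: nearW|exact: fx].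
- exact: ig.
- by apply: aeW => x n _; rewrite /= lee_fin.
move=> il _ cv; split=> //; apply: fine_cvg.
by rewrite fineK ?integrable_fin_num.
Qed.

Lemma Rintegral_dominated_cvg (f : nat -> T -> R) (l g : T -> R) :
  (forall n, measurable_fun setT (f n)) ->
  (forall x, f n x @[n --> \oo] --> l x) ->
  rintegrable mu setT g -> (forall n x, `|f n x| <= g x) ->
  rintegrable mu setT l /\ \int[mu]_x f n x @[n --> \oo] --> \int[mu]_x l x.
Proof.
move=> mf fl; apply: Rintegral_ae_dominated_cvg => //; last exact: aeW.
by apply: (measurable_fun_cvg (h := f)) => // x _; exact: fl.
Qed.

Lemma Rintegral_exhaustion_cvg (D : nat -> set T) (f : T -> R) :
  (forall n, measurable (D n)) -> (forall x, \forall n \near \oo, D n x) ->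
  rintegrable mu setT f ->
  \int[mu]_(x in D n) f x @[n --> \oo] --> \int[mu]_x f x.
Proof.
move=> mD Dx intf; under eq_fun do rewrite Rintegral_mkcond.
have [] // := @Rintegral_dominated_cvg (fun n => f \_ (D n)) f (fun x => `|f x|).
- move=> n; apply/(measurable_restrictT _ (mD n)).1.
  by apply: measurable_funTS; exact: rintegrable_measurable intf.
- move=> x; apply: cvg_near_cst; near=> n; rewrite patchE mem_set//; near: n; exact: Dx.
- exact: rintegrable_norm.
- by move=> n x; rewrite patchE; case: ifP => // _; rewrite normr0.
Unshelve. all: end_near. Qed.

End exhaustion.

(** * Gaussian integrals on the line *)

Section gaussian.
Variable R : realType.
Local Notation mu := (@lebesgue_measure R).
Implicit Types (a m k t u : R).

Lemma continuous_of_derive (h dh : R -> R) :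
  (forall u, is_derive u 1 h (dh u)) -> continuous h.
Proof.
by move=> hd u; apply: differentiable_continuous; apply/derivable1_diffP; case: (hd u).
Qed.

Lemma Rintegral_derivative (h dh : R -> R) : (forall u, is_derive u 1 h (dh u)) ->
  continuous dh -> rintegrable mu setT dh ->
  h n%:R @[n --> \oo] --> (0 : R) -> h (- n%:R) @[n --> \oo] --> (0 : R) ->
  \int[mu]_u dh u = 0.
Proof.
move=> hd cdh idh cv1 cv2.
have ch := continuous_of_derive hd.
have FTC (n : nat) : \int[mu]_(u in `[- n.+1%:R, n.+1%:R]) dh u =
    h n.+1%:R - h (- n.+1%:R).
  rewrite /Rintegral (@continuous_FTC2 _ dh h)//.
  - by rewrite gtrN.
  - exact: continuous_subspaceT.
  - split.
    + by move=> x _; case: (hd x).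
    + by apply: cvg_at_right_filter; exact: ch.
    + by apply: cvg_at_left_filter; exact: ch.
  - by move=> x _; rewrite derive1E; case: (hd x).
have : \int[mu]_(u in `[- n.+1%:R, n.+1%:R]) dh u @[n --> \oo] --> \int[mu]_u dh u.
  apply: Rintegral_exhaustion_cvg => // x; near=> n.
  rewrite /= in_itv/= -ler_norml.
  apply: (@le_trans _ _ n%:R); last by rewrite ler_nat.
  near: n; exact: nbhs_infty_ger.
under eq_fun do rewrite FTC.
move=> cv; have cv0 : h n.+1%:R - h (- n.+1%:R) @[n --> \oo] --> (0 : R).
  rewrite -[X in _ --> X](subrr 0); apply: cvgB.
    by rewrite -(cvg_shiftS (fun n => h n%:R)) in cv1.
  by rewrite -(cvg_shiftS (fun n => h (- n%:R))) in cv2.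
exact: cvg_unique cv cv0.
Unshelve. all: end_near. Qed.

Lemma is_derive_congr (f : R -> R) (u b b' : R) :
  is_derive u 1 f b -> b = b' -> is_derive u 1 f b'.
Proof. by move=> h <-. Qed.

Lemma is_derive_expR_comp (g : R -> R) (u b : R) : is_derive u 1 g b ->
  is_derive u 1 (fun x => expR (g x)) (b * expR (g u)).
Proof.
move=> h; rewrite mulrC.
exact: (@is_derive1_comp R expR g u _ b (is_derive_expR _) h).
Qed.

Lemma is_derive_sin_comp (g : R -> R) (u b : R) : is_derive u 1 g b ->
  is_derive u 1 (fun x => sin (g x)) (b * cos (g u)).
Proof.
move=> h; rewrite mulrC.
exact: (@is_derive1_comp R sin g u _ b (is_derive_sin _) h).
Qed.

Lemma is_derive_cos_comp (g : R -> R) (u b : R) : is_derive u 1 g b ->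
  is_derive u 1 (fun x => cos (g x)) (- b * sin (g u)).
Proof.
move=> h; rewrite mulNr -mulrN mulrC.
exact: (@is_derive1_comp R cos g u _ b (is_derive_cos _) h).
Qed.

Definition gauss a m u := expR (- (a * (u - m) ^+ 2)).

Lemma gauss_gt0 a m u : 0 < gauss a m u.
Proof. exact: expR_gt0. Qed.

Lemma gauss_ge0 a m u : 0 <= gauss a m u.
Proof. exact: expR_ge0. Qed.

Lemma is_derive_gauss a m u :
  is_derive u 1 (gauss a m) (- (2 * a * (u - m)) * gauss a m u).
Proof.
have h : is_derive u 1 (fun u => - (a * (u - m) ^+ 2)) (- (2 * a * (u - m))).
  apply: is_derive_eq; rewrite /GRing.scale/=; ring.
exact: is_derive_expR_comp h.
Qed.

Lemma continuous_gauss a m : continuous (gauss a m).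
Proof. exact: continuous_of_derive (is_derive_gauss a m). Qed.

(** The parameter [a] corresponds to the variance [(2 * a)^-1]; integrability and total mass are
    then those of a probability density. *)
Lemma gauss_normal_pdf a m u : 0 < a ->
  gauss a m u = Num.sqrt (pi / a) * normal_pdf m (Num.sqrt (2 * a)^-1) u.
Proof.
move=> a0.
have s0 : Num.sqrt (2 * a)^-1 != 0 by rewrite sqrtr_eq0 -ltNge invr_gt0 mulr_gt0.
rewrite normal_pdfE// /normal_peak /normal_fun sqr_sqrtr ?invr_ge0 ?mulr_ge0 ?ltW//.
rewrite (_ : (2 * a)^-1 * pi *+ 2 = pi / a); last by field; rewrite gt_eqF.
rewrite mulrA mulfV ?mul1r; last by rewrite sqrtr_eq0 -ltNge divr_gt0// pi_gt0.
by congr expR; field; rewrite gt_eqF.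
Qed.

Lemma rintegrable_gauss a m : 0 < a -> rintegrable mu setT (gauss a m).
Proof.
move=> a0.
have h : rintegrable mu setT (normal_pdf m (Num.sqrt (2 * a)^-1)).
  exact: integrable_normal_pdf.
apply: eq_rintegrable (rintegrableZ (Num.sqrt (pi / a)) measurableT h) => //.
by move=> u _; rewrite gauss_normal_pdf.
Qed.

Lemma Rintegral_gauss a m : 0 < a -> \int[mu]_u gauss a m u = Num.sqrt (pi / a).
Proof.
move=> a0; under eq_Rintegral do rewrite gauss_normal_pdf//.
rewrite RintegralZl//; last exact: integrable_normal_pdf.
by rewrite /Rintegral integral_normal_pdf mulr1.
Qed.

(** Half of the exponent absorbs the quadratic factor, by [1 + x <= expR x]; the other half
    remains. *)
Lemma sqr_gauss_le a m u : 0 < a -> (u - m) ^+ 2 * gauss a m u <= 2 / a * gauss (a / 2) m u.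
Proof.
move=> a0; set x := (u - m) ^+ 2.
have x0 : 0 <= x by exact: sqr_ge0.
have e : gauss a m u = gauss (a / 2) m u * gauss (a / 2) m u.
  by rewrite /gauss -expRD; congr expR; field.
rewrite e mulrA ler_wpM2r ?gauss_ge0//.
rewrite /gauss expRN -/x ler_pdivrMr ?expR_gt0//.
have := expR_ge1Dx (a / 2 * x).
rewrite -(ler_pM2l (divr_gt0 (ltr0n R 2) a0)); apply: le_trans.
by rewrite mulrDr mulr1 mulrA (_ : 2 / a * (a / 2) = 1) ?mul1r; [rewrite lerDr divr_ge0// ltW|field; rewrite gt_eqF].
Qed.

Lemma rintegrable_sqr_gauss a m : 0 < a ->
  rintegrable mu setT (fun u => (1 + (u - m) ^+ 2) * gauss a m u).
Proof.
move=> a0.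
have h := rintegrableD measurableT (rintegrable_gauss m a0)
  (rintegrableZ (2 / a) measurableT (rintegrable_gauss m (divr_gt0 a0 (ltr0n R 2)))).
apply: rintegrable_le h _ => //.
  apply: continuous_measurable_fun => u; apply: cvgM; last exact: continuous_gauss.
  apply: cvgD; first exact: cvg_cst.
  by rewrite expr2; apply: cvgM; apply: cvgB => //; exact: cvg_cst.
move=> u _; rewrite ger0_norm; last first.
  by rewrite mulr_ge0 ?addr_ge0 ?sqr_ge0 ?gauss_ge0.
by rewrite mulrDl mul1r lerD2l sqr_gauss_le.
Qed.

Lemma cvg_gauss_infty a m (s : nat -> R) : 0 < a ->
  (forall n : nat, n%:R - `|m| <= `|s n - m|) ->
  gauss a m (s n) @[n --> \oo] --> (0 : R).
Proof.
move=> a0 sm; apply/cvgrPdist_lt => e e0; near=> n.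
rewrite sub0r normrN ger0_norm ?gauss_ge0//.
rewrite /gauss expRN -(ltf_pV2) ?posrE ?invr_gt0 ?expR_gt0// invrK.
apply: lt_le_trans (expR_ge1Dx _).
have n1 : `|m| + 1 + (a * e)^-1 <= n%:R by near: n; exact: nbhs_infty_ger.
have := sm n; set x := `|s n - m| => nx.
have ae : 0 < (a * e)^-1 by rewrite invr_gt0 mulr_gt0.
have -> : (s n - m) ^+ 2 = x ^+ 2 by rewrite -real_normK ?num_real.
have x1 : 1 + (a * e)^-1 <= x by lra.
have : 1 + (a * e)^-1 <= x ^+ 2 by nra.
rewrite -(ler_pM2l a0) mulrDr (_ : a * (a * e)^-1 = e^-1); last by field; rewrite !gt_eqF.
by lra.
Unshelve. all: end_near. Qed.

(** The real form of the Fourier transform of a Gaussian; the phase [t] covers cosine and sine at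
    once. As a function of [k], the integral [F] has derivative [- S], and integration by parts
    gives [2 * a * S k = k * F k]. So [F] solves a linear differential equation and is determined by
    [F 0]. *)
Lemma Rintegral_gauss_cos a m k t : 0 < a ->
  \int[mu]_u (gauss a m u * cos (k * (u - m) + t)) =
  Num.sqrt (pi / a) * cos t * expR (- (k ^+ 2 / (4 * a))).
Proof.
move=> a0.
pose G := gauss a m.
pose F k := \int[mu]_u (G u * cos (k * (u - m) + t)).
pose S k := \int[mu]_u ((u - m) * G u * sin (k * (u - m) + t)).
have affine k' u : is_derive u 1 (fun u => k' * (u - m) + t) k'.
  by apply: is_derive_eq; rewrite /GRing.scale/=; ring.
have clin k' : continuous (fun u => k' * (u - m) + t).
  exact: (continuous_of_derive (affine k')).
have cc k' : continuous (fun u => cos (k' * (u - m) + t)).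
  move=> u; apply: (@continuous_comp _ _ _ (fun u => k' * (u - m) + t) cos).
    exact: clin.
  exact: continuous_cos.
have cs k' : continuous (fun u => sin (k' * (u - m) + t)).
  move=> u; apply: (@continuous_comp _ _ _ (fun u => k' * (u - m) + t) sin).
    exact: clin.
  exact: continuous_sin.
have cG : continuous G by exact: continuous_gauss.
have cu : continuous (fun u => u - m).
  by move=> u; apply: cvgB => //; exact: cvg_cst.
have cc1 x : `|cos x| <= 1 by rewrite ler_norml cos_geN1 cos_le1.
have cs1 x : `|sin x| <= 1 by rewrite ler_norml sin_geN1 sin_le1.
have G0 u : 0 < G u by exact: gauss_gt0.
have iG2 := rintegrable_sqr_gauss m a0.
have iF k' : rintegrable mu setT (fun u => G u * cos (k' * (u - m) + t)).
  apply: rintegrable_le (rintegrable_gauss m a0) _ => //.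
    by apply: continuous_measurable_fun => u; apply: cvgM; [exact: cG|exact: cc].
  by move=> u _; rewrite normrM (gtr0_norm (G0 u)); apply: ler_piMr; [exact/ltW/G0|exact: cc1].
have um u : `|u - m| <= 1 + (u - m) ^+ 2.
  rewrite -[X in 1 + X]real_normK ?num_real//.
  by have := sqr_ge0 (`|u - m| - 1); have := normr_ge0 (u - m); move: `|u - m| => x; nra.
have iS k' : rintegrable mu setT (fun u => (u - m) * G u * sin (k' * (u - m) + t)).
  apply: rintegrable_le iG2 _ => //.
    apply: continuous_measurable_fun => u; apply: cvgM; last exact: cs.
    by apply: cvgM; [exact: cu|exact: cG].
  move=> u _; rewrite !normrM (gtr0_norm (G0 u)).
  apply: (@le_trans _ _ (`|u - m| * G u)).
    by apply: ler_piMr; [by apply: mulr_ge0 => //; exact/ltW/G0|exact: cs1].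
  by apply: ler_wpM2r; [exact/ltW/G0|exact: um].
have byparts k' : 2 * a * S k' = k' * F k'.
  pose h u := G u * sin (k' * (u - m) + t).
  pose dh u := k' * (G u * cos (k' * (u - m) + t)) -
    2 * a * ((u - m) * G u * sin (k' * (u - m) + t)).
  have hd u : is_derive u 1 h (dh u).
    have h1 := is_derive_sin_comp (affine k' u).
    apply: (is_derive_congr (is_deriveM (is_derive_gauss a m u) h1)).
    by rewrite /dh /GRing.scale/= /G; ring.
  have cdh : continuous dh.
    move=> u; apply: cvgB.
      by apply: cvgZr; apply: cvgM; [exact: cG|exact: cc].
    by apply: cvgZr; apply: cvgM; [apply: cvgM; [exact: cu|exact: cG]|exact: cs].
  have idh : rintegrable mu setT dh.
    by apply: rintegrableB => //; exact: rintegrableZ.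
  have h0 (s : nat -> R) : (forall n : nat, n%:R - `|m| <= `|s n - m|) ->
      h (s n) @[n --> \oo] --> (0 : R).
    move=> sm; have cv := cvg_gauss_infty a0 sm.
    have {}cv : `|G (s n)| @[n --> \oo] --> (0 : R).
      by rewrite -(normr0 R); apply: cvg_norm.
    apply: norm_cvg0; apply: squeeze_cvgr (cvg_cst (0 : R)) cv.
    by apply: nearW => n; rewrite normr_ge0/= normrM; apply: ler_piMr; [exact: normr_ge0|exact: cs1].
  have := Rintegral_derivative hd cdh idh (h0 _ _) (h0 _ _).
  rewrite RintegralB//; [|exact: rintegrableZ|exact: rintegrableZ].
  rewrite (RintegralZl _ measurableT (iF k')) (RintegralZl _ measurableT (iS k')) => e.
  apply/esym/eqP; rewrite -subr_eq0; apply/eqP; apply: e => n.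
    have := lerB_dist n%:R m; rewrite normr_nat; exact.
  have := lerB_normD n%:R m; rewrite normr_nat -(normrN (n%:R + m)) opprD.
  exact.
have dF k' : is_derive k' 1 F (- S k').
  pose f (k : R) u := G u * cos (k * (u - m) + t).
  have df (x u : R) : is_derive x 1 (f ^~ u) (- ((u - m) * G u * sin (x * (u - m) + t))).
    have h : is_derive x 1 (fun x => x * (u - m) + t) (u - m).
      by apply: is_derive_eq; rewrite /GRing.scale/=; ring.
    apply: (is_derive_congr (is_deriveZ (G u) (is_derive_cos_comp h))).
    by rewrite /GRing.scale/=; ring.
  have d1 (x u : R) : partial1of2 f x u = - ((u - m) * G u * sin (x * (u - m) + t)).
    by rewrite partial1of2E; case: (df x u).
  have Ik : `]k' - 1, k' + 1[%classic k' by rewrite /= in_itv/=; apply/andP; split; lra.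
  (* The dominating function does not involve the frequency, so any neighbourhood of [k'] will
     do. *)
  have cvd := @cvg_differentiation_under_integral _ _ _ mu f setT measurableT k'
    (k' - 1) (k' + 1) Ik (fun x _ => iF x) (fun x y _ _ => @ex_derive _ _ _ _ _ _ _ (df x y))
    (fun u => (1 + (u - m) ^+ 2) * gauss a m u).
  have -> : - S k' = \int[mu]_u partial1of2 f k' u.
    under eq_Rintegral do rewrite d1.
    by rewrite RintegralN.
  have cvF : h^-1 *: (F (h + k') - F k') @[h --> 0^'] --> \int[mu]_u partial1of2 f k' u.
    apply: cvd => //.
    - by move=> u; rewrite mulr_ge0 ?addr_ge0 ?sqr_ge0 ?gauss_ge0.
    - move=> x u _ _; rewrite d1 normrN !normrM (gtr0_norm (G0 u)).
      apply: (@le_trans _ _ (`|u - m| * G u)).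
    by apply: ler_piMr; [by apply: mulr_ge0 => //; exact/ltW/G0|exact: cs1].
      by apply: ler_wpM2r; [exact/ltW/G0|exact: um].
  apply: DeriveDef.
    by apply/cvg_ex; eexists; under eq_fun do rewrite scaler1; exact: cvF.
  by rewrite /derive; under eq_fun do rewrite scaler1; exact: cvg_lim cvF.
(* The exponential is the integrating factor of the equation F' = - k F / (2 a). *)
pose Q k' := F k' * expR (k' ^+ 2 / (4 * a)).
have dQ k' : is_derive k' 1 Q 0.
  have h : is_derive k' 1 (fun x => x ^+ 2 / (4 * a)) (k' / (2 * a)).
    apply: is_derive_eq; rewrite /GRing.scale/=; field; exact: lt0r_neq0.
  have h1 := is_derive_expR_comp h.
  apply: (is_derive_congr (is_deriveM (dF k') h1)).
  rewrite /GRing.scale/=.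
  have -> : S k' = k' * F k' / (2 * a).
    by rewrite -byparts mulrAC mulfV ?mul1r// mulf_neq0// gt_eqF.
  field; exact: lt0r_neq0.
have := is_derive_0_is_cst k 0 dQ; rewrite /Q expr0n mul0r expR0 mulr1 => QE.
have F0 : F 0 = Num.sqrt (pi / a) * cos t.
  rewrite /F; under eq_Rintegral do rewrite mul0r add0r.
  by rewrite RintegralZr ?Rintegral_gauss//; exact: rintegrable_gauss.
rewrite -F0 -QE -mulrA -expRD addrN expR0 mulr1; exact: erefl.
Qed.

End gaussian.

(** * Uniqueness of the Fourier transform *)

Section product_integrable.
Context d1 d2 (T1 : measurableType d1) (T2 : measurableType d2) (R : realType).
Variables (m1 : {sigma_finite_measure set T1 -> \bar R})
  (m2 : {sigma_finite_measure set T2 -> \bar R}).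

Lemma rintegrable_prod (f : T1 -> R) (g : T2 -> R) :
  rintegrable m1 setT f -> rintegrable m2 setT g ->
  rintegrable (m1 \x m2)%E setT (fun p => f p.1 * g p.2).
Proof.
move=> intf intg.
have mf := rintegrable_measurable measurableT intf.
have mg := rintegrable_measurable measurableT intg.
have nf := rintegrable_norm intf; have ng := rintegrable_norm intg.
apply/integrable12ltyP.
  apply/measurable_EFinP; apply: measurable_funM.
    exact: (measurableT_comp mf measurable_fst).
  exact: (measurableT_comp mg measurable_snd).
have e x : (\int[m2]_y `|(EFin \o (fun p => f p.1 * g p.2)%R) (x, y)| =
    (`|f x| * \int[m2]_y `|g y|)%:E)%E.
  rewrite EFinM -(rintegrableE ng) -integralZl//.
  by apply: eq_integral => y _; rewrite /= normrM EFinM.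
under eq_integral do rewrite e.
apply: rintegrable_lty; under eq_fun do rewrite mulrC; exact: rintegrableZ.
Qed.

Lemma Rintegral_prodE (F : T1 * T2 -> R) : rintegrable (m1 \x m2)%E setT F ->
  (forall x, rintegrable m2 setT (fun y => F (x, y))) ->
  \int[(m1 \x m2)%E]_p F p = \int[m1]_x \int[m2]_y F (x, y).
Proof.
move=> intF i1; rewrite /Rintegral -(integral12_prod_meas1 intF); congr fine.
by apply: eq_integral => x _; rewrite fineK ?integrable_fin_num//; exact: i1.
Qed.

Lemma Rintegral_fubini (F : T1 * T2 -> R) : rintegrable (m1 \x m2)%E setT F ->
  (forall x, rintegrable m2 setT (fun y => F (x, y))) ->
  (forall y, rintegrable m1 setT (fun x => F (x, y))) ->
  \int[m1]_x \int[m2]_y F (x, y) = \int[m2]_y \int[m1]_x F (x, y).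
Proof.
move=> intF i1 i2; rewrite -Rintegral_prodE// /Rintegral -(integral21_prod_meas1 intF).
congr fine; apply: eq_integral => y _.
by rewrite fineK ?integrable_fin_num//; exact: i2.
Qed.

End product_integrable.

Section fourier_uniqueness.
Variable R : realType.
Local Notation mu := (@lebesgue_measure R).
Implicit Types (a u v p q k t : R) (f : R -> R).

Lemma gauss_sym a u v : gauss a u v = gauss a v u.
Proof. by rewrite /gauss -(sqrrN (v - u)) opprB. Qed.

Lemma gauss_le1 a u v : 0 <= a -> gauss a u v <= 1.
Proof.
by move=> a0; rewrite /gauss expRN invf_le1 ?expR_gt0// (le_trans _ (expR_ge1Dx _))// lerDl mulr_ge0 ?sqr_ge0.
Qed.

Lemma measurable_gauss a m : measurable_fun setT (@gauss R a m).
Proof. by apply: continuous_measurable_fun; exact: continuous_gauss. Qed.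

(** At distance [e] or more from [u], half of the exponent contributes a factor at most
    [2 / (a * e ^+ 2)], and the other half is integrated; the constant 4 leaves room for
    [Num.sqrt 2 <= 2]. Relative to the total mass [Num.sqrt (pi / a)] the bound is of order [a^-1],
    so Gaussian means concentrate at [u]. *)
Lemma Rintegral_gauss_tail a u e (s : R -> R) : 0 < a -> 0 < e ->
  measurable_fun setT s -> (forall v, 0 <= s v <= 1) ->
  (forall v, `|v - u| < e -> s v = 0) ->
  \int[mu]_v (s v * gauss a u v) <= 4 / (a * e ^+ 2) * Num.sqrt (pi / a).
Proof.
move=> a0 e0 ms s01 se.
have ae : 0 < a / 2 * e ^+ 2 by rewrite !mulr_gt0 ?exprn_gt0.
have a2 : 0 < a / 2 by rewrite divr_gt0.
have le v : s v * gauss a u v <= 2 / (a * e ^+ 2) * gauss (a / 2) u v.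
  have [lt|ge] := ltP `|v - u| e.
    by rewrite se// mul0r mulr_ge0 ?gauss_ge0// divr_ge0// mulr_ge0 ?sqr_ge0// ltW.
  have {s01} /andP[s0 s1] := s01 v.
  apply: (@le_trans _ _ (gauss a u v)); first by rewrite ler_piMl ?gauss_ge0.
  have -> : gauss a u v = gauss (a / 2) u v * gauss (a / 2) u v.
    by rewrite /gauss -expRD; congr expR; field.
  rewrite ler_wpM2r ?gauss_ge0// /gauss expRN -[leRHS]invrK lef_pV2 ?posrE ?expR_gt0//; last first.
    by rewrite invr_gt0 divr_gt0// mulr_gt0 ?exprn_gt0.
  apply: le_trans (expR_ge1Dx _).
  have eq1 : (2 / (a * e ^+ 2))^-1 = a / 2 * e ^+ 2 by field; rewrite !gt_eqF.
  rewrite eq1; apply: (@le_trans _ _ (a / 2 * (v - u) ^+ 2)).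
    rewrite ler_pM2l// -[leRHS]real_normK ?num_real//.
    by rewrite ler_pXn2r ?nnegrE// ltW.
  by rewrite lerDr.
have i1 : rintegrable mu setT (fun v => s v * gauss a u v).
  apply: rintegrable_le (rintegrable_gauss u a0) _ => //.
    by apply: measurable_funM => //; exact: measurable_gauss.
  move=> v _; have /andP[s0 s1] := s01 v.
  by rewrite ger0_norm ?mulr_ge0 ?gauss_ge0// ler_piMl ?gauss_ge0.
have i2 : rintegrable mu setT (fun v => 2 / (a * e ^+ 2) * gauss (a / 2) u v).
  by apply: rintegrableZ => //; exact: rintegrable_gauss.
apply: (le_trans (le_Rintegral measurableT i1 i2 (fun v _ => le v))).
rewrite RintegralZl//; last exact: rintegrable_gauss.
rewrite Rintegral_gauss//.
rewrite (_ : 4 / (a * e ^+ 2) = 2 / (a * e ^+ 2) * 2); last by rewrite mulrAC -natrM.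
rewrite -mulrA ler_wpM2l//.
  by rewrite divr_ge0// mulr_ge0 ?sqr_ge0 ?ltW.
rewrite (_ : pi / (a / 2) = 2 * (pi / a)); last by field; rewrite gt_eqF.
rewrite sqrtrM// ler_wpM2r ?sqrtr_ge0//.
by rewrite -(ler_pXn2r (n := 2)) ?nnegrE ?sqrtr_ge0// sqr_sqrtr// expr2; lra.
Qed.

(** A Gaussian is a superposition of cosines with Gaussian weight, so Fubini's theorem reduces its
    integral against [f] to integrals that vanish by hypothesis. *)
Lemma Rintegral_mul_gauss_eq0 f a v : 0 < a -> rintegrable mu setT f ->
  (forall k t, \int[mu]_u (f u * cos (k * u + t)) = 0) ->
  \int[mu]_u (f u * gauss a v u) = 0.
Proof.
move=> a0 intf f0.
(* Since [4 * b = a^-1], the transform of a weight with exponent [b] is, up to a constant, the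
   Gaussian with exponent [a]. *)
pose b := (4 * a)^-1.
have b0 : 0 < b by rewrite invr_gt0 mulr_gt0.
pose F (p : R * R) := gauss b 0 p.1 * f p.2 * cos ((p.2 - v) * (p.1 - 0) + 0).
have cos1 (x : R) : `|cos x| <= 1 by rewrite ler_norml cos_geN1 cos_le1.
have mf := rintegrable_measurable measurableT intf.
have mcos : measurable_fun setT (@cos R).
  exact: continuous_measurable_fun (@continuous_cos R).
have Fle (p : R * R) : `|F p| <= `|gauss b 0 p.1 * f p.2|.
  by rewrite /F normrM ler_piMr.
have mF : measurable_fun setT F.
  apply: measurable_funM.
    apply: measurable_funM; first exact: (measurableT_comp (measurable_gauss b 0) measurable_fst).
    exact: (measurableT_comp mf measurable_snd).
  apply: (measurableT_comp mcos); apply: measurable_funD => //.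
  by apply: measurable_funM; apply: measurable_funB.
have iF : rintegrable (mu \x mu)%E setT F.
  have ip := rintegrable_norm (rintegrable_prod (rintegrable_gauss 0 b0) intf).
  by apply: rintegrable_le ip _.
have i1 y : rintegrable mu setT (fun u => F (y, u)).
  apply: rintegrable_le (rintegrable_norm (rintegrableZ (gauss b 0 y) measurableT intf)) _ => //.
  exact: (measurableT_comp mF (pair1_measurable y)).
have i2 u : rintegrable mu setT (fun y => F (y, u)).
  apply: rintegrable_le (rintegrable_norm (rintegrableZ (f u) measurableT (rintegrable_gauss 0 b0))) _ => //.
    exact: (measurableT_comp mF (pair2_measurable u)).
  by move=> y _; rewrite [f u * _]mulrC.
have := Rintegral_fubini iF i1 i2.
have -> : \int[mu]_y \int[mu]_u F (y, u) = 0.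
  rewrite -[RHS](mul0r (fine (mu setT))) -(Rintegral_cst mu measurableT 0).
  apply: eq_Rintegral => y _.
  transitivity (gauss b 0 y * \int[mu]_u (f u * cos (y * u + - (v * y)))); last first.
    by rewrite f0 mulr0.
  rewrite -RintegralZl//; last first.
    apply: rintegrable_le (rintegrable_norm intf) _ => //.
      by apply: measurable_funM => //; apply: (measurableT_comp mcos);
        apply: measurable_funD => //; apply: measurable_funM.
    by move=> u _ /=; rewrite normrM ler_piMr.
  by apply: eq_Rintegral => u _; rewrite /F mulrA; congr (_ * cos _); rewrite /=; ring.
move/esym => e.
have sb : Num.sqrt (pi / b) != 0 by rewrite sqrtr_eq0 -ltNge divr_gt0// pi_gt0.
apply: (mulfI sb); rewrite mulr0 -e -RintegralZl//; last first.
  apply: rintegrable_le (rintegrable_norm intf) _ => //.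
    by apply: measurable_funM => //; exact: measurable_gauss.
  move=> u _ /=; rewrite normrM ler_piMr// ger0_norm ?gauss_ge0// gauss_le1// ltW//.
apply: eq_Rintegral => u _.
transitivity (f u * \int[mu]_y (gauss b 0 y * cos ((u - v) * (y - 0) + 0))).
  rewrite Rintegral_gauss_cos// cos0 mulr1 /gauss mulrCA; congr (_ * (_ * expR _)).
  by rewrite /b; field; rewrite gt_eqF.
rewrite -RintegralZl//; last first.
  apply: rintegrable_le (rintegrable_gauss 0 b0) _ => //.
    apply: measurable_funM => //; first exact: measurable_gauss.
    apply: (measurableT_comp mcos); apply: measurable_funD => //.
    by apply: measurable_funM => //; apply: measurable_funB.
  by move=> y _ /=; rewrite normrM (ger0_norm (gauss_ge0 _ _ _)) ler_piMr// gauss_ge0.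
by apply: eq_Rintegral => y _; rewrite /F /=; ring.
Qed.

(** The indicator [I] of the interval is approximated by its Gaussian means [W a]. They integrate to
    0 against [f] by Fubini's theorem, lie between 0 and 1, and tend to [I] off the two end points,
    so dominated convergence applies. *)
Lemma Rintegral_itv_eq0 f p q : p < q -> rintegrable mu setT f ->
  (forall a v, 0 < a -> \int[mu]_u (f u * gauss a v u) = 0) ->
  \int[mu]_(u in `]p, q[) f u = 0.
Proof.
move=> pq intf f0.
have mf := rintegrable_measurable measurableT intf.
pose I : R -> R := \1_(`]p, q[%classic).
have mI : measurable_fun setT I by exact: measurable_indic.
have I01 v : 0 <= I v <= 1 by rewrite /I indicE; case: (_ \in _); rewrite ?lexx ler01.
have iI : rintegrable mu setT I.
  apply/integrableP; split; first exact/measurable_EFinP.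
  under eq_integral => v _ do rewrite /= ger0_norm ?(andP (I01 v)).1//.
  rewrite integral_indic// setIT.
  have : (mu `]p, q[%classic = (q - p)%:E)%E by rewrite lebesgue_measure_itv/= lte_fin pq.
  by move=> e; suff : (mu `]p, q[%classic < +oo)%E by []; rewrite e ltry.
pose W a u := (Num.sqrt (pi / a))^-1 * \int[mu]_v (I v * gauss a u v).
have iIg a u : 0 < a -> rintegrable mu setT (fun v => I v * gauss a u v).
  move=> a0; apply: rintegrable_le (rintegrable_gauss u a0) _ => //.
    by apply: measurable_funM => //; exact: measurable_gauss.
  move=> v _; have /andP[s0 s1] := I01 v.
  by rewrite ger0_norm ?mulr_ge0 ?gauss_ge0// ler_piMl ?gauss_ge0.
have sq0 a : 0 < a -> 0 < Num.sqrt (pi / a).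
  by move=> a0; rewrite sqrtr_gt0 divr_gt0// pi_gt0.
have W01 a u : 0 < a -> 0 <= W a u <= 1.
  move=> a0; rewrite /W mulr_ge0/=; last 2 first.
  - by rewrite invr_ge0 ltW// sq0.
  - by apply: Rintegral_ge0 => v _; rewrite mulr_ge0 ?gauss_ge0// (andP (I01 v)).1.
  rewrite mulrC ler_pdivrMr ?sq0// mul1r -(Rintegral_gauss u a0).
  apply: le_Rintegral => //; [exact: iIg|exact: rintegrable_gauss|].
  by move=> v _; rewrite ler_piMl ?gauss_ge0// (andP (I01 v)).2.
have fW a : 0 < a -> rintegrable mu setT (fun u => f u * W a u) /\
    \int[mu]_u (f u * W a u) = 0.
  move=> a0.
  pose F (z : R * R) := I z.1 * f z.2 * gauss a z.2 z.1.
  have mF : measurable_fun setT F.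
    apply: measurable_funM.
      apply: measurable_funM; first exact: (measurableT_comp mI measurable_fst).
      exact: (measurableT_comp mf measurable_snd).
    rewrite /gauss; apply: (measurableT_comp (@measurable_expR R)).
    apply: measurableT_comp => //; apply: measurable_funM => //.
    by apply: measurable_funX; apply: measurable_funB.
  have iF : rintegrable (mu \x mu)%E setT F.
    apply: rintegrable_le (rintegrable_norm (rintegrable_prod iI intf)) _ => //.
    move=> z _; rewrite /F normrM ler_piMr// ger0_norm ?gauss_ge0//.
    by rewrite gauss_le1// ltW.
  have i1 v : rintegrable mu setT (fun u => F (v, u)).
    apply: rintegrable_le (rintegrable_norm (rintegrableZ (I v) measurableT intf)) _ => //.
      exact: (measurableT_comp mF (pair1_measurable v)).
    move=> u _; rewrite /F/= normrM ler_piMr// ger0_norm ?gauss_ge0//.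
    by rewrite gauss_le1// ltW.
  have i2 u : rintegrable mu setT (fun v => F (v, u)).
    apply: eq_rintegrable (rintegrableZ (f u) measurableT (iIg a u a0)) => //.
    by move=> v _; rewrite /F/=; ring.
  have FE u : \int[mu]_v F (v, u) = Num.sqrt (pi / a) * (f u * W a u).
    transitivity (f u * \int[mu]_v (I v * gauss a u v)).
      rewrite -RintegralZl//; last exact: iIg.
      by apply: eq_Rintegral => v _; rewrite /F/=; ring.
    by rewrite /W; field; rewrite gt_eqF ?sq0.
  have ifW : rintegrable mu setT (fun u => f u * W a u).
    have mG : measurable_fun setT (fun u => \int[mu]_v F (v, u)).
      by apply: measurableT_comp => //; exact: (measurable_fubini_G iF).
    apply: rintegrable_le (rintegrable_norm intf) _ => //.
      rewrite (_ : (fun u => _) = fun u => (Num.sqrt (pi / a))^-1 * \int[mu]_v F (v, u)).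
        by apply: measurable_funM => //; exact: measurable_cst.
      by apply/funext => u; rewrite FE mulKf// gt_eqF ?sq0.
    move=> u _; have /andP[w0 w1] := W01 a u a0.
    by rewrite normrM ler_piMr// ger0_norm.
  split=> //.
  apply: (@mulfI _ (Num.sqrt (pi / a))); first by rewrite gt_eqF ?sq0.
  rewrite mulr0 -RintegralZl//.
  have e0 : \int[mu]_v \int[mu]_u F (v, u) = 0.
    rewrite -[RHS](mul0r (fine (mu setT))) -(Rintegral_cst mu measurableT 0).
    apply: eq_Rintegral => v _; rewrite -[RHS](mulr0 (I v)) -(f0 a v a0) -RintegralZl//.
      by apply: eq_Rintegral => u _; rewrite /F/= gauss_sym; ring.
    apply: rintegrable_le (rintegrable_norm intf) _ => //.
      by apply: measurable_funM => //; exact: measurable_gauss.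
    by move=> u _ /=; rewrite normrM ler_piMr// ger0_norm ?gauss_ge0// gauss_le1// ltW.
  rewrite (Rintegral_fubini iF i1 i2) in e0.
  by rewrite -[RHS]e0; apply: eq_Rintegral => u _; rewrite FE.
pose an (n : nat) : R := n.+1%:R.
have an0 n : 0 < an n by rewrite ltr0n.
have tail u e (s : R -> R) : 0 < e -> measurable_fun setT s ->
    (forall v, 0 <= s v <= 1) -> (forall v, `|v - u| < e -> s v = 0) ->
    (Num.sqrt (pi / an n))^-1 * \int[mu]_v (s v * gauss (an n) u v) @[n --> \oo] --> (0 : R).
  move=> e0 ms s01 se.
  have cv : 4 / e ^+ 2 * harmonic n @[n --> \oo] --> (0 : R).
    by rewrite -(mulr0 (4 / e ^+ 2)); apply: cvgZr; exact: cvg_harmonic.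
  apply: squeeze_cvgr (cvg_cst (0 : R)) cv; apply: nearW => n.
  rewrite mulr_ge0/=; last 2 first.
  - by rewrite invr_ge0 sqrtr_ge0.
  - by apply: Rintegral_ge0 => v _; rewrite mulr_ge0 ?gauss_ge0// (andP (s01 v)).1.
  rewrite mulrC ler_pdivrMr ?sq0//.
  apply: le_trans (Rintegral_gauss_tail (an0 n) e0 ms s01 se) _.
  rewrite (_ : 4 / e ^+ 2 * harmonic n = 4 / (an n * e ^+ 2))//.
  by rewrite /harmonic/= /an; field; rewrite !gt_eqF.
(* Near [u] either [1 - I] or [I] vanishes, so the Gaussian mass that it carries is a tail. *)
have WI u : u != p -> u != q -> W (an n) u @[n --> \oo] --> I u.
  move=> up uq; have [uI|uI] := boolP (u \in `]p, q[).
    have -> : I u = 1 by rewrite /I indicE mem_set.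
    have /andP[pu uq'] : p < u < q by rewrite in_itv/= in uI.
    pose e := Num.min (u - p) (q - u).
    have e0 : 0 < e by rewrite lt_min !subr_gt0 pu.
    have -> : (fun n => W (an n) u) = fun n => 1 -
        (Num.sqrt (pi / an n))^-1 * \int[mu]_v ((1 - I v) * gauss (an n) u v).
      apply/funext => n.
      have -> : \int[mu]_v ((1 - I v) * gauss (an n) u v) =
          Num.sqrt (pi / an n) - \int[mu]_v (I v * gauss (an n) u v).
        rewrite -(Rintegral_gauss u (an0 n)) -RintegralB//.
        - by apply: eq_Rintegral => v _; rewrite mulrBl mul1r.
        - exact: rintegrable_gauss.
        - exact: iIg.
      by rewrite mulrBr mulVf ?gt_eqF ?sq0// opprB addrC subrK.
    rewrite -[X in _ --> X]subr0; apply: cvgB; first exact: cvg_cst.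
    apply: (tail _ e) => //.
    - by apply: measurable_funB => //; exact: measurable_cst.
    - by move=> v; have /andP[i0 i1] := I01 v; rewrite subr_ge0 i1 lerBlDr lerDl.
    - move=> v; rewrite ltr_norml lt_min => lt.
      rewrite /I indicE mem_set ?subrr//= in_itv/=.
      by move: lt; rewrite /e ltrNl lt_min => /andP[/andP[h1 h2] /andP[h3 h4]]; apply/andP; split; lra.
  have -> : I u = 0 by rewrite /I indicE memNset//; apply/negP.
  pose e := Num.min `|u - p| `|u - q|.
  have e0 : 0 < e by rewrite lt_min !normr_gt0 !subr_eq0 up.
  apply: (tail _ e) => // v lt.
  rewrite /I indicE memNset//= in_itv/= => /andP[pv vq].
  move: lt; rewrite /e lt_min => /andP[]; move: uI; rewrite in_itv/= negb_and -!leNgt.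
  move=> /orP[h|h]; rewrite ltr_norml => /andP[l1 l2]; rewrite ltr_norml => /andP[l3 l4].
    by move: l2; rewrite ler0_norm ?subr_le0//; lra.
  by move: l3; rewrite ger0_norm ?subr_ge0//; lra.
have iFI : \int[mu]_(u in `]p, q[) f u = \int[mu]_u (f u * I u).
  rewrite Rintegral_mkcond; apply: eq_Rintegral => u _.
  by rewrite patchE /I indicE; case: ifP => _; rewrite ?mulr1 ?mulr0.
rewrite iFI.
have aeWI : {ae mu, forall u, f u * W (an n) u @[n --> \oo] --> f u * I u}.
  have : mu.-negligible ([set p] `|` [set q]).
    by apply: negligibleU; apply/negligibleP => //; exact: lebesgue_measure_set1.
  apply: negligibleS => u /= h; have [->|up] := eqVneq u p; first by left.
  right; have [//|uq] := eqVneq u q; exfalso; apply: h.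
  by apply: cvgZr; exact: WI.
have mfW n : measurable_fun setT (fun u => f u * W (an n) u).
  exact: rintegrable_measurable measurableT (fW _ (an0 n)).1.
have mfI : measurable_fun setT (fun u => f u * I u) by exact: measurable_funM.
have fWle n u : `|f u * W (an n) u| <= `|f u|.
  have /andP[w0 w1] := W01 _ u (an0 n).
  by rewrite normrM ler_piMr// ger0_norm.
have [_ cv] := @Rintegral_ae_dominated_cvg _ _ _ mu _ _ _ mfW mfI aeWI (rintegrable_norm intf) fWle.
have e0 n : \int[mu]_u (f u * W (an n) u) = 0 by rewrite (fW _ (an0 n)).2.
have cv0 : \int[mu]_u (f u * W (an n) u) @[n --> \oo] --> (0 : R).
  under eq_fun do rewrite e0; exact: cvg_cst.
exact: cvg_unique cv cv0.
Qed.

(** Means of [f] over intervals vanish, so at a Lebesgue point [x] the modulus of [f x] is at most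
    the mean of the modulus of [f - f x] over small balls, which tends to 0. *)
Lemma fourier_uniqueness f : rintegrable mu setT f ->
  (forall k t, \int[mu]_u (f u * cos (k * u + t)) = 0) ->
  {ae mu, forall u, f u = 0}.
Proof.
move=> intf f0.
have itv0 p q : p < q -> \int[mu]_(u in `]p, q[) f u = 0.
  by move=> pq; apply: Rintegral_itv_eq0 => // a v a0; exact: Rintegral_mul_gauss_eq0.
have := lebesgue_differentiation (open_integrable_locally openT intf).
apply: negligibleS => x /= nf lp; apply: nf; move: lp; rewrite /lebesgue_pt => cv.
apply/eqP; rewrite -normr_eq0 eq_le normr_ge0 andbT -lee_fin.
rewrite -[leRHS](cvg_lim _ cv)//; apply: lime_ge; first by apply/cvg_ex; exists 0%E.
near=> r.
have r0 : 0 < r by near: r; exact: nbhs_right_gt.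
have BE : ball x r = `]x - r, x + r[%classic by rewrite ball_itv.
have mB : measurable (ball x r) by rewrite BE.
have r2 : 0 < r *+ 2 by rewrite mulrn_wgt0.
have muB : (mu (ball x r) = (r *+ 2)%:E)%E by rewrite lebesgue_measure_ball// ltW.
have iB : rintegrable mu (ball x r) f by apply: integrableS intf.
have iC : rintegrable mu (ball x r) (fun=> f x).
  apply/integrableP; split; first exact/measurable_EFinP/measurable_cst.
  rewrite integral_cst//; apply: lte_mul_pinfty => //.
  by have := ltry (r *+ 2); rewrite -muB.
have iD : rintegrable mu (ball x r) (fun y => `|f y - f x|).
  by apply: rintegrable_norm; exact: rintegrableB.
have -> : davg f x r = ((r *+ 2)^-1 * \int[mu]_(y in ball x r) `|f y - f x|)%:E.
  rewrite /davg /iavg muB inver gt_eqF// EFinM; congr (_ * _)%E.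
  by rewrite /Rintegral fineK// integrable_fin_num.
rewrite lee_fin mulrC ler_pdivlMr//.
have -> : `|f x| * (r *+ 2) = `|\int[mu]_(y in ball x r) (f y - f x)|.
  have e1 : \int[mu]_(y in ball x r) f x = f x * (r *+ 2).
    by rewrite Rintegral_cst//; congr (_ * _); exact: (congr1 fine muB).
  have e2 : \int[mu]_(y in ball x r) f y = 0 by rewrite BE itv0//; lra.
  by rewrite RintegralB// e1 e2 sub0r normrN normrM (gtr0_norm r2).
by apply: le_normr_Rintegral => //; exact: rintegrableB.
Unshelve. all: end_near. Qed.

End fourier_uniqueness.

(** * Green's formula *)

Section plane.
Variable R : realType.
Local Notation mu := (@lebesgue_measure R).
Local Notation mu2 := (@lebesgue_measure R \x @lebesgue_measure R)%E.
Implicit Types (A B f g : R -> R -> R) (a b c d p q x y e : R).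

Definition continuous2 f := forall p q e, 0 < e -> exists2 d, 0 < d &
  forall x y, `|x - p| < d -> `|y - q| < d -> `|f x y - f p q| <= e.

(** Total differentiability at a single point, with gradient [(a, b)]; the sum norm suits boxes,
    whose sides bound the two coordinates separately. *)
Definition diff_at f p q a b := forall e, 0 < e -> exists2 d, 0 < d &
  forall x y, `|x - p| < d -> `|y - q| < d ->
    `|f x y - f p q - (a * (x - p) + b * (y - q))| <= e * (`|x - p| + `|y - q|).

(** Superlevel sets are open, hence countable unions of squares with rational centres and radii
    [n.+1%:R^-1], which lie in the product sigma-algebra. *)
Lemma continuous2_measurable f : continuous2 f ->
  measurable_fun setT (fun z : R * R => f z.1 z.2).
Proof.
move=> cf; apply: (measurability _ (RGenOInfty.measurableE R)).
move=> _ [_ [a ->] <-]; rewrite setTI.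
pose box (r s : rat) (n : nat) : set (R * R) :=
  ball (ratr r : R) n.+1%:R^-1 `*` ball (ratr s : R) n.+1%:R^-1.
set U := _ @^-1` _.
suff -> : U = \bigcup_(r in [set: rat]) \bigcup_(s in [set: rat])
    \bigcup_(n in [set: nat]) (if `[< box r s n `<=` U >] then box r s n else set0).
  apply: bigcupT_measurable_rat => r; apply: bigcupT_measurable_rat => s.
  apply: bigcupT_measurable => n; case: asboolP => _; last exact: measurable0.
  by apply: measurableX; exact: measurable_ball.
apply/seteqP; split; last first.
  by move=> z [r _ [s _ [n _]]]; case: asboolP => [h|//]; exact: h.
move=> [p q]; rewrite /U /= in_itv/= andbT => ltaf.
have e0 : 0 < (f p q - a) / 2 by rewrite divr_gt0// subr_gt0.
have [d d0 hd] := cf p q _ e0.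
have d2 : 0 < d / 2 by rewrite divr_gt0.
have [N _ hN] := near_infty_natSinv_lt (PosNum d2).
have {hN} := hN N (leqnn N); rewrite /=.
have n0 : 0 < N.+1%:R^-1 :> R by rewrite invr_gt0.
set n := N.+1%:R^-1 in n0 * => nd.
have [r] := @rat_in_itvoo R (p - n) (p + n) ltac:(lra).
rewrite in_itv/= => /andP[r1 r2].
have [s] := @rat_in_itvoo R (q - n) (q + n) ltac:(lra).
rewrite in_itv/= => /andP[s1 s2].
exists r => //; exists s => //; exists N => //.
case: asboolP => [_|].
  by split; rewrite /ball/= -/n ltr_norml; apply/andP; split; lra.
case=> -[x y] [] /=; rewrite /ball/= -/n !ltr_norml => /andP[x1 x2] /andP[y1 y2].
rewrite in_itv/= andbT.
have xp : `|x - p| < d by rewrite ltr_norml; apply/andP; split; lra.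
have yq : `|y - q| < d by rewrite ltr_norml; apply/andP; split; lra.
by have := hd x y xp yq; rewrite ler_norml => /andP[h1 h2]; lra.
Qed.

Lemma diff_at_continuous2 f : (forall p q, exists a b, diff_at f p q a b) ->
  continuous2 f.
Proof.
move=> df p q e e0; have [a [b dab]] := df p q.
have [d d0 hd] := dab 1 ltr01.
pose M := 2 + `|a| + `|b|.
have M0 : 0 < M by rewrite /M -addrA ltr_wpDr// addr_ge0.
exists (Num.min d (e / (2 * M))); first by rewrite lt_min d0 divr_gt0// mulr_gt0.
move=> x y; rewrite !lt_min => /andP[xd xe] /andP[yd ye].
have := hd x y xd yd; rewrite mul1r => h.
rewrite -(subrK (a * (x - p) + b * (y - q)) (_ - _)).
apply: (le_trans (ler_normD _ _)); apply: (le_trans (lerD h (ler_normD _ _))).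
rewrite !normrM.
have a0 := normr_ge0 a; have b0 := normr_ge0 b.
have x0 := normr_ge0 (x - p); have y0 := normr_ge0 (y - q).
have [k kE] : exists k, k = e / (2 * M) by eexists.
have ek : e = k * (2 * M) by rewrite kE divfK// gt_eqF// mulr_gt0.
rewrite -kE in xe ye; rewrite ek /M.
move: (`|a|) (`|b|) (`|x - p|) (`|y - q|) a0 b0 x0 y0 xe ye => a' b' x' y' *.
nra.
Qed.

Lemma continuous2_x f y : continuous2 f -> continuous (f^~ y).
Proof.
move=> cf x; apply/cvgrPdist_le => e e0; have [d d0 hd] := cf x y e e0.
apply/nbhs_ballP; exists d => //= z; rewrite /ball/= => xz.
by rewrite distrC hd ?subrr ?normr0// distrC.
Qed.

Lemma continuous2_y f x : continuous2 f -> continuous (f x).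
Proof.
move=> cf y; apply/cvgrPdist_le => e e0; have [d d0 hd] := cf x y e e0.
apply/nbhs_ballP; exists d => //= z; rewrite /ball/= => yz.
by rewrite distrC hd ?subrr ?normr0// distrC.
Qed.

Lemma Rintegral_near_cst (disp : measure_display) (T : measurableType disp)
    (m : {measure set T -> \bar R})
    (D : set T) (f : T -> R) (k M v : R) :
  measurable D -> (m D = v%:E)%E -> rintegrable m D f ->
  (forall t, D t -> `|f t - k| <= M) ->
  `|\int[m]_(t in D) f t - k * v| <= M * v.
Proof.
move=> mD mv intf fk.
have ic (r : R) : rintegrable m D (fun=> r).
  apply/integrableP; split; first exact/measurable_EFinP/measurable_cst.
  by rewrite integral_cst// mv -EFinM ltry.
have cst (r : R) : \int[m]_(t in D) r = r * v by rewrite Rintegral_cst// mv.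
rewrite -(cst k) -(RintegralB mD intf (ic k)) -(cst M).
apply: le_trans (le_normr_Rintegral mD _) _; first exact: rintegrableB.
apply: le_Rintegral => //; last exact: ic.
by apply: rintegrable_norm; exact: rintegrableB.
Qed.

(** Half-open, so that the pieces of a subdivided box are disjoint and exhaust it. *)
Definition ibox a b c d : set (R * R) := `]a, b]%classic `*` `]c, d]%classic.

Lemma measurable_ibox a b c d : measurable (ibox a b c d).
Proof. by apply: measurableX; exact: measurable_itv. Qed.

Lemma ibox_measure a b c d : a <= b -> c <= d ->
  (mu2 (ibox a b c d) = ((b - a) * (d - c))%:E)%E.
Proof.
move=> ab cd.
have h (p q : R) : p <= q -> (mu `]p, q]%classic = (q - p)%:E)%E.
  move=> pq; rewrite lebesgue_measure_itv/= lte_fin.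
  by case: ltgtP pq => [//|//|->] _; rewrite ?subrr.
transitivity (mu `]a, b]%classic * mu `]c, d]%classic)%E; last by rewrite !h.
by apply: product_measure1E; exact: measurable_itv.
Qed.

Lemma rintegrable_itv (f : R -> R) a b : continuous f -> rintegrable mu `]a, b]%classic f.
Proof.
move=> cf; apply: (@integrableS _ _ _ mu `[a, b]%classic) => //.
- exact: subset_itv_oc_cc.
- apply: continuous_compact_integrable; first exact: segment_compact.
  exact: continuous_subspaceT.
Qed.

Lemma Rintegral_itv_split (f : R -> R) a m b : a <= m -> m <= b -> continuous f ->
  \int[mu]_(x in `]a, b]) f x =
  \int[mu]_(x in `]a, m]) f x + \int[mu]_(x in `]m, b]) f x.
Proof.
move=> am mb cf; rewrite -Rintegral_setU//.
- by rewrite -itv_bndbnd_setU.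
- rewrite -itv_bndbnd_setU//; exact: rintegrable_itv.
- apply: lt_disjoint => x y; rewrite !in_itv/= => /andP[_ xm] /andP[my _].
  exact: le_lt_trans xm my.
Qed.

Section green.
Variables A B g : R -> R -> R.
Hypothesis diffA : forall p q, exists a1 a2 b1 b2,
  [/\ diff_at A p q a1 a2, diff_at B p q b1 b2 & a1 + b2 = g p q].
Hypothesis cg : continuous2 g.

Let cA : continuous2 A.
Proof.
apply: diff_at_continuous2 => p q.
by have [a1 [a2 [_ [_ [h _ _]]]]] := diffA p q; exists a1, a2.
Qed.

Let cB : continuous2 B.
Proof.
apply: diff_at_continuous2 => p q.
by have [_ [_ [b1 [b2 [_ h _]]]]] := diffA p q; exists b1, b2.
Qed.

Let ibox_int a b c d := \int[mu2]_(z in ibox a b c d) g z.1 z.2.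

(** The flux of the field [(A, B)] out of the box minus the integral of its divergence [g]. *)
Definition green_defect a b c d :=
  \int[mu]_(y in `]c, d]) (A b y - A a y) +
  \int[mu]_(x in `]a, b]) (B x d - B x c) - ibox_int a b c d.

Let cAB a b : continuous (fun y => A b y - A a y).
Proof. by move=> y; apply: cvgB; exact: continuous2_y. Qed.
Let cBB c d : continuous (fun x => B x d - B x c).
Proof.
move=> x; apply: cvgB; first exact: (@continuous2_x B d cB x).
exact: (@continuous2_x B c cB x).
Qed.

(** The two fluxes through the common side [x = m] cancel. *)
Lemma green_defect_split1 a m b c d : a <= m -> m <= b ->
  rintegrable mu2 (ibox a b c d) (fun z => g z.1 z.2) ->
  green_defect a b c d = green_defect a m c d + green_defect m b c d.
Proof.
move=> am mb ig.
have boxE : ibox a b c d = ibox a m c d `|` ibox m b c d.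
  rewrite /ibox (@itv_bndbnd_setU _ _ (BRight a) (BRight m) (BRight b))//.
  apply/seteqP; split=> [[x y] [/= [h|h] h2]|[x y] [[h h2]|[h h2]]]; rewrite /=.
  - by left. - by right. - by split=> //; left. - by split=> //; right.
have disj : [disjoint ibox a m c d & ibox m b c d].
  rewrite disj_set2E; apply/eqP/seteqP; split=> // -[x y] [[/=]].
  rewrite !in_itv/= => /andP[_ xm] _ [/=]; rewrite !in_itv/= => /andP[mx _] _.
  by have := lt_le_trans mx xm; rewrite ltxx.
rewrite boxE in ig.
rewrite /green_defect /ibox_int boxE Rintegral_setU//; try exact: measurable_ibox.
rewrite (Rintegral_itv_split am mb)//.
have -> : \int[mu]_(y in `]c, d]) (A b y - A a y) =
    \int[mu]_(y in `]c, d]) (A m y - A a y) + \int[mu]_(y in `]c, d]) (A b y - A m y).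
  rewrite -RintegralD//; try exact: rintegrable_itv.
  by apply: eq_Rintegral => y _; ring.
ring.
Qed.

Lemma green_defect_split2 a b c m d : c <= m -> m <= d ->
  rintegrable mu2 (ibox a b c d) (fun z => g z.1 z.2) ->
  green_defect a b c d = green_defect a b c m + green_defect a b m d.
Proof.
move=> cm md ig.
have boxE : ibox a b c d = ibox a b c m `|` ibox a b m d.
  rewrite /ibox (@itv_bndbnd_setU _ _ (BRight c) (BRight m) (BRight d))//.
  apply/seteqP; split=> [[x y] [/= h [h2|h2]]|[x y] [[h h2]|[h h2]]]; rewrite /=.
  - by left. - by right. - by split=> //; left. - by split=> //; right.
have disj : [disjoint ibox a b c m & ibox a b m d].
  rewrite disj_set2E; apply/eqP/seteqP; split=> // -[x y] [[/=]] _.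
  rewrite !in_itv/= => /andP[_ xm] [/=] _; rewrite !in_itv/= => /andP[mx _].
  by have := lt_le_trans mx xm; rewrite ltxx.
rewrite boxE in ig.
rewrite /green_defect /ibox_int boxE Rintegral_setU//; try exact: measurable_ibox.
rewrite (Rintegral_itv_split cm md)//.
have -> : \int[mu]_(x in `]a, b]) (B x d - B x c) =
    \int[mu]_(x in `]a, b]) (B x m - B x c) + \int[mu]_(x in `]a, b]) (B x d - B x m).
  rewrite -RintegralD//; try exact: rintegrable_itv.
  by apply: eq_Rintegral => y _; ring.
ring.
Qed.

(** The affine parts of [A] and [B] at [(p, q)] have flux [g p q] times the area, so only the
    remainders and the oscillation of [g] contribute. The remainders are [e] times a length,
    integrated over sides of comparable length, which makes the bound [e] times an area. *)
Lemma green_defect_small a b c d p q e a1 a2 b1 b2 :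
  a <= p <= b -> c <= q <= d -> 0 <= e -> a1 + b2 = g p q ->
  rintegrable mu2 (ibox a b c d) (fun z => g z.1 z.2) ->
  (forall x y, a <= x <= b -> c <= y <= d ->
    [/\ `|A x y - A p q - (a1 * (x - p) + a2 * (y - q))| <= e * (`|x - p| + `|y - q|),
        `|B x y - B p q - (b1 * (x - p) + b2 * (y - q))| <= e * (`|x - p| + `|y - q|) &
        `|g x y - g p q| <= e]) ->
  `|green_defect a b c d| <= 3 * e * ((b - a) + (d - c)) ^+ 2.
Proof.
move=> /andP[ap pb] /andP[cq qd] e0 gE ig h.
have ab := le_trans ap pb; have cd := le_trans cq qd.
pose L := (b - a) + (d - c).
have near x y : a <= x <= b -> c <= y <= d -> `|x - p| + `|y - q| <= L.
  move=> /andP[x1 x2] /andP[y1 y2]; apply: lerD; rewrite ler_norml; apply/andP; split; lra.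
have aab : a <= a <= b by rewrite lexx.
have bab : a <= b <= b by rewrite lexx andbT.
have ccd : c <= c <= d by rewrite lexx.
have dcd : c <= d <= d by rewrite lexx andbT.
have mitv (s t : R) : s <= t -> (mu `]s, t]%classic = (t - s)%:E)%E.
  move=> st; rewrite lebesgue_measure_itv/= lte_fin.
  by case: ltgtP st => [//|//|->] _; rewrite ?subrr.
have eL x y : a <= x <= b -> c <= y <= d -> e * (`|x - p| + `|y - q|) <= e * L.
  by move=> hx hy; rewrite ler_wpM2l// near.
have e1 : `|\int[mu]_(y in `]c, d]) (A b y - A a y) - a1 * (b - a) * (d - c)|
    <= 2 * (e * L) * (d - c).
  apply: Rintegral_near_cst => //; [exact: mitv|exact: rintegrable_itv|].
  move=> y /=; rewrite in_itv/= => /andP[/ltW y1 y2].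
  have yy : c <= y <= d by rewrite y1.
  have [h1 _ _] := h b y bab yy; have [h2 _ _] := h a y aab yy.
  have := le_trans h1 (eL _ _ bab yy); have := le_trans h2 (eL _ _ aab yy).
  by rewrite !ler_norml => /andP[? ?] /andP[? ?]; apply/andP; split; lra.
have e2 : `|\int[mu]_(x in `]a, b]) (B x d - B x c) - b2 * (d - c) * (b - a)|
    <= 2 * (e * L) * (b - a).
  apply: Rintegral_near_cst => //; [exact: mitv|exact: rintegrable_itv|].
  move=> x /=; rewrite in_itv/= => /andP[/ltW x1 x2].
  have xx : a <= x <= b by rewrite x1.
  have [_ h1 _] := h x d xx dcd; have [_ h2 _] := h x c xx ccd.
  have := le_trans h1 (eL _ _ xx dcd); have := le_trans h2 (eL _ _ xx ccd).
  by rewrite !ler_norml => /andP[? ?] /andP[? ?]; apply/andP; split; lra.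
have e3 : `|ibox_int a b c d - g p q * ((b - a) * (d - c))| <= e * ((b - a) * (d - c)).
  apply: Rintegral_near_cst => //; [exact: measurable_ibox|exact: ibox_measure|].
  move=> [x y] [/=]; rewrite !in_itv/= => /andP[/ltW x1 x2] /andP[/ltW y1 y2].
  have xx : a <= x <= b by rewrite x1.
  have yy : c <= y <= d by rewrite y1.
  by have [_ _] := h x y xx yy.
rewrite /green_defect; move: e1 e2 e3.
set X := Rintegral _ _ _; set Y := Rintegral _ _ _; set Z := ibox_int _ _ _ _.
rewrite -gE -/L !ler_norml => /andP[? ?] /andP[? ?] /andP[? ?].
have s0 : 0 <= b - a by rewrite subr_ge0.
have t0 : 0 <= d - c by rewrite subr_ge0.
have key : 2 * (e * L) * (d - c) + 2 * (e * L) * (b - a) + e * ((b - a) * (d - c))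
    <= 3 * e * L ^+ 2.
  rewrite /L; move: (b - a) (d - c) s0 t0 => s t s0 t0.
  have := mulr_ge0 e0 (mulr_ge0 s0 t0); have := mulr_ge0 e0 (sqr_ge0 s).
  have := mulr_ge0 e0 (sqr_ge0 t); nra.
by apply/andP; split; lra.
Qed.

(* Goursat's argument: a box with non-zero defect contains a nested sequence
   of boxes whose defects are at least proportional to their areas, which
   contradicts the differentiability at their common point. *)
Theorem green_box a b c d : a <= b -> c <= d ->
  rintegrable mu2 (ibox a b c d) (fun z => g z.1 z.2) ->
  \int[mu]_(y in `]c, d]) (A b y - A a y) +
  \int[mu]_(x in `]a, b]) (B x d - B x c) =
  \int[mu2]_(z in ibox a b c d) g z.1 z.2.
Proof.
move=> ab cd ig; apply/eqP; rewrite -subr_eq0 -/(ibox_int a b c d).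
rewrite -/(green_defect a b c d); apply/eqP.
set D0 := green_defect a b c d.
pose w (n : nat) := (b - a) / 2 ^+ n; pose h (n : nat) := (d - c) / 2 ^+ n.
have p2 n : 0 < (2 : R) ^+ n by rewrite exprn_gt0.
have w0 n : 0 <= w n by rewrite divr_ge0 ?subr_ge0// ltW.
have h0 n : 0 <= h n by rewrite divr_ge0 ?subr_ge0// ltW.
have wS n : w n = w n.+1 + w n.+1 by rewrite /w exprS; field; rewrite gt_eqF.
have hS n : h n = h n.+1 + h n.+1 by rewrite /h exprS; field; rewrite gt_eqF.
pose box n (s : R * R) := ibox s.1 (s.1 + w n) s.2 (s.2 + h n).
pose def n (s : R * R) := green_defect s.1 (s.1 + w n) s.2 (s.2 + h n).
(* Each bisection cuts a box into four, and at least a quarter of the modulus of the defect survives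
   in one of them. *)
pose good n (s : R * R) := `|D0| / 4 ^+ n <= `|def n s| /\ box n s `<=` ibox a b c d.
pose step n (s s' : R * R) := [/\ good n.+1 s', s.1 <= s'.1 <= s.1 + w n.+1 &
  s.2 <= s'.2 <= s.2 + h n.+1].
have sub_int n s : good n s -> rintegrable mu2 (box n s) (fun z => g z.1 z.2).
  by move=> [_ sub]; apply: integrableS ig => //; exact: measurable_ibox.
have ex n s : good n s -> exists s', step n s s'.
  move=> gs; have [g1 g2] := gs; have is_ := sub_int _ _ gs.
  set x := s.1 in is_ *; set y := s.2 in is_ *.
  have sub x' y' : x <= x' <= x + w n.+1 -> y <= y' <= y + h n.+1 ->
      box n.+1 (x', y') `<=` ibox a b c d.
    move=> /andP[x1 x2] /andP[y1 y2] [u v] [/=].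
    rewrite !in_itv/= => /andP[u1 u2] /andP[v1 v2]; apply: g2; split; rewrite /= in_itv/=.
      by have wn := wS n; rewrite -/x; apply/andP; split; lra.
    by have hn := hS n; rewrite -/y; apply/andP; split; lra.
  have split4 : def n s = def n.+1 (x, y) + def n.+1 (x, y + h n.+1) +
      (def n.+1 (x + w n.+1, y) + def n.+1 (x + w n.+1, y + h n.+1)).
    rewrite /def /= -/x -/y.
    have wx : x + w n.+1 + w n.+1 = x + w n by rewrite (wS n) addrA.
    have hy : y + h n.+1 + h n.+1 = y + h n by rewrite (hS n) addrA.
    have xw : x <= x + w n.+1 by rewrite lerDl.
    have yh : y <= y + h n.+1 by rewrite lerDl.
    have xw' : x + w n.+1 <= x + w n by rewrite -wx lerDl.
    have yh' : y + h n.+1 <= y + h n by rewrite -hy lerDl.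
    rewrite wx hy (green_defect_split1 xw xw')//; congr (_ + _).
      rewrite (green_defect_split2 yh yh')//.
      apply: integrableS is_ => //; try exact: measurable_ibox.
      move=> [u v] [/=]; rewrite !in_itv/= => /andP[u1 u2] vv; split=> //=.
      by rewrite in_itv/= u1 (le_trans u2).
    rewrite (green_defect_split2 yh yh')//.
    apply: integrableS is_ => //; try exact: measurable_ibox.
    move=> [u v] [/=]; rewrite !in_itv/= => /andP[u1 u2] vv; split=> //=.
    by rewrite in_itv/= u2 andbT (le_lt_trans xw).
  pose D' := `|D0| / 4 ^+ n.+1.
  have DD' : `|D0| / 4 ^+ n = 4 * D' by rewrite /D' exprS; field; rewrite expf_neq0.
  have inx : x <= x <= x + w n.+1 by rewrite lexx lerDl w0.
  have inx' : x <= x + w n.+1 <= x + w n.+1 by rewrite lexx lerDl w0.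
  have iny : y <= y <= y + h n.+1 by rewrite lexx lerDl h0.
  have iny' : y <= y + h n.+1 <= y + h n.+1 by rewrite lexx lerDl h0.
  have [k1|k1] := leP D' `|def n.+1 (x, y)|.
    by exists (x, y); split=> //; split=> //; exact: sub.
  have [k2|k2] := leP D' `|def n.+1 (x, y + h n.+1)|.
    by exists (x, y + h n.+1); split=> //; split=> //; exact: sub.
  have [k3|k3] := leP D' `|def n.+1 (x + w n.+1, y)|.
    by exists (x + w n.+1, y); split=> //; split=> //; exact: sub.
  have [k4|k4] := leP D' `|def n.+1 (x + w n.+1, y + h n.+1)|.
    by exists (x + w n.+1, y + h n.+1); split=> //; split=> //; exact: sub.
  exfalso; rewrite DD' split4 in g1.
  move: k1 k2 k3 k4 g1.
  set u1 := def _ _; set u2 := def _ _; set u3 := def _ _; set u4 := def _ _.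
  have := ler_normD (u1 + u2) (u3 + u4); have := ler_normD u1 u2; have := ler_normD u3 u4.
  by move=> *; lra.
(* The step is chosen for all pairs at once; for a box that is not good its value is arbitrary. *)
have /choice[F hF] : forall ns : nat * (R * R), exists s', good ns.1 ns.2 -> step ns.1 ns.2 s'.
  move=> [n s]; have [gs|ngs] := pselect (good n s).
    by have [s' ?] := ex n s gs; exists s'.
  by exists s.
pose S := fix S (n : nat) : R * R := if n is m.+1 then F (m, S m) else (a, c).
have gS n : good n (S n).
  elim: n => [|n ih]; last by case: (hF (n, S n) ih).
  have wE : a + w 0%N = b by rewrite /w expr0 divr1 addrC subrK.
  have hE : c + h 0%N = d by rewrite /h expr0 divr1 addrC subrK.
  by split; rewrite /def /box /= ?wE ?hE// expr0 divr1.
have sS n : step n (S n) (S n.+1) by exact: (hF (n, S n) (gS n)).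
(* The supremum of the left end points is a common point, since every left end is at most every
   right end. *)
have nested_common_point (u v : nat -> R) : (forall n, v n = v n.+1 + v n.+1) -> (forall n, 0 <= v n) ->
    (forall n, u n <= u n.+1 <= u n + v n.+1) ->
    exists p, forall n, u n <= p <= u n + v n.
  move=> vS v0 us.
  have mono n k : u n <= u (n + k)%N /\ u (n + k)%N + v (n + k)%N <= u n + v n.
    elim: k => [|k [ih1 ih2]]; first by rewrite addn0 !lexx.
    have /andP[l1 l2] := us (n + k)%N; have := vS (n + k)%N.
    by rewrite addnS; split; lra.
  have le_all m n : u m <= u n + v n.
    have [l1 l2] := mono m (maxn m n - m)%N; have [l3 l4] := mono n (maxn m n - n)%N.
    rewrite subnKC ?leq_maxl// in l1 l2; rewrite subnKC ?leq_maxr// in l3 l4.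
    by have := v0 (maxn m n); lra.
  have hs : has_sup (range u).
    by split; [exists (u 0%N), 0%N|exists (u 0%N + v 0%N) => _ [m _ <-]].
  exists (sup (range u)) => n; apply/andP; split.
    by apply: sup_upper_bound => //; exists n.
  by apply: ge_sup => [|_ [m _ <-]//]; exists (u 0%N), 0%N.
have [p hp] : exists p, forall n, (S n).1 <= p <= (S n).1 + w n.
  by apply: nested_common_point => // n; case: (sS n).
have [q hq] : exists q, forall n, (S n).2 <= q <= (S n).2 + h n.
  by apply: nested_common_point => // n; case: (sS n).
have [a1 [a2 [b1 [b2 [dA dB gE]]]]] := diffA p q.
pose L := (b - a) + (d - c).
have L0 : 0 <= L by rewrite addr_ge0// subr_ge0.
(* At level [n] the sum of the sides is [L / 2 ^+ n], and its square cancels the [4 ^+ n] in the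
   lower bound for the defect. *)
have main e : 0 < e -> `|D0| <= 3 * e * L ^+ 2.
  move=> e0.
  have [d1 d10 h1] := dA _ e0; have [d2 d20 h2] := dB _ e0; have [d3 d30 h3] := cg p q e0.
  pose dd := Num.min d1 (Num.min d2 d3).
  have dd0 : 0 < dd by rewrite !lt_min d10 d20.
  have [n hn] : exists n : nat, L / 2 ^+ n < dd.
    have cv : L * 2^-1 ^+ n @[n --> \oo] --> (0 : R).
      by rewrite -(mulr0 L); apply: cvgZr; apply: cvg_expr; rewrite ger0_norm// invf_lt1// ltr1n.
    move/cvgrPdist_lt : cv => /(_ dd dd0)[n _ /(_ n (leqnn n))].
    rewrite /= sub0r normrN exprVn ger0_norm; first by exists n.
    by rewrite divr_ge0// ltW.
  have whL : w n + h n = L / 2 ^+ n by rewrite /w /h -mulrDl.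
  have near x y : (S n).1 <= x <= (S n).1 + w n -> (S n).2 <= y <= (S n).2 + h n ->
      `|x - p| < dd /\ `|y - q| < dd.
    have /andP[pl pr] := hp n; have /andP[ql qr] := hq n.
    have := w0 n; have := h0 n => hn0 wn0.
    move=> /andP[x1 x2] /andP[y1 y2]; split; rewrite ltr_norml; apply/andP; split; lra.
  have := @green_defect_small (S n).1 ((S n).1 + w n) (S n).2 ((S n).2 + h n) p q e
    a1 a2 b1 b2 (hp n) (hq n) (ltW e0) gE (sub_int _ _ (gS n)) _.
  have bound x y : (S n).1 <= x <= (S n).1 + w n -> (S n).2 <= y <= (S n).2 + h n ->
    [/\ `|A x y - A p q - (a1 * (x - p) + a2 * (y - q))| <= e * (`|x - p| + `|y - q|),
        `|B x y - B p q - (b1 * (x - p) + b2 * (y - q))| <= e * (`|x - p| + `|y - q|) &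
        `|g x y - g p q| <= e].
    move=> hx hy; have [] := near x y hx hy.
    by rewrite !lt_min => /and3P[? ? ?] /and3P[? ? ?]; split; [exact: h1|exact: h2|exact: h3].
  move=> /(_ bound); have [gd _] := gS n; move=> /(le_trans gd).
  have -> : (S n).1 + w n - (S n).1 + ((S n).2 + h n - (S n).2) = L / 2 ^+ n.
    by rewrite -whL; ring.
  rewrite ler_pdivrMr ?exprn_gt0// => /le_trans; apply.
  rewrite le_eqVlt; apply/orP; left; apply/eqP.
  have -> : (4 : R) ^+ n = 2 ^+ n * 2 ^+ n by rewrite -exprMn -natrM.
  by field; rewrite gt_eqF.
apply/eqP; rewrite -normr_eq0 eq_le normr_ge0 andbT; apply/ler_addgt0Pr => e e0.
rewrite add0r; have L1 : 0 < 3 * (L ^+ 2 + 1) by rewrite mulr_gt0// ltr_wpDl ?sqr_ge0.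
apply: (le_trans (main (e / (3 * (L ^+ 2 + 1))) (divr_gt0 e0 L1))).
have X0 : 0 < L ^+ 2 + 1 by rewrite ltr_wpDl ?sqr_ge0.
rewrite (_ : _ * L ^+ 2 = e * (L ^+ 2 / (L ^+ 2 + 1))); last by field; rewrite gt_eqF.
by rewrite ler_piMr ?(ltW e0)// ler_pdivrMr// mul1r lerDl.
Qed.

End green.
End plane.

(** * Differentiability of functions of a complex variable *)

Section real_differentiability.
Variable R : realType.
Local Notation mu := (@lebesgue_measure R).
Local Notation mu2 := (@lebesgue_measure R \x @lebesgue_measure R)%E.
Implicit Types (F G : R[i] -> R[i]) (z h w : R[i]).

(* [a] and [b] are the Wirtinger derivatives of F with respect to z and its
   conjugate. *)
Definition rdiff F z (a b : R[i]) := forall e : R, 0 < e -> exists2 d, 0 < d &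
  forall h, abs h < d -> abs (F (z + h) - F z - (a * h + b * conjc h)) <= e * abs h.

Definition ccontinuous F := forall z (e : R), 0 < e -> exists2 d, 0 < d &
  forall h, abs h < d -> abs (F (z + h) - F z) <= e.

(** Sums, products and quadratic remainders come with constant factors, and products of errors are
    controlled for small [e] only; this form accepts both. *)
Lemma rdiff_weak F z a b (C : R) : 0 <= C ->
  (forall e, 0 < e -> e < 1 -> exists2 d, 0 < d & forall h, abs h < d ->
    abs (F (z + h) - F z - (a * h + b * conjc h)) <= C * e * abs h) ->
  rdiff F z a b.
Proof.
move=> C0 hC e e0.
pose e' := Num.min (1 / 2) (e / (C + 1)).
have C1 : 0 < C + 1 by rewrite ltr_wpDl.
have e'0 : 0 < e' by rewrite lt_min !divr_gt0.
have e'1 : e' < 1 by rewrite gt_min ltr_pdivrMr// mul1r ltr1n.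
have [d d0 hd] := hC e' e'0 e'1; exists d => // h /hd le; apply: (le_trans le).
rewrite ler_wpM2r ?abs_ge0//; have : e' <= e / (C + 1) by rewrite ge_min lexx orbT.
by rewrite ler_pdivlMr//; nra.
Qed.

Lemma rdiff_quadratic F z a b (C r : R) : 0 <= C -> 0 < r ->
  (forall h, abs h < r ->
    abs (F (z + h) - F z - (a * h + b * conjc h)) <= C * abs h ^+ 2) ->
  rdiff F z a b.
Proof.
move=> C0 r0 hC; apply: (@rdiff_weak _ _ _ _ C) => // e e0 _.
exists (Num.min r e) => [|h]; rewrite lt_min ?r0// => /andP[/hC le he].
by apply: (le_trans le); rewrite expr2 mulrA ler_wpM2r ?abs_ge0// ler_wpM2l// ltW.
Qed.

Lemma rdiff_lipschitz F z a b : rdiff F z a b -> exists2 d, 0 < d &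
  forall h, abs h < d -> abs (F (z + h) - F z) <= (1 + abs a + abs b) * abs h.
Proof.
move=> dF; have [d d0 hd] := dF 1 ltr01; exists d => // h /hd le.
rewrite -(subrK (a * h + b * conjc h) (_ - _)).
apply: (le_trans (abs_triangle _ _)); apply: (le_trans (lerD le (abs_triangle _ _))).
by rewrite !absM absJ; lra.
Qed.

Lemma rdiff_ccontinuous F : (forall z, exists a b, rdiff F z a b) -> ccontinuous F.
Proof.
move=> dF z e e0; have [a [b /rdiff_lipschitz[d d0 hd]]] := dF z.
set M := 1 + abs a + abs b in hd.
have M0 : 0 < M by rewrite /M -addrA ltr_wpDr// addr_ge0// abs_ge0.
exists (Num.min d (e / M)) => [|h]; rewrite lt_min ?d0 ?divr_gt0// => /andP[/hd le].
by rewrite ltr_pdivlMr// mulrC => /ltW; exact: le_trans.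
Qed.

Lemma rdiff_cst (c : R[i]) z : rdiff (fun=> c) z 0 0.
Proof.
move=> e e0; exists 1 => // h _; rewrite subrr !mul0r addr0 subr0 abs0.
by rewrite mulr_ge0 ?abs_ge0// ltW.
Qed.

Lemma rdiffD F G z a b a' b' : rdiff F z a b -> rdiff G z a' b' ->
  rdiff (fun z => F z + G z) z (a + a') (b + b').
Proof.
move=> dF dG; apply: (@rdiff_weak _ _ _ _ 2) => // e e0 _.
have [d1 d10 h1] := dF e e0; have [d2 d20 h2] := dG e e0.
exists (Num.min d1 d2) => [|h]; rewrite lt_min ?d10// => /andP[/h1 le1 /h2 le2].
rewrite (_ : _ - _ = (F (z + h) - F z - (a * h + b * conjc h)) +
  (G (z + h) - G z - (a' * h + b' * conjc h))); last by ring.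
by apply: (le_trans (abs_triangle _ _)); lra.
Qed.

Lemma rdiffM F G z a b a' b' : rdiff F z a b -> rdiff G z a' b' ->
  rdiff (fun z => F z * G z) z (a * G z + F z * a') (b * G z + F z * b').
Proof.
move=> dF dG.
have [r r0 hr] := rdiff_lipschitz dG.
set M := 1 + abs a' + abs b' in hr.
have M0 : 0 <= M by rewrite /M !addr_ge0// abs_ge0.
pose C := abs (G z) + M + (abs a + abs b) * M + abs (F z).
have C0 : 0 <= C by rewrite /C !addr_ge0// ?mulr_ge0// ?addr_ge0// abs_ge0.
apply: (@rdiff_weak _ _ _ _ C) => // e e0 e1.
have [d1 d10 h1] := dF e e0; have [d2 d20 h2] := dG e e0.
exists (Num.min (Num.min d1 d2) (Num.min r e)) => [|h].
  by rewrite !lt_min d10 d20 r0.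
rewrite !lt_min => /andP[/andP[/h1 le1 /h2 le2] /andP[/hr le3 he]].
have -> : F (z + h) * G (z + h) - F z * G z -
    ((a * G z + F z * a') * h + (b * G z + F z * b') * conjc h) =
  (F (z + h) - F z - (a * h + b * conjc h)) * (G z + (G (z + h) - G z)) +
  (a * h + b * conjc h) * (G (z + h) - G z) +
  F z * (G (z + h) - G z - (a' * h + b' * conjc h)) by ring.
have t1 := abs_triangle (G z) (G (z + h) - G z).
have t2 : abs (a * h + b * conjc h) <= (abs a + abs b) * abs h.
  by apply: (le_trans (abs_triangle _ _)); rewrite !absM absJ mulrDl.
apply: (le_trans (abs_triangle _ _)).
apply: (le_trans (lerD (abs_triangle _ _) (lexx _))).
rewrite !absM.
move: le1 le2 le3 t1 t2 (abs_ge0 (F (z + h) - F z - (a * h + b * conjc h)))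
  (abs_ge0 (G z + (G (z + h) - G z))) (abs_ge0 (G (z + h) - G z))
  (abs_ge0 (a * h + b * conjc h)) (abs_ge0 h)
  (abs_ge0 (F z)) (addr_ge0 (abs_ge0 a) (abs_ge0 b)) he.
rewrite /C.
move: (abs (F (z + h) - F z - (a * h + b * conjc h)))
  (abs (G (z + h) - G z - (a' * h + b' * conjc h))) (abs (G z + (G (z + h) - G z)))
  (abs (G (z + h) - G z)) (abs (a * h + b * conjc h)) (abs h) (abs (F z)) (abs (G z))
  (abs a + abs b) => x1 x2 x3 x4 x5 x6 x7 x8 x9 le1 le2 le3 t1 t2 p1 p2 p3 p4 p5 p6 p7 he.
have x6M : M * x6 <= M by rewrite ler_piMr// ltW// (lt_trans he).
have q1 : x1 * x3 <= e * x6 * (x8 + M).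
  by apply: ler_pM => //; apply: (le_trans t1); rewrite lerD2l (le_trans le3).
have q2 : x5 * x4 <= (x9 * x6) * (M * e).
  apply: ler_pM => //; apply: (le_trans le3).
  by rewrite ler_wpM2l// ltW.
have q3 := ler_wpM2l p6 le2; lra.
Qed.

Lemma ccontinuousD F G : ccontinuous F -> ccontinuous G ->
  ccontinuous (fun z => F z + G z).
Proof.
move=> cF cG z e e0; have e2 : 0 < e / 2 by rewrite divr_gt0.
have [d1 d10 h1] := cF z _ e2; have [d2 d20 h2] := cG z _ e2.
exists (Num.min d1 d2) => [|h]; rewrite lt_min ?d10// => /andP[/h1 le1 /h2 le2].
rewrite opprD addrACA [leRHS]splitr.
by apply: (le_trans (abs_triangle _ _)); exact: lerD.
Qed.

Lemma ccontinuousM F G : ccontinuous F -> ccontinuous G ->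
  ccontinuous (fun z => F z * G z).
Proof.
move=> cF cG z e e0.
pose C := abs (F z) + abs (G z) + 1.
have C1 : 1 <= C by rewrite /C lerDr addr_ge0// abs_ge0.
have C0 : 0 < C by rewrite (lt_le_trans ltr01).
pose e' := Num.min 1 (e / C).
have e'0 : 0 < e' by rewrite lt_min ltr01 divr_gt0.
have [d1 d10 h1] := cF z _ e'0; have [d2 d20 h2] := cG z _ e'0.
exists (Num.min d1 d2) => [|h]; rewrite lt_min ?d10// => /andP[/h1 le1 /h2 le2].
have -> : F (z + h) * G (z + h) - F z * G z = (F (z + h) - F z) * (G (z + h) - G z) +
  F z * (G (z + h) - G z) + (F (z + h) - F z) * G z by ring.
apply: (le_trans (abs_triangle _ _)).
apply: (le_trans (lerD (abs_triangle _ _) (lexx _))).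
rewrite !absM.
have : e' <= e / C by rewrite ge_min lexx orbT.
rewrite ler_pdivlMr// => eC; apply: le_trans eC.
have e'1 : e' <= 1 by rewrite ge_min lexx.
have F0 := abs_ge0 (F z); have G0 := abs_ge0 (G z).
have x0 := abs_ge0 (F (z + h) - F z); have y0 := abs_ge0 (G (z + h) - G z).
have q1 : abs (F (z + h) - F z) * abs (G (z + h) - G z) <= e' * 1.
  by apply: ler_pM => //; exact: le_trans le2 e'1.
have q2 := ler_wpM2l F0 le2; have q3 := ler_wpM2r G0 le1.
rewrite /C; lra.
Qed.

End real_differentiability.

(** * Integrals of d-bar derivatives over the plane *)

Section dbar.
Variable R : realType.
Local Notation mu := (@lebesgue_measure R).
Local Notation mu2 := (@lebesgue_measure R \x @lebesgue_measure R)%E.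
Implicit Types (F G : R[i] -> R[i]) (z h w : R[i]) (p q x y c : R).

(** With Wirtinger derivatives [a] and [b], the partial derivatives of [F] are [a + b] in [x] and
    ['i * (a - b)] in [y]. *)
Lemma rdiff_diff_at F p q a b : rdiff F (p +i* q) a b ->
  diff_at (fun x y => complex.Re (F (x +i* y))) p q
    (complex.Re a + complex.Re b) (complex.Im b - complex.Im a) /\
  diff_at (fun x y => complex.Im (F (x +i* y))) p q
    (complex.Im a + complex.Im b) (complex.Re a - complex.Re b).
Proof.
move=> dF.
suff key (e : R) : 0 < e -> exists2 d, 0 < d & forall x y, `|x - p| < d -> `|y - q| < d ->
    abs (F (x +i* y) - F (p +i* q) - (a * ((x - p) +i* (y - q)) +
      b * conjc ((x - p) +i* (y - q)))) <= e * (`|x - p| + `|y - q|).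
  split=> e /key[d d0 hd]; exists d => // x y xp yq; have := hd x y xp yq.
    apply: le_trans; apply: le_trans (Re_le_abs _).
    by rewrite !ReImE le_eqVlt; apply/orP; left; apply/eqP; congr `|_|; ring.
  apply: le_trans; apply: le_trans (Im_le_abs _).
  by rewrite !ReImE le_eqVlt; apply/orP; left; apply/eqP; congr `|_|; ring.
move=> e0; have [d d0 hd] := dF e e0.
exists (d / 2) => [|x y xp yq]; first by rewrite divr_gt0.
have hle : abs ((x - p) +i* (y - q)) <= `|x - p| + `|y - q| by exact: abs_le_ReIm.
have := hd ((x - p) +i* (y - q)).
have -> : (p +i* q) + ((x - p) +i* (y - q)) = x +i* y.
  by apply: complex_ext; rewrite !ReImE; ring.
move=> h; apply: (le_trans (h _)); last by rewrite ler_wpM2l// ltW.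
by rewrite (le_lt_trans hle)// [ltRHS]splitr ltrD.
Qed.

Lemma ccontinuous_Re F : ccontinuous F -> continuous2 (fun x y => complex.Re (F (x +i* y))).
Proof.
move=> cF p q e e0; have [d d0 hd] := cF (p +i* q) e e0.
exists (d / 2) => [|x y xp yq]; first by rewrite divr_gt0.
have hle : abs ((x - p) +i* (y - q)) <= `|x - p| + `|y - q| by exact: abs_le_ReIm.
have := hd ((x - p) +i* (y - q)).
have -> : (p +i* q) + ((x - p) +i* (y - q)) = x +i* y.
  by apply: complex_ext; rewrite !ReImE; ring.
rewrite -Re_opp -Re_add => h; apply: (le_trans (Re_le_abs _)); apply: h.
by rewrite (le_lt_trans hle)// [ltRHS]splitr ltrD.
Qed.

Lemma ccontinuous_cst (a : R[i]) : ccontinuous (fun=> a).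
Proof. by move=> z e e0; exists 1 => // h _; rewrite subrr abs0 ltW. Qed.

Lemma ccontinuous_Im F : ccontinuous F -> continuous2 (fun x y => complex.Im (F (x +i* y))).
Proof.
move=> cF; have := ccontinuous_Re (ccontinuousM (ccontinuous_cst (- 'i)) cF).
rewrite /continuous2 => h p q e e0; have [d d0 hd] := h p q e e0; exists d => // x y xp yq.
have := hd x y xp yq; rewrite !Re_mul !ReImE /=; congr (`|_| <= _).
by rewrite oppr0 !mul0r !sub0r !mulN1r !opprK.
Qed.

Lemma ccontinuous_measurable F : ccontinuous F ->
  @cmeasurable _ (measurableTypeR R * measurableTypeR R)%type R
    (fun t => F (t.1 +i* t.2)).
Proof.
move=> cF; split.
  exact: (continuous2_measurable (ccontinuous_Re cF)).
exact: (continuous2_measurable (ccontinuous_Im cF)).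
Qed.

Let X z : R[i] := (complex.Re z)%:C.
Let Y z : R[i] := (complex.Im z)%:C.

Lemma rdiff_Re z : rdiff (fun z => (complex.Re z)%:C) z (2^-1)%:C (2^-1)%:C.
Proof.
move=> e e0; exists 1 => // h _.
rewrite (_ : _ - _ = 0) ?abs0 ?mulr_ge0 ?abs_ge0 ?ltW//.
by apply: complex_ext; rewrite !ReImE; field.
Qed.

Lemma rdiff_Im z : rdiff (fun z => (complex.Im z)%:C) z (0 -i* 2^-1) (0 +i* 2^-1).
Proof.
move=> e e0; exists 1 => // h _.
rewrite (_ : _ - _ = 0) ?abs0 ?mulr_ge0 ?abs_ge0 ?ltW//.
by apply: complex_ext; rewrite !ReImE; field.
Qed.

(* The polynomial (1 - c x^2) (1 - c y^2) vanishes on the boundary of the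
   square [-N, N]^2 if c = N^-2. *)
Let cutoff c z : R[i] := (1 + - c%:C * (X z * X z)) * (1 + - c%:C * (Y z * Y z)).
(** The d-bar derivatives of [X] and [Y] are 1/2 and i/2; the halves cancel against the factor 2
    from differentiating a square. *)
Let dcutoff c z : R[i] := - c%:C * X z * (1 + - c%:C * (Y z * Y z)) +
  (1 + - c%:C * (X z * X z)) * (- c%:C * (Y z * 'i)).

Let rdiff_cutoff c z : exists a, rdiff (cutoff c) z a (dcutoff c z).
Proof.
have dX := rdiffD (rdiff_cst 1 z) (rdiffM (rdiff_cst (- c%:C) z) (rdiffM (rdiff_Re z) (rdiff_Re z))).
have dY := rdiffD (rdiff_cst 1 z) (rdiffM (rdiff_cst (- c%:C) z) (rdiffM (rdiff_Im z) (rdiff_Im z))).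
have := rdiffM dX dY; set a := (X in rdiff _ _ X _); set b := (X in rdiff _ _ _ X).
move=> d; exists a; rewrite (_ : dcutoff c z = b)// /b /dcutoff /X /Y.
have -> : 0 +i* 2^-1 = (2^-1)%:C * 'i :> R[i].
  by apply: complex_ext; rewrite !ReImE; ring.
have two : (2^-1)%:C + (2^-1)%:C = 1 :> R[i] by rewrite -rmorphD -div1r -splitr.
have t2 : (2^-1)%:C = 1 - (2^-1)%:C :> R[i] by rewrite -two; ring.
set k := (2^-1)%:C in two t2 *.
(* Inserting [k + k = 1] makes the identity polynomial in [k]. *)
transitivity ((k + k) * dcutoff c z); first by rewrite two mul1r.
by rewrite /dcutoff /X /Y; ring.
Qed.

Let cutoffE c x y : cutoff c (x +i* y) = ((1 - c * x ^+ 2) * (1 - c * y ^+ 2))%:C.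
Proof. by apply: complex_ext; rewrite /cutoff /X /Y !ReImE; ring. Qed.

Let ccX : ccontinuous X.
Proof. by apply: rdiff_ccontinuous => z; do 2 eexists; exact: rdiff_Re. Qed.
Let ccY : ccontinuous Y.
Proof. by apply: rdiff_ccontinuous => z; do 2 eexists; exact: rdiff_Im. Qed.

Let ccontinuous_dcutoff c : ccontinuous (dcutoff c).
Proof.
have cst := ccontinuous_cst.
have c1 : ccontinuous (fun z => 1 + - c%:C * (Y z * Y z)).
  by apply: ccontinuousD => //; do 2 (apply: ccontinuousM => //).
have c2 : ccontinuous (fun z => 1 + - c%:C * (X z * X z)).
  by apply: ccontinuousD => //; do 2 (apply: ccontinuousM => //).
apply: ccontinuousD; apply: ccontinuousM => //.
  by apply: ccontinuousM.
by do 2 (apply: ccontinuousM => //).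
Qed.

(** The first two bounds are uniform in [c] and provide the dominating function; the last two tend
    to 0 with [c] at a fixed point. *)
Let cutoff_bound c x y : 0 <= c -> c <= 1 -> c * x ^+ 2 <= 1 -> c * y ^+ 2 <= 1 ->
  [/\ abs (cutoff c (x +i* y)) <= 1, abs (dcutoff c (x +i* y)) <= 2,
     abs (dcutoff c (x +i* y)) <= c * (`|x| + `|y|) &
     abs (cutoff c (x +i* y) - 1) <= c * (x ^+ 2 + y ^+ 2)].
Proof.
move=> c0 c1 cx cy.
have x0 : 0 <= c * x ^+ 2 by rewrite mulr_ge0 ?sqr_ge0.
have y0 : 0 <= c * y ^+ 2 by rewrite mulr_ge0 ?sqr_ge0.
have bd : abs (dcutoff c (x +i* y)) <= c * (`|x| + `|y|).
  apply: (le_trans (abs_triangle _ _)).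
  have nx : abs (1 + - c%:C * (X (x +i* y) * X (x +i* y))) <= 1.
    rewrite (_ : _ + _ = (1 - c * x ^+ 2)%:C); last first.
      by apply: complex_ext; rewrite /X !ReImE; ring.
    by rewrite abs_real ler_norml; apply/andP; split; lra.
  have ny : abs (1 + - c%:C * (Y (x +i* y) * Y (x +i* y))) <= 1.
    rewrite (_ : _ + _ = (1 - c * y ^+ 2)%:C); last first.
      by apply: complex_ext; rewrite /Y !ReImE; ring.
    by rewrite abs_real ler_norml; apply/andP; split; lra.
  have absi : abs 'i = 1 :> R.
    by rewrite abs_def /= expr0n expr1n add0r sqrtr1.
  rewrite [leRHS]mulrDr; apply: lerD.
    rewrite !absM absN !abs_real (ger0_norm c0) ler_piMr// mulr_ge0//.
  by rewrite !absM absN !abs_real (ger0_norm c0) absi mulr1 ler_piMl// mulr_ge0.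
split=> //.
- rewrite cutoffE abs_real ler_norml.
  by move: (c * x ^+ 2) (c * y ^+ 2) x0 y0 cx cy => s t *; apply/andP; split; nra.
- apply: (le_trans bd); rewrite mulrDr.
  have le (t : R) : 0 <= c * t ^+ 2 -> c * t ^+ 2 <= 1 -> c * `|t| <= 1.
    move=> _ ct; rewrite -real_normK ?num_real// in ct.
    rewrite -(ler_pXn2r (n := 2))// ?nnegrE ?mulr_ge0// expr1n exprMn.
    by apply: le_trans ct; rewrite ler_wpM2r ?sqr_ge0// expr2 ler_piMl.
  by have := le x x0 cx; have := le y y0 cy; lra.
- rewrite cutoffE -(rmorph1 (real_complex R)) -rmorphB abs_real ler_norml mulrDr.
  by move: (c * x ^+ 2) (c * y ^+ 2) x0 y0 cx cy => s t *; apply/andP; split; nra.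
Qed.

(** Green's formula for [F] times the cutoff has no boundary terms, and dominated convergence leads
    from the squares to the plane. A sharp restriction to squares would leave integrals of [F] over
    their sides, on which integrability over the plane gives no direct control. *)
Theorem Re_integral_dbar_eq0 F b : (forall z, exists a, rdiff F z a (b z)) ->
  ccontinuous b -> cintegrable mu2 (fun t => F (t.1 +i* t.2)) ->
  cintegrable mu2 (fun t => b (t.1 +i* t.2)) ->
  \int[mu2]_t complex.Re (b (t.1 +i* t.2)) = 0.
Proof.
move=> dF cb iF ib.
have cF : ccontinuous F.
  by apply: rdiff_ccontinuous => z; have [a da] := dF z; exists a, (b z).
pose c (n : nat) : R := (n.+1%:R ^+ 2)^-1.
have c0 n : 0 <= c n by rewrite invr_ge0 sqr_ge0.
have c1 n : c n <= 1 by rewrite invf_le1 ?exprn_gt0// exprn_ege1// ler1n.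
pose N (n : nat) : R := n.+1%:R.
have N0 n : 0 < N n by rewrite ltr0n.
have cN n x : `|x| <= N n -> c n * x ^+ 2 <= 1.
  move=> xN; rewrite mulrC ler_pdivrMr ?exprn_gt0// mul1r -real_normK ?num_real//.
  by rewrite ler_pXn2r ?nnegrE// ltW.
pose bn n z := b z * cutoff (c n) z + F z * dcutoff (c n) z.
have cbn n : ccontinuous (bn n).
  apply: ccontinuousD; apply: ccontinuousM => //.
  by apply: rdiff_ccontinuous => z; have [a da] := rdiff_cutoff (c n) z; exists a, (dcutoff (c n) z).
pose Q n := ibox (- N n) (N n) (- N n) (N n).
have mQ n : @measurable _ (measurableTypeR R * measurableTypeR R)%type (Q n).
  exact: measurable_ibox.
have inQ n (t : R * R) : Q n t -> `|t.1| <= N n /\ `|t.2| <= N n.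
  by move=> []; rewrite /= !in_itv/= !ler_norml => /andP[/ltW -> ->] /andP[/ltW -> ->].
pose M (t : R * R) := abs (b (t.1 +i* t.2)) + 2 * abs (F (t.1 +i* t.2)).
have iM : rintegrable mu2 setT M.
  apply: rintegrableD => //; first exact: cintegrable_abs.
  by apply: rintegrableZ => //; exact: cintegrable_abs.
have bnM n t : Q n t -> abs (bn n (t.1 +i* t.2)) <= M t.
  move=> /inQ[/cN h1 /cN h2]; have [k1 k2 _ _] := cutoff_bound (c0 n) (c1 n) h1 h2.
  apply: (le_trans (abs_triangle _ _)).
  rewrite (absM (b _)) (absM (F _)) /M; apply: lerD.
    by rewrite ler_piMr ?abs_ge0.
  by rewrite mulrC ler_wpM2r ?abs_ge0.
have mbn n : measurable_fun setT (fun t : R * R => complex.Re (bn n (t.1 +i* t.2))).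
  by have [] := ccontinuous_measurable (cbn n).
have ibn n : rintegrable mu2 (Q n) (fun t => complex.Re (bn n (t.1 +i* t.2))).
  have iMQ : rintegrable mu2 (Q n) M.
    by move: iM; apply: integrableS; [exact: measurableT|exact: mQ|].
  have mb : measurable_fun (Q n) (fun t : R * R => complex.Re (bn n (t.1 +i* t.2))).
    exact: measurable_funTS.
  apply: (@rintegrable_le _ _ _ mu2 (Q n) _ M (mQ n) mb iMQ).
  by move=> t Qt; apply: le_trans (Re_le_abs _) (bnM n t Qt).
have int0 n : \int[mu2]_(t in Q n) complex.Re (bn n (t.1 +i* t.2)) = 0.
  (* Twice the d-bar derivative is the [x] derivative plus i times the [y] derivative; its real part
     is the divergence of the field made of the real part and the negative imaginary part. *)
  pose P x y := complex.Re (F (x +i* y) * cutoff (c n) (x +i* y)).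
  pose U x y := - complex.Im (F (x +i* y) * cutoff (c n) (x +i* y)).
  pose g x y := 2 * complex.Re (bn n (x +i* y)).
  have dPU p q : exists a1 a2 b1 b2,
      [/\ diff_at P p q a1 a2, diff_at U p q b1 b2 & a1 + b2 = g p q].
    have [a da] := dF (p +i* q); have [a' da'] := rdiff_cutoff (c n) (p +i* q).
    have [d1 d2] := rdiff_diff_at (rdiffM da da').
    move: d1 d2; set s := _ + F _ * a'; set r := _ + F _ * dcutoff _ _ => d1 d2.
    exists (complex.Re s + complex.Re r), (complex.Im r - complex.Im s),
      (- (complex.Im s + complex.Im r)), (- (complex.Re s - complex.Re r)).
    split=> //; last by rewrite /g /bn -/r; move: (complex.Re s) (complex.Re r) => ? ?; ring.
    move=> e e0; have [d d0 hd] := d2 e e0; exists d => // x y xp yq.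
    have := hd x y xp yq; apply: le_trans; rewrite -normrN.
    by rewrite le_eqVlt; apply/orP; left; apply/eqP; congr `|_|; rewrite /U; ring.
  have cg : continuous2 g.
    have ct := ccontinuous_Re (ccontinuousM (ccontinuous_cst 2%:C) (cbn n)).
    have gE x y : complex.Re (2%:C * bn n (x +i* y)) = g x y.
      by rewrite (Re_mul 2%:C) Re_real Im_real mul0r subr0.
    move=> p q e e0; have [d d0 hd] := ct p q e e0; exists d => // x y xp yq.
    by have := hd x y xp yq; rewrite !gE.
  have NN : - N n <= N n by have n0 := N0 n; lra.
  have ig : rintegrable mu2 (Q n) (fun t => g t.1 t.2).
    by apply: rintegrableZ; [exact: mQ|exact: ibn].
  have cE : c n * N n ^+ 2 = 1 by rewrite mulVf// expf_neq0// gt_eqF.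
  have edge x y : `|x| = N n \/ `|y| = N n -> cutoff (c n) (x +i* y) = 0.
    have z0 (t : R) : `|t| = N n -> 1 - c n * t ^+ 2 = 0.
      by move=> tN; rewrite -real_normK ?num_real// tN cE subrr.
    by rewrite cutoffE => -[/z0 ->|/z0 ->]; rewrite ?mul0r ?mulr0.
  have P0 x y : `|x| = N n \/ `|y| = N n -> P x y = 0.
    by move=> /edge e; rewrite /P e mulr0.
  have U0 x y : `|x| = N n \/ `|y| = N n -> U x y = 0.
    by move=> /edge e; rewrite /U e mulr0 oppr0.
  have nN : `|N n| = N n by rewrite gtr0_norm.
  have nNN : `|- N n| = N n by rewrite normrN.
  have zero (f : R -> R) D : (forall x, f x = 0) -> \int[mu]_(x in D) f x = 0.
    move=> f0; rewrite -[RHS](Rintegral_set0 mu (fun=> 0)) /Rintegral integral_set0.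
    by congr fine; apply: integral0_eq => x _; rewrite f0.
  have := green_box dPU cg NN NN ig.
  rewrite zero; last by move=> y; rewrite !P0 ?subrr//; left.
  rewrite zero; last by move=> x; rewrite !U0 ?subrr//; right.
  rewrite addr0 => g0; have two0 : (2 : R) != 0 by rewrite pnatr_eq0.
  by apply: (mulfI two0); rewrite mulr0 g0 -(RintegralZl 2 (mQ n) (ibn n)).
have cvp (t : R * R) : ((fun t => complex.Re (bn n (t.1 +i* t.2))) \_ (Q n)) t
    @[n --> \oo] --> complex.Re (b (t.1 +i* t.2)).
  case: t => x y; pose C := abs (b (x +i* y)) * (x ^+ 2 + y ^+ 2) +
    abs (F (x +i* y)) * (`|x| + `|y|).
  have cv : C * harmonic n @[n --> \oo] --> (0 : R).
    by rewrite -(mulr0 C); apply: cvgZr; exact: cvg_harmonic.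
  apply/cvgrPdist_le => e e0.
  move/cvgrPdist_le : cv => /(_ e e0) cv; near=> n.
  have Qt : Q n (x, y).
    have xn : `|x| < n%:R by near: n; exact: nbhs_infty_gtr.
    have yn : `|y| < n%:R by near: n; exact: nbhs_infty_gtr.
    have nn : n%:R <= N n by rewrite ler_nat.
    rewrite ltr_norml in xn; rewrite ltr_norml in yn.
    case/andP: xn => x1 x2; case/andP: yn => y1 y2.
    by split; rewrite /= in_itv/=; apply/andP; split; lra.
  rewrite patchE mem_set//.
  have [/cN h1 /cN h2] := inQ n _ Qt.
  have [_ _ k3 k4] := cutoff_bound (c0 n) (c1 n) h1 h2.
  have : C * harmonic n <= e.
    near: n; apply: filterS cv => m; rewrite sub0r normrN; apply: le_trans; exact: ler_norm.
  apply: le_trans; rewrite -Re_opp -Re_add; apply: (le_trans (Re_le_abs _)).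
  rewrite abs_subC /bn /=.
  rewrite (_ : _ - _ = b (x +i* y) * (cutoff (c n) (x +i* y) - 1) +
    F (x +i* y) * dcutoff (c n) (x +i* y)); last by ring.
  apply: (le_trans (abs_triangle _ _)); rewrite (absM (b _)) (absM (F _)).
  have ch : c n <= harmonic n.
    rewrite /c /harmonic/= lef_pV2 ?posrE ?exprn_gt0//.
    by rewrite expr2 ler_peMl// ?ler1n// ler0n.
  apply: (@le_trans _ _ (abs (b (x +i* y)) * (c n * (x ^+ 2 + y ^+ 2)) +
    abs (F (x +i* y)) * (c n * (`|x| + `|y|)))).
    by apply: lerD; rewrite ler_wpM2l ?abs_ge0.
  have -> : forall A B D E : R, A * (c n * B) + D * (c n * E) = (A * B + D * E) * c n.
    by move=> *; ring.
  by rewrite ler_wpM2l// /C addr_ge0// mulr_ge0 ?abs_ge0 ?addr_ge0 ?sqr_ge0.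
pose fn n : (measurableTypeR R * measurableTypeR R)%type -> R :=
  (fun t => complex.Re (bn n (t.1 +i* t.2))) \_ (Q n).
have mfn n : measurable_fun setT (fn n).
  by apply/(measurable_restrictT _ (mQ n)); apply: measurable_funTS; exact: mbn.
have fnM n t : `|fn n t| <= M t.
  rewrite /fn patchE; case: ifPn => [/set_mem Qt|_].
    exact: le_trans (Re_le_abs _) (bnM n t Qt).
  by rewrite normr0 /M addr_ge0 ?mulr_ge0 ?abs_ge0.
have [_ cv] := @Rintegral_dominated_cvg _ _ _ mu2 fn _ M mfn cvp iM fnM.
have cv0 : \int[mu2]_t ((fun t => complex.Re (bn n (t.1 +i* t.2))) \_ (Q n)) t
    @[n --> \oo] --> (0 : R).
  by under eq_fun do rewrite -Rintegral_mkcond int0; exact: cvg_cst.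
exact: cvg_unique cv cv0.
Unshelve. all: end_near. Qed.

Theorem integral_dbar_eq0 F b : (forall z, exists a, rdiff F z a (b z)) ->
  ccontinuous b -> cintegrable mu2 (fun t => F (t.1 +i* t.2)) ->
  cintegrable mu2 (fun t => b (t.1 +i* t.2)) ->
  cintegral mu2 (fun t => b (t.1 +i* t.2)) = 0.
Proof.
move=> dF cb iF ib; apply: complex_ext; rewrite /cintegral !(Re_mk, Im_mk).
  exact: Re_integral_dbar_eq0 dF cb iF ib.
(* The real part of [- 'i * b] is the imaginary part of [b]. *)
have := @Re_integral_dbar_eq0 (fun z => - 'i * F z) (fun z => - 'i * b z) _
  (ccontinuousM (ccontinuous_cst _) cb) (cintegrableZ _ iF) (cintegrableZ _ ib).
move=> h; rewrite -[LHS](_ : \int[mu2]_t complex.Re (- 'i * b (t.1 +i* t.2)) = _).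
  apply: h => z; have [a da] := dF z.
  have := rdiffM (rdiff_cst (- 'i) z) da.
  by rewrite !mul0r !add0r => d; exists (- 'i * a).
apply: eq_Rintegral => t _; rewrite Re_mul /=.
by rewrite oppr0 mul0r sub0r mulN1r opprK.
Qed.

End dbar.

(** * The Bargmann space *)

Section complex_exponential.
Variable R : realType.
Implicit Types (F G : R[i] -> R[i]) (z h w : R[i]) (a b x y s : R).

Lemma mean_value_le (f df : R -> R) (b M : R) : (forall x, is_derive x 1 f (df x)) ->
  (forall x, `|x| <= `|b| -> `|df x| <= M) -> `|f b - f 0| <= M * `|b|.
Proof.
move=> fd dfM.
have cf : continuous f by exact: continuous_of_derive fd.
have fd' (u v x : R) : x \in `]u, v[ -> is_derive x 1 f (df x) by move=> _.
have [b0|b0] := leP 0 b.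
  have [c] := MVT_segment b0 (fd' 0 b) (continuous_subspaceT cf).
  rewrite in_itv/= => /andP[c0 cb] ->; rewrite normrM subr0 ler_wpM2r//.
  by apply: dfM; rewrite !ger0_norm.
have [c] := MVT_segment (ltW b0) (fd' b 0) (continuous_subspaceT cf).
rewrite in_itv/= => /andP[cb c0] e; rewrite distrC e normrM sub0r normrN ler_wpM2r//.
by apply: dfM; rewrite !ler0_norm ?(ltW b0)// lerN2.
Qed.

Lemma normr_sin_le b : `|sin b| <= `|b|.
Proof.
have := @mean_value_le sin cos b 1 (fun x => is_derive_sin x) _.
rewrite sin0 subr0 mul1r; apply=> x _.
by rewrite ler_norml cos_geN1 cos_le1.
Qed.

Lemma normr_cos_sub1_le b : `|cos b - 1| <= b ^+ 2.
Proof.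
have := @mean_value_le cos (fun x => - sin x) b `|b| (fun x => is_derive_cos x) _.
rewrite cos0 -normrM -expr2 ger0_norm ?sqr_ge0//; apply=> x xb.
by rewrite normrN (le_trans (normr_sin_le x)).
Qed.

Lemma normr_sin_sub_le b : `|sin b - b| <= b ^+ 2.
Proof.
have d x : is_derive x 1 (fun x => sin x - x) (cos x - 1) by exact: is_deriveB.
have := @mean_value_le (fun x => sin x - x) (fun x => cos x - 1) b `|b| d _.
rewrite sin0 !subr0 -normrM -expr2 [leRHS]ger0_norm ?sqr_ge0//; apply=> x xb.
have := @mean_value_le cos (fun x => - sin x) x 1 (fun x => is_derive_cos x) _.
rewrite cos0 mul1r => h; apply: le_trans xb; apply: h => y _.
by rewrite normrN ler_norml sin_geN1 sin_le1.
Qed.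

Lemma normr_expR_sub1_le x : `|expR x - 1| <= `|x| * expR `|x|.
Proof.
have h1 := expR_ge1Dx x.
have h2 : expR x - 1 <= x * expR x.
  have := expR_ge1Dx (- x); rewrite expRN -[leRHS]mul1r ler_pdivlMr ?expR_gt0// => *; lra.
have [x0|x0] := leP 0 x.
  by rewrite (ger0_norm x0) ger0_norm// subr_ge0 -expR0 ler_expR.
rewrite ler0_norm; last by rewrite subr_le0 -expR0 ler_expR ltW.
apply: (@le_trans _ _ `|x|); first by rewrite (ltr0_norm x0); lra.
by rewrite ler_peMr// -expR0 ler_expR.
Qed.

Lemma normr_expR_remainder_le x : `|expR x - 1 - x| <= x ^+ 2 * expR `|x|.
Proof.
have h1 := expR_ge1Dx x.
have h2 : expR x - 1 <= x * expR x.
  have := expR_ge1Dx (- x); rewrite expRN -[leRHS]mul1r ler_pdivlMr ?expR_gt0// => *; lra.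
have h3 := normr_expR_sub1_le x.
rewrite ger0_norm; last by lra.
apply: (@le_trans _ _ (x * (expR x - 1))); first by lra.
apply: (le_trans (ler_norm _)); rewrite normrM -[X in X * expR _]real_normK ?num_real//.
by rewrite expr2 -mulrA ler_wpM2l.
Qed.

(** The bound holds for all [z], because besides differentiating the exponential it has to control
    difference quotients of [SB f] under the integral, where the exponent is unbounded. In the
    constant 3, one unit comes from the real part and two from the imaginary part. *)
Lemma abs_cexp_remainder_le z :
  abs (cexp z - 1 - z) <= 3 * abs z ^+ 2 * expR (abs z).
Proof.
case: z => a b; set z := a +i* b.
have az : `|a| <= abs z by exact: (Re_le_abs z).
have zz : abs z ^+ 2 = a ^+ 2 + b ^+ 2 by rewrite sqr_abs.
set E := expR `|a|.
have E1 : 1 <= E by rewrite -expR0 ler_expR.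
have aE : expR a <= E by rewrite ler_expR ler_norm.
have e0 := expR_ge0 a.
have r1 := normr_expR_remainder_le a; have r2 := normr_expR_sub1_le a.
have r3 := normr_cos_sub1_le b; have r4 := normr_sin_sub_le b.
rewrite -/E in r1 r2.
have re : `|complex.Re (cexp z - 1 - z)| <= (a ^+ 2 + b ^+ 2) * E.
  rewrite !ReImE /=.
  have -> : expR a * cos b - 1 - a = (expR a - 1 - a) + expR a * (cos b - 1) by ring.
  apply: (le_trans (ler_normD _ _)); rewrite mulrDl lerD// normrM (ger0_norm e0) mulrC.
  by apply: ler_pM.
have im : `|complex.Im (cexp z - 1 - z)| <= 2 * (a ^+ 2 + b ^+ 2) * E.
  rewrite !ReImE /= subr0.
  have -> : expR a * sin b - b = expR a * (sin b - b) + (expR a - 1) * b by ring.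
  apply: (le_trans (ler_normD _ _)); rewrite !normrM (ger0_norm e0).
  have q1 : expR a * `|sin b - b| <= E * b ^+ 2 by exact: ler_pM.
  have q2 : `|expR a - 1| * `|b| <= (`|a| * E) * `|b| by rewrite ler_wpM2r.
  have q3 : `|a| * `|b| <= a ^+ 2 + b ^+ 2.
    rewrite -(real_normK (num_real a)) -(real_normK (num_real b)).
    by move: (`|a|) (`|b|) => s t; have := sqr_ge0 (s - t); have := sqr_ge0 s; have := sqr_ge0 t; nra.
  have q4 : (`|a| * E) * `|b| <= (a ^+ 2 + b ^+ 2) * E by rewrite mulrAC ler_wpM2r// (le_trans ler01).
  have q5 := sqr_ge0 a; have E0 : 0 <= E by exact: le_trans E1.
  have := mulr_ge0 E0 q5; lra.
apply: (le_trans (abs_le_ReIm _)); apply: (le_trans (lerD re im)).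
rewrite -zz (_ : _ + _ = 3 * abs z ^+ 2 * E); last by ring.
by apply: ler_wpM2l; [rewrite mulr_ge0 ?sqr_ge0|rewrite /E ler_expR].
Qed.

Lemma rdiff_cexp_comp F z (a : R[i]) :
  (exists C : R, 0 <= C /\ forall h, abs h < 1 ->
    abs (F (z + h) - F z - a * h) <= C * abs h ^+ 2) ->
  rdiff (fun z => cexp (F z)) z (a * cexp (F z)) 0.
Proof.
move=> [C [C0 hC]].
pose K := abs a + C.
have K0 : 0 <= K by rewrite addr_ge0// abs_ge0.
pose M := abs (cexp (F z)) * (3 * K ^+ 2 * expR K + C).
have M0 : 0 <= M by rewrite mulr_ge0 ?abs_ge0// addr_ge0// !mulr_ge0 ?sqr_ge0// expR_ge0.
apply: (@rdiff_quadratic _ _ _ _ _ M 1) => // h h1.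
pose k := F (z + h) - F z.
have kE : F (z + h) = F z + k by rewrite /k; ring.
have ha := abs_ge0 h.
have hh : abs h ^+ 2 <= abs h by rewrite expr2 ler_piMr// ltW.
have le1 := hC h h1; rewrite -/k in le1.
have kK : abs k <= K * abs h.
  rewrite -(subrK (a * h) k); apply: (le_trans (abs_triangle _ _)).
  rewrite absM /K mulrDl addrC lerD2l; apply: (le_trans le1); exact: ler_wpM2l.
have kK' : abs k <= K by apply: (le_trans kK); rewrite ler_piMr// ltW.
rewrite kE cexpD mul0r addr0.
have -> : cexp (F z) * cexp k - cexp (F z) - a * cexp (F z) * h =
  cexp (F z) * ((cexp k - 1 - k) + (k - a * h)) by ring.
rewrite absM /M -mulrA ler_wpM2l ?abs_ge0//.
apply: (le_trans (abs_triangle _ _)); rewrite mulrDl lerD//.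
apply: (le_trans (abs_cexp_remainder_le k)).
rewrite [leRHS]mulrAC; apply: ler_pM.
- by rewrite mulr_ge0 ?sqr_ge0.
- exact: expR_ge0.
- rewrite -mulrA ler_wpM2l// -exprMn ler_pXn2r ?nnegrE ?mulr_ge0 ?abs_ge0//.
- by rewrite ler_expR.
Qed.

Lemma rdiff_cexp_linear (c d : R[i]) z :
  rdiff (fun z => cexp (c * z + d)) z (c * cexp (c * z + d)) 0.
Proof.
apply: (@rdiff_cexp_comp (fun z => c * z + d)).
exists 0; split=> // h _; rewrite mul0r (_ : _ - _ = 0) ?abs0//; ring.
Qed.

Lemma rdiff_cexp_sqr (c : R[i]) z :
  rdiff (fun z => cexp (c * z ^+ 2)) z (2 * c * z * cexp (c * z ^+ 2)) 0.
Proof.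
apply: (@rdiff_cexp_comp (fun z => c * z ^+ 2)).
exists (abs c); split; first exact: abs_ge0.
move=> h _; rewrite (_ : _ - _ = c * h ^+ 2); last by ring.
by rewrite absM expr2 absM -expr2.
Qed.

Definition cgauss s w z : R := expR (- (s * abs (z - w) ^+ 2)).

Lemma cgauss_ge0 s w z : 0 <= cgauss s w z.
Proof. exact: expR_ge0. Qed.

Lemma rdiff_cgauss s w z : 0 <= s -> rdiff (fun z => (cgauss s w z)%:C) z
  (- s%:C * conjc (z - w) * (cgauss s w z)%:C) (- s%:C * (z - w) * (cgauss s w z)%:C).
Proof.
move=> s0; set v := z - w.
pose K := s * (2 * abs v + 1).
have v0 := abs_ge0 v.
have K0 : 0 <= K by rewrite mulr_ge0// addr_ge0// mulr_ge0.
have g1 : cgauss s w z <= 1.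
  by rewrite /cgauss expRN invf_le1 ?expR_gt0// (le_trans _ (expR_ge1Dx _))// lerDl mulr_ge0 ?sqr_ge0.
pose M := K ^+ 2 * expR K + s.
have M0 : 0 <= M by rewrite addr_ge0// mulr_ge0 ?sqr_ge0 ?expR_ge0.
apply: (@rdiff_quadratic _ _ _ _ _ M 1) => // h h1.
(* The exact increment of the exponent. Its linear part has the claimed Wirtinger coefficients up to
   the factor [cgauss s w z]; the rest is quadratic in [h]. *)
pose x := - s * (2 * complex.Re (conjc v * h) + abs h ^+ 2).
have gE : cgauss s w (z + h) = cgauss s w z * expR x.
  rewrite /cgauss -expRD; congr expR; rewrite /x -/v.
  have -> : z + h - w = v + h by rewrite /v; ring.
  by rewrite !sqr_abs !ReImE; ring.
have rE : (- s%:C * conjc v * (cgauss s w z)%:C) * h + (- s%:C * v * (cgauss s w z)%:C) * conjc h =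
    (cgauss s w z * (x + s * abs h ^+ 2))%:C.
  by apply: complex_ext; rewrite /x !ReImE; ring.
rewrite rE gE -!rmorphB abs_real.
have -> : cgauss s w z * expR x - cgauss s w z - cgauss s w z * (x + s * abs h ^+ 2) =
  cgauss s w z * ((expR x - 1 - x) - s * abs h ^+ 2) by ring.
have ha := abs_ge0 h.
have hh : abs h ^+ 2 <= abs h by rewrite expr2 ler_piMr// ltW.
have xK : `|x| <= K * abs h.
  rewrite /x normrM normrN (ger0_norm s0) /K -mulrA ler_wpM2l//.
  apply: (le_trans (ler_normD _ _)); rewrite normrX (ger0_norm ha) (normrM 2).
  rewrite normr_nat [leRHS]mulrDl mul1r lerD//.
  by rewrite -mulrA ler_wpM2l// (le_trans (Re_le_abs _))// absM absJ.
have xK' : `|x| <= K by apply: (le_trans xK); rewrite ler_piMr// ltW.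
rewrite normrM (ger0_norm (cgauss_ge0 _ _ _)).
apply: (@le_trans _ _ (1 * (M * abs h ^+ 2))); last by rewrite mul1r.
apply: ler_pM => //; first exact: cgauss_ge0.
apply: (le_trans (ler_normB _ _)).
rewrite /M mulrDl lerD//; last by rewrite ger0_norm// mulr_ge0 ?sqr_ge0.
apply: (le_trans (normr_expR_remainder_le x)).
rewrite [leRHS]mulrAC; apply: ler_pM.
- exact: sqr_ge0.
- exact: expR_ge0.
- rewrite -(real_normK (num_real x)) -exprMn; apply: lerXn2r => //; rewrite nnegrE ?normr_ge0//.
  exact: mulr_ge0.
- by rewrite ler_expR.
Qed.

Lemma rdiff_inv w z : z != w -> rdiff (fun z => (z - w)^-1) z (- (z - w)^-2) 0.
Proof.
move=> zw; set v := z - w; have v0 : v != 0 by rewrite subr_eq0.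
have av := abs_gt0 v0.
apply: (@rdiff_quadratic _ _ _ _ _ (2 / abs v ^+ 3) (abs v / 2)).
- by rewrite divr_ge0// exprn_ge0// ltW.
- by rewrite divr_gt0.
move=> h hv.
have tri := abs_triangle (v + h) (- h); rewrite addrK absN in tri.
have vh : abs v / 2 <= abs (v + h) by lra.
have vh0 : v + h != 0.
  by apply: contraTneq vh => ->; rewrite abs0 -ltNge divr_gt0.
have -> : z + h - w = v + h by rewrite /v; ring.
rewrite mul0r addr0 -/v.
rewrite (_ : _ - _ = h ^+ 2 / (v ^+ 2 * (v + h))); last by field; rewrite v0 vh0.
have e2 (u : R[i]) : abs (u ^+ 2) = abs u ^+ 2 by rewrite expr2 absM.
rewrite (absM (h ^+ 2)) absV (absM (v ^+ 2)) !e2 mulrC ler_wpM2r ?sqr_ge0//.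
have avh : 0 < abs (v + h) by exact: abs_gt0.
rewrite -[leRHS]invrK lef_pV2 ?posrE ?invr_gt0 ?divr_gt0 ?mulr_gt0 ?exprn_gt0//.
rewrite (_ : (2 / abs v ^+ 3)^-1 = abs v ^+ 2 * (abs v / 2)); last by field; rewrite gt_eqF.
by rewrite ler_pM2l ?exprn_gt0.
Qed.

End complex_exponential.

(** * Gaussian averages of entire functions *)

Section mean_value.
Variable R : realType.
Local Notation mu := (@lebesgue_measure R).
Local Notation mu2 := (@lebesgue_measure R \x @lebesgue_measure R)%E.
Implicit Types (phi : R[i] -> R[i]) (z h w : R[i]) (s x y : R).

(** The vanishing coefficient of [conjc h] is the Cauchy-Riemann equation; the two formulations
    differ by a division by [h]. *)
Lemma derivable_rdiff phi z :
  derivable (phi : R[i]^o -> R[i]^o) z 1 <-> exists a, rdiff phi z a 0.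
Proof.
split.
  move=> /cvg_ex[l] /cvgrPdist_le cv; exists l => e e0.
  have eC : 0 < e%:C :> R[i] by rewrite ltcR.
  have := cv _ eC; rewrite /dnbhs near_withinE => /nbhs_ballP[d /= d0 hd].
  have [dE dR] := ge0_complexP (ltW d0).
  have d0' : 0 < complex.Re d by rewrite -ltcR -dE.
  exists (complex.Re d) => // h hlt.
  have [->|h0] := eqVneq h 0.
    rewrite addr0 subrr mulr0 mul0r addr0 subrr abs0 mulr0 //.
  have := hd h; rewrite /ball/= sub0r normrN absE dE ltcR => /(_ hlt h0).
  rewrite absE lecR /GRing.scale/= mulr1 => le.
  rewrite mul0r addr0 (addrC z) -(abs_subC (l * h)).
  have -> : l * h - (phi (h + z) - phi z) = (l - h^-1 * (phi (h + z) - phi z)) * h.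
    by rewrite mulrBl mulrAC mulVf// mul1r.
  by rewrite absM ler_wpM2r ?abs_ge0.
move=> [a da]; apply/cvg_ex; exists a; apply/cvgrPdist_le => e e0.
have [eE eR] := ge0_complexP (ltW e0).
have e0' : 0 < complex.Re e by rewrite -ltcR -eE.
have [d d0 hd] := da _ e0'.
rewrite /dnbhs near_withinE; apply/nbhs_ballP; exists d%:C => /=; first by rewrite ltcR.
move=> h; rewrite /ball/= sub0r normrN absE ltcR => /hd le h0.
rewrite absE eE lecR /GRing.scale/= mulr1.
rewrite mul0r addr0 (addrC z) in le.
have h0' := abs_gt0 h0.
rewrite -(ler_pM2r h0') -absM; apply: le_trans le; rewrite abs_subC.
by rewrite mulrBl mulrAC mulVf// mul1r.
Qed.

Lemma entireP phi : entire phi <-> forall z, exists a, rdiff phi z a 0.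
Proof. by split=> h z; apply/derivable_rdiff; exact: h. Qed.

Lemma entire_ccontinuous phi : entire phi -> ccontinuous phi.
Proof.
by move=> /entireP ephi; apply: rdiff_ccontinuous => z; have [a da] := ephi z; exists a, 0.
Qed.

Lemma entireM (f g : R[i] -> R[i]) : entire f -> entire g -> entire (fun z => f z * g z).
Proof.
move=> /entireP ef /entireP eg; apply/entireP => z.
have [a da] := ef z; have [b db] := eg z.
by have := rdiffM da db; rewrite mul0r mulr0 addr0 => d; eexists; exact: d.
Qed.

Lemma entire_cexp_linear (c d : R[i]) : entire (fun z => cexp (c * z + d)).
Proof. by apply/entireP => z; eexists; exact: rdiff_cexp_linear. Qed.

Lemma cgaussE s w x y : cgauss s w (x +i* y) =
  gauss s (complex.Re w) x * gauss s (complex.Im w) y.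
Proof.
rewrite /cgauss /gauss -expRD sqr_abs; congr expR.
by case: w => a b; rewrite !ReImE; ring.
Qed.

Lemma rintegrable_cgauss s w : 0 < s ->
  rintegrable mu2 setT (fun t => cgauss s w (t.1 +i* t.2)).
Proof.
move=> s0; have := rintegrable_prod (rintegrable_gauss (complex.Re w) s0)
  (rintegrable_gauss (complex.Im w) s0).
by apply: eq_rintegrable => // t _; rewrite cgaussE.
Qed.

Lemma Rintegral_cgauss s w : 0 < s ->
  \int[mu2]_t cgauss s w (t.1 +i* t.2) = pi / s.
Proof.
move=> s0; have i1 := rintegrable_gauss (complex.Re w) s0.
have i2 := rintegrable_gauss (complex.Im w) s0.
rewrite Rintegral_prodE; [|exact: rintegrable_cgauss|]; last first.
  move=> x; apply: eq_rintegrable (rintegrableZ (gauss s (complex.Re w) x) measurableT i2) => //.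
  by move=> y _; rewrite /= cgaussE.
transitivity (\int[mu]_x (gauss s (complex.Re w) x * Num.sqrt (pi / s))).
  apply: eq_Rintegral => x _; rewrite -(Rintegral_gauss (complex.Im w) s0) -RintegralZl//.
  by apply: eq_Rintegral => y _; rewrite /= cgaussE.
by rewrite (RintegralZr _ measurableT i1) Rintegral_gauss// -expr2 sqr_sqrtr// divr_ge0 ?pi_ge0// ltW.
Qed.

(** Away from [w] the factor [(z - w)^-1] is holomorphic, and the d-bar derivative of a Gaussian
    carries the factor [z - w] that cancels it. At [w] the difference of the Gaussians vanishes to
    second order, so the singularity is removable and no disc around it has to be cut out. *)
Lemma rdiff_gauss_kernel s w z : 1 <= s ->
  exists a, rdiff (fun z => ((cgauss 1 w z)%:C - (cgauss s w z)%:C) * (z - w)^-1) z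
    a (s * cgauss s w z - cgauss 1 w z)%:C.
Proof.
move=> s1; have s0 : 0 <= s by exact: le_trans s1.
have [->|zw] := eqVneq z w; last first.
  have d1 := rdiffD (rdiff_cgauss w z ler01)
    (rdiffM (rdiff_cst (-1) z) (rdiff_cgauss w z s0)).
  have := rdiffM d1 (rdiff_inv zw).
  set a := (X in rdiff _ _ X _); set b := (X in rdiff _ _ _ X) => d; exists a.
  rewrite (_ : (s * cgauss s w z - cgauss 1 w z)%:C = b); last first.
    rewrite /b; have v0 : z - w != 0 by rewrite subr_eq0.
    rewrite realCB realCM; move: (z - w) (cgauss s w z)%:C (cgauss 1 w z)%:C v0.
    by move=> v e f v0; field.
  by move: d; congr rdiff; apply/funext => u; rewrite mulN1r.
(* At [z = w] the inverse of 0 is 0, which is the continuous value; the kernel at [w + h] is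
   [(s - 1)%:C * conjc h] up to third order. *)
exists 0.
pose C := 1 + s ^+ 2.
have C0 : 0 <= C by rewrite addr_ge0 ?sqr_ge0.
apply: (@rdiff_quadratic _ _ _ _ _ C 1) => // h h1.
rewrite mul0r add0r subrr invr0 mulr0 subr0 addrAC subrr add0r.
have [->|h0] := eqVneq h 0.
  by rewrite invr0 mulr0 conjc0 mulr0 subrr abs0 expr0n mulr0.
have ah := abs_gt0 h0.
have g t : cgauss t w (w + h) = expR (- (t * abs h ^+ 2)).
  by rewrite /cgauss addrAC subrr add0r.
have gw t : cgauss t w w = 1 by rewrite /cgauss subrr abs0 expr0n mulr0 oppr0 expR0.
rewrite !g !gw mulr1.
set q := abs h ^+ 2.
have q0 : 0 <= q by exact: sqr_ge0.
(* The upper bound rests on [(1 - t + t ^+ 2) * (1 + t) = 1 + t ^+ 3]. *)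
have bd (t : R) : 0 <= t -> 1 - t <= expR (- t) <= 1 - t + t ^+ 2.
  move=> t0; have := expR_ge1Dx (- t) => h2; rewrite h2 /=.
  rewrite expRN; apply: (@le_trans _ _ (1 + t)^-1).
    rewrite lef_pV2 ?posrE ?expR_gt0 ?expR_ge1Dx//; lra.
  rewrite -[leLHS]mul1r ler_pdivrMr; last by lra.
  have t3 : 0 <= t ^+ 3 by exact: exprn_ge0.
  by rewrite (_ : _ * (1 + t) = 1 + t ^+ 3) ?lerDl//; ring.
have -> : ((expR (- (1 * q)))%:C - (expR (- (s * q)))%:C) * h^-1 - (s - 1)%:C * conjc h =
    (expR (- (1 * q)) - expR (- (s * q)) - (s - 1) * q)%:C * h^-1.
  have hc : conjc h = q%:C * h^-1.
    by rewrite /q -mul_conj mulrAC mulfV// mul1r.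
  by rewrite hc !(realCB, realCM); ring.
rewrite absM absV abs_real ler_pdivrMr//.
rewrite mul1r; have /andP[b1 b2] := bd q q0.
have /andP[b3 b4] := bd (s * q) (mulr_ge0 s0 q0).
apply: (@le_trans _ _ ((1 + s ^+ 2) * q ^+ 2)).
  by rewrite ler_norml; apply/andP; split; nra.
rewrite /C -mulrA ler_wpM2l// /q -exprM -exprSr; apply: ler_wiXn2l => //; exact: ltW.
Qed.

(** With [v = abs (z - w)], the numerator is [cgauss 1 w z] times a factor at most 1 and at most
    [(s - 1) * v ^+ 2]; the former bound serves for [v > 1], the latter for [v <= 1]. Domination by
    [cgauss 1 w] is what makes the product with [phi] integrable. *)
Lemma gauss_kernel_le s w z : 1 <= s ->
  abs (((cgauss 1 w z)%:C - (cgauss s w z)%:C) * (z - w)^-1) <= s * cgauss 1 w z.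
Proof.
move=> s1; have g0 := @cgauss_ge0 R 1 w z.
have [->|zw] := eqVneq z w.
  by rewrite subrr invr0 mulr0 abs0 mulr_ge0// ?cgauss_ge0// (le_trans _ s1).
have v0 : 0 < abs (z - w) by rewrite abs_gt0// subr_eq0.
rewrite absM absV -realCB abs_real ler_pdivrMr//.
have gE : cgauss s w z = cgauss 1 w z * expR (- ((s - 1) * abs (z - w) ^+ 2)).
  by rewrite /cgauss -expRD; congr expR; ring.
rewrite gE -{1}[cgauss 1 w z]mulr1 -mulrBr normrM (ger0_norm g0) mulrAC mulrC.
rewrite ler_wpM2r//.
have x0 : 0 <= (s - 1) * abs (z - w) ^+ 2 by rewrite mulr_ge0 ?sqr_ge0 ?subr_ge0.
have e1 : expR (- ((s - 1) * abs (z - w) ^+ 2)) <= 1.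
  by rewrite -[leRHS]expR0 ler_expR oppr_le0.
have e2 := expR_ge1Dx (- ((s - 1) * abs (z - w) ^+ 2)).
have e3 := expR_ge0 (- ((s - 1) * abs (z - w) ^+ 2)).
rewrite ger0_norm ?subr_ge0//.
move: (expR _) e1 e2 e3 => e e1 e2 e3.
move: (abs (z - w)) v0 x0 e2 => v v0 x0 e2.
by have [v1|v1] := leP v 1; nra.
Qed.

(* Green's formula with the kernel (exp(-|z-w|^2) - exp(-s|z-w|^2)) / (z - w). *)
Lemma cintegral_cgauss_indep phi w s : entire phi -> 1 <= s ->
  rintegrable mu2 setT (fun t => abs (phi (t.1 +i* t.2)) * cgauss 1 w (t.1 +i* t.2)) ->
  cintegral mu2 (fun t => phi (t.1 +i* t.2) * (s * cgauss s w (t.1 +i* t.2))%:C) =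
  cintegral mu2 (fun t => phi (t.1 +i* t.2) * (cgauss 1 w (t.1 +i* t.2))%:C).
Proof.
move=> ephi s1 iphi; have s0 : 0 <= s by exact: le_trans s1.
have cphi := entire_ccontinuous ephi.
pose k z := ((cgauss 1 w z)%:C - (cgauss s w z)%:C) * (z - w)^-1.
pose b z := (s * cgauss s w z - cgauss 1 w z)%:C.
have dk z : exists a, rdiff k z a (b z) by exact: rdiff_gauss_kernel.
have ck : ccontinuous k.
  by apply: rdiff_ccontinuous => z; have [a da] := dk z; exists a, (b z).
have cg t : 0 <= t -> ccontinuous (fun z => (cgauss t w z)%:C).
  by move=> t0; apply: rdiff_ccontinuous => z; do 2 eexists; exact: rdiff_cgauss.
have gs z : cgauss s w z <= cgauss 1 w z.
  by rewrite /cgauss ler_expR lerN2 ler_wpM2r ?sqr_ge0.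
have cgs : ccontinuous (fun z => (s * cgauss s w z)%:C).
  have := ccontinuousM (ccontinuous_cst s%:C) (cg s s0).
  by congr ccontinuous; apply/funext => z; rewrite realCM.
have is_ := rintegrableZ s measurableT iphi.
have i1 : cintegrable mu2 (fun t => phi (t.1 +i* t.2) * (cgauss 1 w (t.1 +i* t.2))%:C).
  apply: cintegrable_le iphi _.
    by have := ccontinuous_measurable (ccontinuousM cphi (cg 1 ler01)).
  by move=> t; rewrite absM abs_real ger0_norm// cgauss_ge0.
have i2 : cintegrable mu2 (fun t => phi (t.1 +i* t.2) * (s * cgauss s w (t.1 +i* t.2))%:C).
  apply: cintegrable_le is_ _.
    by have := ccontinuous_measurable (ccontinuousM cphi cgs).
  move=> t; rewrite absM abs_real ger0_norm ?mulr_ge0 ?cgauss_ge0// mulrCA.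
  by rewrite ler_wpM2l// ler_wpM2l ?abs_ge0.
apply/eqP; rewrite -subr_eq0 -cintegralB//; apply/eqP.
rewrite -[RHS](@integral_dbar_eq0 R (fun z => phi z * k z) (fun z => phi z * b z)).
- by apply: eq_cintegral => t; rewrite /b realCB; ring.
- move=> z; have [a da] := (entireP phi).1 ephi z; have [a' da'] := dk z.
  by have := rdiffM da da'; rewrite mul0r add0r => d; eexists; exact: d.
- apply: ccontinuousM => //.
  have := ccontinuousD cgs (ccontinuousM (ccontinuous_cst (-1)) (cg 1 ler01)).
  by congr ccontinuous; apply/funext => z; rewrite /b realCB mulN1r.
- apply: cintegrable_le is_ _.
    by have := ccontinuous_measurable (ccontinuousM cphi ck).
  by move=> t; rewrite absM mulrCA ler_wpM2l ?abs_ge0// gauss_kernel_le.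
- have := cintegrableD i2 (cintegrableZ (-1) i1).
  by congr cintegrable; apply/funext => t; rewrite /b realCB; ring.
Qed.

End mean_value.

(** * The Bargmann space and its reproducing kernel *)

Section bargmann_space.
Variable R : realType.
Local Notation mu := (@lebesgue_measure R).
Local Notation mu2 := (@lebesgue_measure R \x @lebesgue_measure R)%E.
Implicit Types (phi psi : R[i] -> R[i]) (z h w : R[i]) (s x y : R).

(* As s grows, s exp(-s |z - w|^2) concentrates at w. *)
Theorem cintegral_mul_cgauss phi w : entire phi ->
  rintegrable mu2 setT (fun t => abs (phi (t.1 +i* t.2)) * cgauss 1 w (t.1 +i* t.2)) ->
  cintegral mu2 (fun t => phi (t.1 +i* t.2) * (cgauss 1 w (t.1 +i* t.2))%:C) =
  pi%:C * phi w.
Proof.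
move=> ephi iphi; have cphi := entire_ccontinuous ephi.
set I := cintegral _ _.
have g1 := rintegrable_cgauss w (@ltr01 R).
(* An integrable bound for [phi - phi w] times the Gaussian of parameter 1, independent of [s]. *)
pose T t := (abs (phi (t.1 +i* t.2)) + abs (phi w)) * cgauss 1 w (t.1 +i* t.2).
have iT : rintegrable mu2 setT T.
  apply: eq_rintegrable (rintegrableD measurableT iphi
    (rintegrableZ (abs (phi w)) measurableT g1)) => //.
  by move=> t _; rewrite /T; ring.
pose T0 := \int[mu2]_t T t.
have T0_ge0 : 0 <= T0.
  by apply: Rintegral_ge0 => t _; rewrite mulr_ge0 ?cgauss_ge0// addr_ge0// abs_ge0.
apply/eqP; rewrite -subr_eq0; apply/eqP/abs_eq0/eqP; rewrite eq_le abs_ge0 andbT.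
apply/ler_addgt0Pr => e e0; rewrite add0r.
(* The total error is [e' * pi] from the neighbourhood of [w] and [e'] from the rest of the
   plane. *)
pose e' := e / (pi + 1).
have pi1 : 0 < pi + 1 :> R by rewrite ltr_wpDl// pi_ge0.
have e'0 : 0 < e' by rewrite divr_gt0.
have [d d0 hd] := cphi w e' e'0.
pose C := 8 / d ^+ 4 * (T0 + 1).
have T1 : 0 < T0 + 1 by rewrite ltr_wpDl.
have C0 : 0 < C by rewrite mulr_gt0// divr_gt0// exprn_gt0.
have [n _ /(_ n (leqnn n)) /=] := near_infty_natSinv_lt (PosNum (divr_gt0 e'0 C0)).
set q := n.+1%:R^-1 => qe.
have q0 : 0 < q by rewrite invr_gt0.
(* [s - 1 = n.+1%:R], so [cgauss s w] is [cgauss 1 w] times a Gaussian factor of parameter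
   [n.+1%:R]. *)
pose s : R := n.+2%:R.
have s1 : 1 <= s by rewrite ler1n.
have s0 : 0 < s by exact: lt_le_trans s1.
pose M := 8 / d ^+ 4 * q.
have M0 : 0 <= M by rewrite mulr_ge0 ?divr_ge0 ?exprn_ge0// ltW.
have igs := rintegrable_cgauss w s0.
have pw (t : R * R) : abs ((phi (t.1 +i* t.2) - phi w) * (s * cgauss s w (t.1 +i* t.2))%:C) <=
    e' * (s * cgauss s w (t.1 +i* t.2)) + M * T t.
  have -> : t.1 +i* t.2 = w + (t.1 +i* t.2 - w) by rewrite addrC subrK.
  rewrite /T; set z := t.1 +i* t.2; set v := z - w.
  have zE : w + v = z by rewrite /v addrC subrK.
  have sg0 : 0 <= s * cgauss s w (w + v) by rewrite mulr_ge0 ?cgauss_ge0// ltW.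
  rewrite absM abs_real (ger0_norm sg0).
  have MT0 : 0 <= M * ((abs (phi z) + abs (phi w)) * cgauss 1 w z).
    by rewrite mulr_ge0// mulr_ge0 ?cgauss_ge0// addr_ge0// abs_ge0.
  have [lt|ge] := ltP (abs v) d.
    apply: (@le_trans _ _ (e' * (s * cgauss s w (w + v)))); last by rewrite lerDl.
    by rewrite ler_wpM2r// hd.
  apply: (@le_trans _ _ (M * ((abs (phi z) + abs (phi w)) * cgauss 1 w z))); last first.
    by rewrite lerDr mulr_ge0// ltW.
  rewrite [leRHS]mulrCA; apply: ler_pM => //; first exact: abs_ge0.
    by rewrite zE (le_trans (abs_triangle _ _))// absN.
  rewrite zE.
  have -> : cgauss s w z = expR (- (n.+1%:R * abs v ^+ 2)) * cgauss 1 w z.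
    rewrite /cgauss -expRD; congr expR; rewrite /s -/v -natr1; ring.
  rewrite mulrA ler_wpM2r ?cgauss_ge0//.
  pose x : R := n.+1%:R * abs v ^+ 2.
  have x_ge : n.+1%:R * d ^+ 2 <= x.
    by rewrite ler_pM2l// ler_pXn2r ?nnegrE ?abs_ge0// ltW.
  have nd0 : 0 < n.+1%:R * d ^+ 2 :> R by rewrite mulr_gt0// exprn_gt0.
  have x0 : 0 < x by exact: lt_le_trans x_ge.
  rewrite -/x expRN.
  (* Quadratic growth of the exponential beats the linear factor [s <= 2 * n.+1%:R]: the quotient is
     at most [8 / d ^+ 4] times the reciprocal of [n.+1%:R], which is [M]. *)
  have ex : (n.+1%:R * d ^+ 2) ^+ 2 / 4 <= expR x.
    have -> : expR x = expR (x / 2) * expR (x / 2) by rewrite -expRD -splitr.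
    have x2 : x / 2 <= expR (x / 2) by apply: le_trans (expR_ge1Dx _); rewrite lerDr.
    have x20 : 0 <= x / 2 by rewrite divr_ge0// ltW.
    apply: (@le_trans _ _ ((x / 2) * (x / 2))); last exact: ler_pM.
    rewrite (_ : _ / 4 = (n.+1%:R * d ^+ 2) / 2 * ((n.+1%:R * d ^+ 2) / 2)); last by field.
    by apply: ler_pM; rewrite ?divr_ge0 ?ler_wpM2r// ltW.
  apply: (@le_trans _ _ (s * ((n.+1%:R * d ^+ 2) ^+ 2 / 4)^-1)).
    by rewrite ler_wpM2l ?(ltW s0)// lef_pV2 ?posrE ?expR_gt0// divr_gt0// exprn_gt0.
  have s2 : s <= 2 * n.+1%:R by rewrite /s -natrM ler_nat mul2n -addnn addSn addnS !ltnS leq_addl.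
  apply: (@le_trans _ _ (2 * n.+1%:R * ((n.+1%:R * d ^+ 2) ^+ 2 / 4)^-1)).
    by rewrite ler_wpM2r// invr_ge0 divr_ge0// sqr_ge0.
  rewrite /M /q le_eqVlt; apply/orP; left; apply/eqP.
  have := ltr0Sn R n; move: (n.+1%:R : R) => m m0.
  by field; rewrite !gt_eqF.
have cphis : ccontinuous (fun z => (s * cgauss s w z)%:C).
  have cg : ccontinuous (fun z => (cgauss s w z)%:C).
    by apply: rdiff_ccontinuous => z; do 2 eexists; exact: rdiff_cgauss (ltW s0).
  have := ccontinuousM (ccontinuous_cst s%:C) cg.
  by congr ccontinuous; apply/funext => z; rewrite realCM.
have idiff : cintegrable mu2
    (fun t => (phi (t.1 +i* t.2) - phi w) * (s * cgauss s w (t.1 +i* t.2))%:C).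
  apply: cintegrable_le (rintegrableD measurableT (rintegrableZ e' measurableT
    (rintegrableZ s measurableT igs)) (rintegrableZ M measurableT iT)) pw.
  exact: (ccontinuous_measurable (ccontinuousM
    (ccontinuousD cphi (ccontinuous_cst (- phi w))) cphis)).
have icst : cintegrable mu2 (fun t => phi w * (s * cgauss s w (t.1 +i* t.2))%:C).
  by apply: cintegrableZ; split; [exact: rintegrableZ|exact: rintegrable0].
have IE : I - pi%:C * phi w = cintegral mu2
    (fun t => (phi (t.1 +i* t.2) - phi w) * (s * cgauss s w (t.1 +i* t.2))%:C).
  have -> : pi%:C * phi w = cintegral mu2 (fun t => phi w * (s * cgauss s w (t.1 +i* t.2))%:C).
    rewrite cintegralZ; last by split; [exact: rintegrableZ|exact: rintegrable0].
    rewrite cintegral_real (RintegralZl _ measurableT igs) Rintegral_cgauss//.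
    by rewrite mulrC mulrCA mulfV ?mulr1// gt_eqF.
  rewrite /I -(cintegral_cgauss_indep ephi s1 iphi) -cintegralB//.
    by apply: eq_cintegral => t; ring.
  have := cintegrableD idiff icst; congr cintegrable; apply/funext => t; ring.
rewrite IE; apply: (le_trans (abs_cintegral_le idiff)).
have i1 := rintegrableZ e' measurableT (rintegrableZ s measurableT igs).
have i2 := rintegrableZ M measurableT iT.
apply: (le_trans (le_Rintegral measurableT (cintegrable_abs idiff)
  (rintegrableD measurableT i1 i2) (fun t _ => pw t))).
rewrite RintegralD// (RintegralZl _ measurableT (rintegrableZ s measurableT igs)).
rewrite (RintegralZl _ measurableT igs) (RintegralZl _ measurableT iT) Rintegral_cgauss//.
rewrite -/T0.
have MT : M * T0 <= e'.
  apply: (@le_trans _ _ (C * q)).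
    rewrite /M /C mulrAC ler_wpM2r ?(ltW q0)// ler_wpM2l ?divr_ge0 ?exprn_ge0// ?(ltW d0)//.
    by rewrite lerDl.
  by rewrite mulrC -ler_pdivlMr// ltW.
have sE : s * (pi / s) = pi by rewrite mulrC divfK// gt_eqF.
have eE : e = e' * pi + e' by rewrite -[X in _ + X]mulr1 -mulrDr /e' divfK// gt_eqF.
by rewrite sE [leRHS]eE lerD.
Qed.

(** Each function takes half of the exponent of the weight, which turns the Bargmann inner product
    into [pi^-1] times the one of square-integrable functions on the plane. *)
Definition bargmann_lift phi (t : measurableTypeR R * measurableTypeR R) : R[i] :=
  phi (t.1 +i* t.2) * (expR (- ((t.1 ^+ 2 + t.2 ^+ 2) / 2)))%:C.

Lemma sqr_expR_half x : expR (- (x / 2)) ^+ 2 = expR (- x).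
Proof. by rewrite expr2 -expRD; congr expR; field. Qed.

Lemma sqr_abs_bargmann_lift phi t : abs (bargmann_lift phi t) ^+ 2 =
  abs (phi (t.1 +i* t.2)) ^+ 2 * expR (- (t.1 ^+ 2 + t.2 ^+ 2)).
Proof.
by rewrite absM abs_real (ger0_norm (expR_ge0 _)) exprMn sqr_expR_half.
Qed.

Lemma cmeasurable_bargmann_lift phi : entire phi -> cmeasurable (bargmann_lift phi).
Proof.
move=> /entire_ccontinuous cphi; apply: cmeasurableM.
  exact: (ccontinuous_measurable cphi).
apply: cmeasurable_real; apply: (measurableT_comp (@measurable_expR R)).
apply: measurableT_comp => //; apply: measurable_funM; last exact: measurable_cst.
by apply: measurable_funD; apply: measurable_funX.
Qed.

Lemma car_bargmannP phi : car bargmann phi <->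
  entire phi /\ L2fun mu2 (bargmann_lift phi).
Proof.
split=> -[ephi].
  move=> h; split=> //; apply/L2funP; split; first exact: cmeasurable_bargmann_lift.
  by under eq_integral do rewrite sqr_abs_bargmann_lift.
move=> /L2funP[_ h]; split=> //; move: h.
by under eq_integral do rewrite sqr_abs_bargmann_lift.
Qed.

Lemma ip_bargmannE phi psi : ip bargmann phi psi =
  (pi^-1)%:C * L2prod mu2 (bargmann_lift phi) (bargmann_lift psi).
Proof.
congr (_ * _); apply: eq_cintegral => t; rewrite numconjE /bargmann_lift conjCM conjc_real.
by rewrite mulrACA -realCM -expr2 sqr_expR_half.
Qed.

Lemma bargmann_lift_lincomb a phi psi : bargmann_lift (lincomb a phi psi) =
  fun t => a * bargmann_lift phi t + bargmann_lift psi t.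
Proof. by apply/funext => t; rewrite /bargmann_lift /lincomb; ring. Qed.

Lemma entire_lincomb a phi psi : entire phi -> entire psi -> entire (lincomb a phi psi).
Proof.
move=> /entireP e1 /entireP e2; apply/entireP => z.
have [b db] := e1 z; have [c dc] := e2 z.
have := rdiffD (rdiffM (rdiff_cst a z) db) dc.
by rewrite mul0r mulr0 !addr0 => d; eexists; exact: d.
Qed.

Definition bargmann_kernel z w : R[i] := cexp (z * conjc w).

(** Completing the square, the squared modulus of the kernel times the weight is [expR (abs w ^+ 2)]
    times [cgauss 1 w]. *)
Lemma bargmann_kernel_car w : car bargmann (fun z => bargmann_kernel z w).
Proof.
have ek : entire (fun z => bargmann_kernel z w).
  have := @entire_cexp_linear R (conjc w) 0.
  by congr entire; apply/funext => z; rewrite /bargmann_kernel addr0 mulrC.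
apply/car_bargmannP; split=> //.
apply: (@L2fun_le _ _ R mu2 _ (fun t => expR (abs w ^+ 2) * cgauss 1 w (t.1 +i* t.2))).
- exact: cmeasurable_bargmann_lift.
- by apply: rintegrableZ => //; exact: rintegrable_cgauss.
- move=> t; rewrite sqr_abs_bargmann_lift /bargmann_kernel abs_cexp expr2 /cgauss -!expRD.
  rewrite le_eqVlt; apply/orP; left; apply/eqP; congr expR.
  by rewrite !sqr_abs !ReImE; ring.
Qed.

(** The integrand of the inner product is [psi] times [cgauss 1 w], where [psi] is [phi] times an
    entire function with value 1 at [w]; so the Gaussian mean value property of [psi] gives
    [phi w]. *)
Lemma bargmann_reproducing phi w : car bargmann phi ->
  phi w = ip bargmann phi (fun z => bargmann_kernel z w).
Proof.
move=> /car_bargmannP[ephi Lphi].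
have /car_bargmannP[_ Lk] := bargmann_kernel_car w.
pose psi z := phi z * cexp (- conjc w * z + conjc w * w).
have epsi : entire psi.
  exact: (@entireM R phi (fun z => cexp (- conjc w * z + conjc w * w)) ephi
    (@entire_cexp_linear R _ _)).
have psiE (t : R * R) : psi (t.1 +i* t.2) * (cgauss 1 w (t.1 +i* t.2))%:C =
    bargmann_lift phi t * conjc (bargmann_lift (fun z => bargmann_kernel z w) t).
  rewrite /psi /bargmann_lift /bargmann_kernel /cgauss conjCM conjc_real -!cexp_real -cexpJ.
  rewrite -!mulrA; congr (_ * _); rewrite -!cexpD; congr cexp.
  by apply: complex_ext; rewrite !ReImE ?sqr_abs ?ReImE; field.
have i1 : rintegrable mu2 setT (fun t => abs (psi (t.1 +i* t.2)) * cgauss 1 w (t.1 +i* t.2)).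
  apply: eq_rintegrable (L2fun_abs_mul Lphi Lk) => //.
  move=> t _.
  rewrite -(absJ (bargmann_lift (fun z => bargmann_kernel z w) t)) -absM -psiE.
  by rewrite absM abs_real ger0_norm ?cgauss_ge0.
have := cintegral_mul_cgauss epsi i1.
rewrite ip_bargmannE /L2prod -(eq_cintegral mu2 psiE) => ->.
rewrite mulrA -realCM mulVf ?mul1r ?gt_eqF ?pi_gt0//.
by rewrite /psi mulNr addNr cexp0 mulr1.
Qed.

Lemma prehilbert_bargmann : prehilbert (@bargmann R).
Proof.
split.
  split.
    apply/car_bargmannP; split.
      by apply/entireP => z; exists 0; exact: rdiff_cst.
    rewrite (_ : bargmann_lift _ = fun=> 0); first exact: L2fun0.
    by apply/funext => t; rewrite /bargmann_lift mul0r.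
  move=> a phi psi /car_bargmannP[e1 L1] /car_bargmannP[e2 L2].
  apply/car_bargmannP; split; first exact: entire_lincomb.
  by rewrite (bargmann_lift_lincomb a phi psi); exact: L2fun_lincomb.
have pi0 : 0 <= (pi : R)^-1 by rewrite invr_ge0 pi_ge0.
split.
- move=> a phi psi chi /car_bargmannP[e1 L1] /car_bargmannP[e2 L2] /car_bargmannP[e3 L3].
  by rewrite !ip_bargmannE (bargmann_lift_lincomb a phi psi) L2prod_lincombl//; ring.
- move=> phi psi /car_bargmannP[e1 L1] /car_bargmannP[e2 L2].
  by rewrite !ip_bargmannE (L2prod_conj L1 L2) conjCM conjc_real.
- move=> phi _; rewrite ip_bargmannE L2prod_self -realCM ler0c mulr_ge0//.
  by apply: Rintegral_ge0 => t _; exact: sqr_ge0.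
- move=> phi cphi; have /car_bargmannP[e1 L1] := cphi.
  rewrite ip_bargmannE => /eqP; rewrite mulf_eq0 => /orP[/eqP[/eqP]|/eqP h].
    by rewrite invr_eq0 gt_eqF ?pi_gt0.
  (* Vanishing almost everywhere becomes vanishing everywhere through the reproducing property. *)
  have ae0 := L2prod_eq0 L1 h.
  apply/funext => w; rewrite (bargmann_reproducing w cphi) ip_bargmannE.
  have /car_bargmannP[_ Lk] := bargmann_kernel_car w.
  rewrite /L2prod -[RHS](mulr0 (pi^-1)%:C); congr (_ * _).
  transitivity (cintegral mu2 (fun=> 0 : R[i])); last first.
    by rewrite (cintegral_real mu2 (fun=> 0)) Rintegral_cst// mul0r.
  apply: ae_eq_cintegral.
  - exact: cintegrable_measurable (L2prod_integrable L1 Lk).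
  - exact: cmeasurable_cst.
  - by apply: filterS ae0 => t ->; rewrite mul0r.
Qed.

Lemma kernel_of_bargmann : kernel_of bargmann bargmann_kernel.
Proof.
move=> w; split; first exact: bargmann_kernel_car.
by move=> phi; exact: bargmann_reproducing.
Qed.

End bargmann_space.

(** * The Segal-Bargmann transform *)

Section segal_bargmann.
Variable R : realType.
Local Notation mu := (@lebesgue_measure R).
Implicit Types (f g : R -> R[i]) (z h w : R[i]) (u x y : R).

Lemma L2P f : L2 f <-> L2fun mu f.
Proof.
rewrite L2funP /L2 /cmeasurable /=.
by split=> [[m1 m2 h]|[[m1 m2] h]].
Qed.

Lemma L2ipE f g : L2ip f g = L2prod mu f g.
Proof. by apply: eq_cintegral => u; rewrite numconjE. Qed.

Lemma sqr_sqrt2 : Num.sqrt 2 ^+ 2 = 2 :> R.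
Proof. by rewrite sqr_sqrtr. Qed.

Lemma cmeasurable_SBkernel (c : R) z : cmeasurable (SBkernel c z).
Proof.
apply: cmeasurableM; first exact: cmeasurable_cst.
apply: cmeasurable_cexp; apply: cmeasurableB; last exact: cmeasurable_cst.
apply: cmeasurableD.
  apply: cmeasurableN; apply: cmeasurable_real; apply: measurable_funM.
    exact: measurable_funX.
  exact: measurable_cst.
apply: cmeasurableM; last exact: cmeasurable_cst.
apply: cmeasurable_real; apply: measurable_funM => //; exact: measurable_cst.
Qed.

(** Completing the square in [u]; the remaining growth [expR (abs z ^+ 2)] is the one that the
    Bargmann weight compensates. *)
Lemma sqr_abs_SBkernel (c : R) z u : abs (SBkernel c z u) ^+ 2 =
  c ^+ 2 * expR (abs z ^+ 2) * gauss 1 (Num.sqrt 2 * complex.Re z) u.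
Proof.
rewrite /SBkernel absM abs_real abs_cexp exprMn real_normK ?num_real//.
rewrite -mulrA; congr (_ * _); rewrite /gauss -expRD expr2 -expRD; congr expR.
rewrite half_real expr2 !ReImE sqr_abs.
rewrite (_ : (u - Num.sqrt 2 * complex.Re z) ^+ 2 = u ^+ 2 -
  2 * (Num.sqrt 2 * u * complex.Re z) + Num.sqrt 2 ^+ 2 * complex.Re z ^+ 2); last by ring.
by rewrite sqr_sqrt2; field.
Qed.

Lemma L2fun_SBkernel (c : R) z : L2fun mu (SBkernel c z).
Proof.
apply: (@L2fun_le _ _ R mu _ (fun u => c ^+ 2 * expR (abs z ^+ 2) *
  gauss 1 (Num.sqrt 2 * complex.Re z) u)).
- exact: cmeasurable_SBkernel.
- by apply: rintegrableZ => //; exact: rintegrable_gauss.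
- by move=> u; rewrite sqr_abs_SBkernel.
Qed.

Lemma SB_integrable (c : R) f z : L2fun mu f ->
  cintegrable mu (fun u => SBkernel c z u * f u).
Proof. by move=> Lf; apply: L2fun_mul => //; exact: L2fun_SBkernel. Qed.

Lemma SB_L2prod (c : R) f z : SB c f z = L2prod mu f (fun u => conjc (SBkernel c z u)).
Proof. by apply: eq_cintegral => u; rewrite conjcK mulrC. Qed.

Lemma SB_lincomb (c : R) a f g : L2fun mu f -> L2fun mu g ->
  SB c (fun u => a * f u + g u) = lincomb a (SB c f) (SB c g).
Proof.
move=> Lf Lg; apply/funext => z; rewrite /lincomb !SB_L2prod L2prod_lincombl//.
by apply: L2funJ; exact: L2fun_SBkernel.
Qed.

Lemma SB_ae (c : R) f g : L2fun mu f -> L2fun mu g -> ae_equal f g -> SB c f = SB c g.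
Proof.
move=> Lf Lg fg; apply/funext => z; apply: ae_eq_cintegral.
- by apply: cintegrable_measurable; exact: SB_integrable.
- by apply: cintegrable_measurable; exact: SB_integrable.
- by apply: negligibleS fg => u /= nfg fg; apply: nfg; rewrite fg.
Qed.

(** For [s = a +i* b] the real part of the exponent is completed to a square with centre
    [m = a / q], leaving an oscillation of frequency [k = q * b] about [m] with phase [a * b]. The
    sine is a cosine shifted by [pi / 2], so one real integral serves both parts. *)
Lemma cintegral_gauss_cexp (s : R[i]) :
  cintegrable mu (fun u => cexp (- (u ^+ 2)%:C + (Num.sqrt 2 * u)%:C * s)) /\
  cintegral mu (fun u => cexp (- (u ^+ 2)%:C + (Num.sqrt 2 * u)%:C * s)) =
  (Num.sqrt pi)%:C * cexp (s ^+ 2 / 2).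
Proof.
case: s => a b; pose q : R := Num.sqrt 2.
have qq : q ^+ 2 = 2 by exact: sqr_sqrt2.
have q0 : q != 0 by rewrite sqrtr_eq0 -ltNge.
pose m := a / q; pose k := q * b.
have mm : m ^+ 2 = a ^+ 2 / 2 by rewrite expr_div_n qq.
have kk : k ^+ 2 = 2 * b ^+ 2 by rewrite exprMn qq.
have qm : q * m = a by rewrite /m mulrC divfK.
have fE u : cexp (- (u ^+ 2)%:C + (q * u)%:C * (a +i* b)) =
    (expR (a ^+ 2 / 2) * (gauss 1 m u * cos (k * (u - m) + a * b))) +i*
    (expR (a ^+ 2 / 2) * (gauss 1 m u * cos (k * (u - m) + (a * b - pi / 2)))).
  rewrite /cexp !ReImE.
  have -> : - u ^+ 2 + (q * u * a - 0 * b) = a ^+ 2 / 2 + - (1 * (u - m) ^+ 2).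
    rewrite -mm -[in LHS]qm (_ : q * u * (q * m) = q ^+ 2 * (u * m)); last by ring.
    by rewrite qq; ring.
  have -> : - 0 + (q * u * b + 0 * a) = k * (u - m) + a * b.
    by rewrite /k -[in RHS]qm; ring.
  rewrite expRD -/(gauss 1 m u) addrA; congr (_ +i* _); rewrite -mulrA//.
  by congr (_ * (_ * _)); rewrite cosB cos_pihalf sin_pihalf mulr0 add0r mulr1.
have i1 t : rintegrable mu setT (fun u => gauss 1 m u * cos (k * (u - m) + t)).
  apply: rintegrable_le (rintegrable_gauss m ltr01) _ => //.
    apply: measurable_funM; first exact: measurable_gauss.
    apply: (measurableT_comp (continuous_measurable_fun (@continuous_cos R))).
    apply: measurable_funD => //; apply: measurable_funM => //.
    by apply: measurable_funB.
  move=> u _ /=; rewrite normrM (ger0_norm (gauss_ge0 _ _ _)) ler_piMr ?gauss_ge0//.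
  by rewrite ler_norml cos_geN1 cos_le1.
have vE t : \int[mu]_u (expR (a ^+ 2 / 2) * (gauss 1 m u * cos (k * (u - m) + t))) =
    Num.sqrt pi * (expR ((a ^+ 2 - b ^+ 2) / 2) * cos t).
  rewrite (RintegralZl _ measurableT (i1 t)) Rintegral_gauss_cos// kk divr1.
  rewrite (_ : (a ^+ 2 - b ^+ 2) / 2 = a ^+ 2 / 2 + - (2 * b ^+ 2 / (4 * 1))); last by field.
  by rewrite expRD; ring.
split.
  have iZ t := rintegrableZ (expR (a ^+ 2 / 2)) measurableT (i1 t).
  by split; [apply: eq_rintegrable (iZ (a * b))|
    apply: eq_rintegrable (iZ (a * b - pi / 2))] => // u _; rewrite fE ?Re_mk ?Im_mk.
rewrite (eq_cintegral mu fE) /cintegral.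
under eq_Rintegral do rewrite Re_mk.
rewrite vE; under eq_Rintegral do rewrite Im_mk.
rewrite vE realCE half_real expr2 /cexp !ReImE.
have -> : 2^-1 * (a * a - b * b) - 0 * (a * b + b * a) = (a ^+ 2 - b ^+ 2) / 2 by ring.
have -> : 2^-1 * (a * b + b * a) + 0 * (a * a - b * b) = a * b by field.
by rewrite cosB cos_pihalf sin_pihalf mulr0 add0r mulr1.
Qed.

(** The product of the two kernels is an exponential of [- u ^+ 2] plus a linear term with
    coefficient [s = z + conjc w]. In [s ^+ 2 / 2] the pure squares cancel against [d], and
    [z * conjc w] remains. *)
Lemma SB_kernel (c : R) z w :
  SB c (fun u => conjc (SBkernel c w u)) z =
  (c ^+ 2 * Num.sqrt pi)%:C * bargmann_kernel z w.
Proof.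
pose s := z + conjc w; pose d := - (z ^+ 2 + conjc w ^+ 2) / 2.
have e u : SBkernel c z u * conjc (SBkernel c w u) = ((c ^+ 2)%:C * cexp d) *
    cexp (- (u ^+ 2)%:C + (Num.sqrt 2 * u)%:C * s).
  rewrite /SBkernel conjCM conjc_real -cexpJ mulrACA -realCM -expr2 -mulrA.
  congr (_ * _); rewrite -!cexpD; congr cexp; rewrite /s /d.
  by apply: complex_ext; rewrite !half_real !expr2 !ReImE; field.
have [ci iE] := cintegral_gauss_cexp s.
rewrite /SB (eq_cintegral mu e) cintegralZ// iE.
rewrite /bargmann_kernel realCM -!mulrA; congr (_ * _).
rewrite mulrCA; congr (_ * _); rewrite -cexpD; congr cexp.
by rewrite /d /s; field.
Qed.

End segal_bargmann.

(** * Injectivity of the transform *)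

Section segal_bargmann_injectivity.
Variable R : realType.
Local Notation mu := (@lebesgue_measure R).
Implicit Types (f g : R -> R[i]) (z h w : R[i]) (u x y : R).

Lemma SB_eq0 (c : R) f : 0 < c -> L2fun mu f -> SB c f = (fun=> 0) ->
  {ae mu, forall u, f u = 0}.
Proof.
move=> c0 Lf SB0.
pose e u := expR (- (u ^+ 2 / 2)); pose g u := (e u)%:C * f u.
have ge u : e u != 0 by rewrite gt_eqF// expR_gt0.
(* The point on the imaginary axis is scaled so that the linear term becomes i k u; the term
   [- z ^+ 2 / 2] then gives the positive factor [expR (k ^+ 2 / 4)]. *)
have SBE k u : SBkernel c (0 +i* (k / Num.sqrt 2)) u * f u =
    (c * expR (k ^+ 2 / 4))%:C * (cexp (0 +i* (k * u)) * g u).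
  rewrite /SBkernel /g /e (realCM c) -!mulrA; congr (_ * _).
  rewrite [in RHS]mulrA [in RHS]mulrA; congr (_ * _).
  rewrite -!cexp_real -!cexpD; congr cexp.
  have q0 : Num.sqrt 2 != 0 :> R by rewrite sqrtr_eq0 -ltNge.
  have qp : Num.sqrt 2 * (k / Num.sqrt 2) = k by rewrite mulrC divfK.
  have pp : (k / Num.sqrt 2) * (k / Num.sqrt 2) = k * k / 2.
    by rewrite mulrACA -invfM -expr2 -expr2 sqr_sqrt2.
  move: qp pp; set p := k / _; set q := Num.sqrt 2 => qp pp.
  apply: complex_ext; rewrite half_real !ReImE; first lra.
  by rewrite -[in RHS]qp; ring.
have k0 u : SBkernel c 0 u = (c * e u)%:C.
  rewrite /SBkernel /e (realCM c) -cexp_real; congr (_ * cexp _).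
  by apply: complex_ext; rewrite half_real !ReImE; ring.
have ig : cintegrable mu g.
  have := cintegrableZ (c^-1)%:C (SB_integrable c 0 Lf).
  congr cintegrable; apply/funext => u.
  by rewrite k0 mulrA -realCM mulrA mulVf ?gt_eqF// mul1r.
have [ig1 ig2] := ig.
have mcos k : measurable_fun setT (fun u => cos (k * u) : R).
  apply: (measurableT_comp (continuous_measurable_fun (@continuous_cos R))).
  by apply: measurable_funM => //; exact: measurable_cst.
have msin k : measurable_fun setT (fun u => sin (k * u) : R).
  apply: (measurableT_comp (continuous_measurable_fun (@continuous_sin R))).
  by apply: measurable_funM => //; exact: measurable_cst.
have cos1 (x : R) : `|cos x| <= 1 by rewrite ler_norml cos_geN1 cos_le1.
have sin1 (x : R) : `|sin x| <= 1 by rewrite ler_norml sin_geN1 sin_le1.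
have icos k (r : R -> R) : rintegrable mu setT r ->
    rintegrable mu setT (fun u => r u * cos (k * u)).
  move=> ir; apply: rintegrable_le (rintegrable_norm ir) _ => //.
    exact: (measurable_funM (rintegrable_measurable measurableT ir) (mcos k)).
  by move=> u _ /=; rewrite normrM ler_piMr.
have isin k (r : R -> R) : rintegrable mu setT r ->
    rintegrable mu setT (fun u => r u * sin (k * u)).
  move=> ir; apply: rintegrable_le (rintegrable_norm ir) _ => //.
    exact: (measurable_funM (rintegrable_measurable measurableT ir) (msin k)).
  by move=> u _ /=; rewrite normrM ler_piMr.
pose g1 u := complex.Re (g u); pose g2 u := complex.Im (g u).
have cE k : cexp (0 +i* k) = cos k +i* sin k :> R[i].
  by rewrite /cexp /= expR0 !mul1r.
have icg k : cintegrable mu (fun u => cexp (0 +i* (k * u)) * g u).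
  split.
    apply: eq_rintegrable (rintegrableB measurableT (icos k _ ig1) (isin k _ ig2)) => //.
    by move=> u _; rewrite cE !ReImE; ring.
  apply: eq_rintegrable (rintegrableD measurableT (icos k _ ig2) (isin k _ ig1)) => //.
  by move=> u _; rewrite cE !ReImE; ring.
have fourier0 k : cintegral mu (fun u => cexp (0 +i* (k * u)) * g u) = 0.
  have := congr1 (fun F => F (0 +i* (k / Num.sqrt 2))) SB0.
  rewrite /SB (eq_cintegral mu (SBE k)) cintegralZ// => /eqP.
  rewrite mulf_eq0 => /orP[/eqP[/eqP]|/eqP//].
  by rewrite mulf_eq0 !gt_eqF ?expR_gt0.
(* For complex-valued [g] the vanishing transform only couples cosine and sine integrals of the two
   parts. Replacing [k] by [- k] changes the sign of the sine integrals alone, which separates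
   them. *)
have re0 k : \int[mu]_u (g1 u * cos (k * u)) = \int[mu]_u (g2 u * sin (k * u)).
  have := congr1 (@complex.Re R) (fourier0 k); rewrite /cintegral Re_mk => h.
  apply/eqP; rewrite -subr_eq0 -RintegralB//; [|exact: icos|exact: isin].
  rewrite -[X in _ == X]h; apply/eqP; apply: eq_Rintegral => u _.
  by rewrite cE /g1 /g2 !ReImE; ring.
have im0 k : \int[mu]_u (g2 u * cos (k * u)) = - \int[mu]_u (g1 u * sin (k * u)).
  have := congr1 (@complex.Im R) (fourier0 k); rewrite /cintegral Im_mk => h.
  apply/eqP; rewrite -addr_eq0 -RintegralD//; [|exact: icos|exact: isin].
  rewrite -[X in _ == X]h; apply/eqP; apply: eq_Rintegral => u _.
  by rewrite cE /g1 /g2 !ReImE; ring.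
have cosN k (r : R -> R) : \int[mu]_u (r u * cos (- k * u)) = \int[mu]_u (r u * cos (k * u)).
  by apply: eq_Rintegral => u _; rewrite mulNr cosN.
have sinN k (r : R -> R) : rintegrable mu setT r ->
    \int[mu]_u (r u * sin (- k * u)) = - \int[mu]_u (r u * sin (k * u)).
  move=> ir; rewrite -RintegralN//; last exact: isin.
  by apply: eq_Rintegral => u _; rewrite mulNr sinN mulrN.
have z1 k : \int[mu]_u (g1 u * cos (k * u)) = 0 /\ \int[mu]_u (g2 u * sin (k * u)) = 0.
  by have := re0 k; have := re0 (- k); rewrite cosN sinN// => *; split; lra.
have z2 k : \int[mu]_u (g2 u * cos (k * u)) = 0 /\ \int[mu]_u (g1 u * sin (k * u)) = 0.
  by have := im0 k; have := im0 (- k); rewrite cosN sinN// => *; split; lra.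
have all0 (r : R -> R) : rintegrable mu setT r ->
    (forall k, \int[mu]_u (r u * cos (k * u)) = 0) ->
    (forall k, \int[mu]_u (r u * sin (k * u)) = 0) ->
    {ae mu, forall u, r u = 0}.
  move=> ir rc rs; apply: fourier_uniqueness => // k t.
  transitivity (\int[mu]_u (cos t * (r u * cos (k * u)) - sin t * (r u * sin (k * u)))).
    by apply: eq_Rintegral => u _; rewrite cosD; ring.
  have ic := icos k _ ir; have isn := isin k _ ir.
  rewrite RintegralB//; [|exact: rintegrableZ|exact: rintegrableZ].
  rewrite (RintegralZl _ measurableT ic) (RintegralZl _ measurableT isn).
  by rewrite rc rs !mulr0 subrr.
have h1 := all0 g1 ig1 (fun k => (z1 k).1) (fun k => (z2 k).2).
have h2 := all0 g2 ig2 (fun k => (z2 k).1) (fun k => (z1 k).2).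
apply: negligibleS (negligibleU h1 h2) => u /= fu.
apply: contrapT => /not_orP[/contrapT e1 /contrapT e2]; apply: fu.
have /eqP : g u = 0 by apply: complex_ext.
rewrite /g mulf_eq0 => /orP[/eqP[/eqP]|/eqP//].
by rewrite (negbTE (ge u)).
Qed.

End segal_bargmann_injectivity.

(** * Holomorphy of the transformed functions *)

Section segal_bargmann_entire.
Variable R : realType.
Local Notation mu := (@lebesgue_measure R).
Implicit Types (f : R -> R[i]) (z h : R[i]) (u B : R).

(** With [B = q * abs z] this bounds the modulus of the part of the kernel that depends on [u];
    raising [B] makes room for further factors growing exponentially in [u]. *)
Let W B u : R := expR (B * `|u|) * expR (- (u ^+ 2 / 2)).

Let L2fun_exp_gauss B : L2fun mu (fun u => (W B u)%:C).
Proof.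
apply: (@L2fun_le _ _ R mu _ (fun u => expR (2 * B ^+ 2) * gauss 2^-1 0 u)).
- apply: cmeasurable_real; apply: measurable_funM; apply: measurableT_comp => //.
    by apply: measurable_funM => //; exact: measurableT_comp.
  by apply: measurableT_comp => //; apply: measurable_funM => //; exact: measurable_funX.
- by apply: rintegrableZ => //; apply: rintegrable_gauss; rewrite invr_gt0.
- move=> u; rewrite abs_real real_normK ?num_real// /W /gauss exprMn !expr2 -!expRD ler_expR.
  (* This square yields that [2 * B] times the modulus of [u] is at most [2 * B ^+ 2 + u ^+ 2 / 2];
     half of the Gaussian exponent is left over. *)
  have := sqr_ge0 (2 * B - `|u|); have := real_normK (num_real u).
  by rewrite subr0 !expr2 => *; nra.
Qed.

Lemma sqr_le_expR (x : R) : 0 <= x -> x ^+ 2 <= 4 * expR x.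
Proof.
move=> x0; have h := expR_ge1Dx (x / 2).
have -> : expR x = expR (x / 2) ^+ 2 by rewrite expr2 -expRD -splitr.
by move: h; set y := expR _ => h; nra.
Qed.

(** The integrand without [c] and the exponential of [- z ^+ 2 / 2]; here [z] enters only through
    the exponential of a linear function. *)
Let k f z u := cexp ((Num.sqrt 2 * u)%:C * z) * ((expR (- (u ^+ 2 / 2)))%:C * f u).

Let q := Num.sqrt 2 : R.
Let q0 : 0 <= q := sqrtr_ge0 _.

Let cmeasurable_sqrt2 : cmeasurable (fun u : R => (q * u)%:C).
Proof. by apply: cmeasurable_real; apply: measurable_funM => //; exact: measurable_cst. Qed.

Section kernel_estimates.
Variable f : R -> R[i].
Hypothesis Lf : L2fun mu f.

Let mf : cmeasurable f. Proof. by case: Lf. Qed.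

Let mk z : cmeasurable (k f z).
Proof.
apply: cmeasurableM.
  apply: cmeasurable_cexp; apply: cmeasurableM; first exact: cmeasurable_sqrt2.
  exact: cmeasurable_cst.
apply: cmeasurableM => //; apply: cmeasurable_real; apply: measurableT_comp => //.
by apply: measurableT_comp => //; apply: measurable_funM => //; exact: measurable_funX.
Qed.

Let iW B : rintegrable mu setT (fun u => W B u * abs (f u)).
Proof.
apply: eq_rintegrable (L2fun_abs_mul (L2fun_exp_gauss B) Lf) => // u _.
by rewrite abs_real ger0_norm// mulr_ge0 ?expR_ge0.
Qed.

Let kW z u : abs (k f z u) <= W (q * abs z) u * abs (f u).
Proof.
rewrite /k /W !absM abs_cexp abs_real (ger0_norm (expR_ge0 _)) mulrA.
rewrite ler_wpM2r ?abs_ge0// ler_wpM2r ?expR_ge0// ler_expR.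
apply: le_trans (ler_norm _) (le_trans (Re_le_abs _) _).
by rewrite absM abs_real normrM (ger0_norm q0) mulrAC.
Qed.

Let WM B B' u : expR (B * `|u|) * W B' u = W (B + B') u.
Proof. by rewrite /W mulrA -expRD mulrDl. Qed.

Let ik z : cintegrable mu (k f z).
Proof. exact: (@cintegrable_le _ _ R mu _ _ (mk z) (iW (q * abs z)) (kW z)). Qed.

Let ik1 z : cintegrable mu (fun u => (q * u)%:C * k f z u).
Proof.
apply: (@cintegrable_le _ _ R mu _ _ (cmeasurableM cmeasurable_sqrt2 (mk z))
  (iW (q + q * abs z))) => u.
rewrite absM abs_real -WM -mulrA ler_pM ?abs_ge0//.
rewrite normrM (ger0_norm q0) (le_trans _ (expR_ge1Dx _))//.
by rewrite lerDr.
Qed.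

Let SB_factor (c : R) z : SB c f z =
  (c%:C * cexp (- (2^-1)%:C * z ^+ 2)) * cintegral mu (k f z).
Proof.
rewrite -cintegralZ//.
apply: eq_cintegral => u; rewrite /SBkernel /k !mulrA; congr (_ * f u).
rewrite -!mulrA; congr (_ * _); rewrite -cexp_real -!cexpD; congr cexp.
by apply: complex_ext; rewrite half_real ?expr2 !ReImE; ring.
Qed.

(** Integrating the second-order remainder of the exponential shows that the integral of [k f z] has
    a complex derivative at every [z]; the prefactor is entire. *)
Lemma entire_SB (c : R) : entire (SB c f).
Proof.
pose L z := cintegral mu (k f z).
have dL z : rdiff L z (cintegral mu (fun u => (q * u)%:C * k f z u)) 0.
  (* Of the two additional [q], one pays for the square of [u] in the remainder and the other for
     its exponential factor; the constant 12 is 3 from the remainder times 4 from [sqr_le_expR]. *)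
  pose B := q + (q + q * abs z).
  have iB := rintegrableZ 12 measurableT (iW B).
  apply: (@rdiff_quadratic R L z _ _ (\int[mu]_u (12 * (W B u * abs (f u)))) 1) => //.
    apply: Rintegral_ge0 => u _; rewrite !mulr_ge0 ?expR_ge0 ?abs_ge0//.
  move=> h h1; rewrite mul0r addr0 mulrC /L.
  rewrite -cintegralZ// -cintegralB// -cintegralB//; last 2 first.
  - have := cintegrableD (ik (z + h)) (cintegrableZ (-1) (ik z)).
    by congr cintegrable; apply/funext => u; rewrite mulN1r.
  - exact: cintegrableZ.
  have rE u : k f (z + h) u - k f z u - h * ((q * u)%:C * k f z u) =
      k f z u * (cexp ((q * u)%:C * h) - 1 - (q * u)%:C * h).
    rewrite /k mulrDr cexpD; ring.
  rewrite (eq_cintegral mu rE).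
  have rW u : abs (k f z u * (cexp ((q * u)%:C * h) - 1 - (q * u)%:C * h)) <=
      abs h ^+ 2 * (12 * (W B u * abs (f u))).
    have t0 : 0 <= q * `|u| by rewrite mulr_ge0.
    have tE : abs ((q * u)%:C * h) = q * `|u| * abs h.
      by rewrite absM abs_real normrM (ger0_norm q0).
    rewrite absM mulrC; set E := expR (q * `|u|).
    have E0 : 0 <= E by exact: expR_ge0.
    have rle : abs (cexp ((q * u)%:C * h) - 1 - (q * u)%:C * h) <=
        abs h ^+ 2 * (12 * (E * E)).
      apply: le_trans (abs_cexp_remainder_le _) _; rewrite tE exprMn.
      have e1 : expR (q * `|u| * abs h) <= E by rewrite ler_expR ler_piMr// ltW.
      apply: (@le_trans _ _ (3 * ((4 * E) * abs h ^+ 2) * E)); last first.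
        by rewrite le_eqVlt; apply/orP; left; apply/eqP; ring.
      apply: ler_pM => //; rewrite ?expR_ge0// ?mulr_ge0 ?exprn_ge0 ?abs_ge0//.
      by rewrite ler_wpM2l// ler_wpM2r ?exprn_ge0 ?abs_ge0// sqr_le_expR.
    apply: le_trans (ler_pM (abs_ge0 _) (abs_ge0 _) rle (kW z u)) _.
    by rewrite le_eqVlt -!WM -/E; apply/orP; left; apply/eqP; ring.
  have ir : cintegrable mu (fun u => k f z u * (cexp ((q * u)%:C * h) - 1 - (q * u)%:C * h)).
    apply: (fun mf => @cintegrable_le _ _ R mu _ _ mf (rintegrableZ (abs h ^+ 2) measurableT iB) rW).
    apply: (cmeasurableM (mk z)).
    have mqh : cmeasurable (fun u => (q * u)%:C * h).
      by apply: cmeasurableM; [exact: cmeasurable_sqrt2|exact: cmeasurable_cst].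
    apply: cmeasurableB => //.
    apply: cmeasurableB; last exact: cmeasurable_cst.
    exact: cmeasurable_cexp.
  apply: le_trans (abs_cintegral_le ir) _.
  rewrite mulrC -(RintegralZl _ measurableT iB).
  apply: le_Rintegral => //; first exact: cintegrable_abs.
  exact: rintegrableZ.
have eL : entire L by apply/entireP => z; eexists; exact: dL.
rewrite (_ : SB c f = fun z => (c%:C * cexp (- (2^-1)%:C * z ^+ 2)) * L z); last first.
  by apply/funext => z; exact: SB_factor.
have eG : entire (fun z => c%:C * cexp (- (2^-1)%:C * z ^+ 2)).
  apply/entireP => z; have := rdiffM (rdiff_cst c%:C z) (rdiff_cexp_sqr (- (2^-1)%:C) z).
  by rewrite !mulr0 !mul0r !add0r => d; eexists; exact: d.
exact: (@entireM R _ L eG eL).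
Qed.

End kernel_estimates.

End segal_bargmann_entire.

(** * The range of the transform as a Hilbert space *)

Section SBspace_theory.
Variables (R : realType) (c : R).
Hypothesis c0 : 0 < c.
Local Notation mu := (@lebesgue_measure R).
Implicit Types (f g : R -> R[i]) (phi psi : R[i] -> R[i]).

Lemma car_SBP phi : car (SBspace c) phi <-> exists2 f : R -> R[i], L2fun mu f & phi = SB c f.
Proof. by split=> [[f /L2P Lf <-]|[f /L2P Lf ->]]; exists f. Qed.

Lemma SB_inj f g : L2fun mu f -> L2fun mu g -> SB c f = SB c g -> ae_equal f g.
Proof.
move=> Lf Lg fg; have Ld := L2fun_lincomb (-1) Lg Lf.
have d0 : SB c (fun u => -1 * g u + f u) = fun=> 0.
  by rewrite SB_lincomb// fg; apply/funext => z; rewrite /lincomb mulN1r addNr.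
apply: negligibleS (SB_eq0 c0 Ld d0) => u /= nfg d; apply: nfg.
by apply/eqP; rewrite -subr_eq0 addrC -mulN1r; apply/eqP.
Qed.

Lemma SBpreimageP phi : car (SBspace c) phi ->
  L2fun mu (SBpreimage c phi) /\ SB c (SBpreimage c phi) = phi.
Proof.
move=> [f Lf fE]; have [/L2P h1 h2] : [set f | L2 f /\ SB c f = phi] (SBpreimage c phi).
  by apply: (xgetPex (fun=> 0)); exists f.
by split.
Qed.

Lemma L2prod_ae f g f' g' : L2fun mu f -> L2fun mu g -> L2fun mu f' -> L2fun mu g' ->
  ae_equal f f' -> ae_equal g g' -> L2prod mu f g = L2prod mu f' g'.
Proof.
move=> Lf Lg Lf' Lg' ff gg; apply: ae_eq_cintegral.
- exact: cintegrable_measurable (L2prod_integrable Lf Lg).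
- exact: cintegrable_measurable (L2prod_integrable Lf' Lg').
- apply: negligibleS (negligibleU ff gg) => u /= h.
  by apply: contrapT => /not_orP[/contrapT e1 /contrapT e2]; apply: h; rewrite e1 e2.
Qed.

(** By injectivity the chosen preimage of [SB c f] equals [f] almost everywhere, and the integral
    does not see the difference. *)
Lemma ip_SB f g : L2fun mu f -> L2fun mu g ->
  ip (SBspace c) (SB c f) (SB c g) = L2prod mu f g.
Proof.
move=> Lf Lg; rewrite /= L2ipE.
have [Lf' ef] : L2fun mu (SBpreimage c (SB c f)) /\ SB c (SBpreimage c (SB c f)) = SB c f.
  by apply: SBpreimageP; apply/car_SBP; exists f.
have [Lg' eg] : L2fun mu (SBpreimage c (SB c g)) /\ SB c (SBpreimage c (SB c g)) = SB c g.
  by apply: SBpreimageP; apply/car_SBP; exists g.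
by apply: L2prod_ae => //; exact: SB_inj.
Qed.

Lemma prehilbert_SB : prehilbert (SBspace c).
Proof.
split.
  split.
    apply/car_SBP; exists (fun=> 0); first exact: L2fun0.
    have := SB_lincomb c (-1) (L2fun0 mu) (L2fun0 mu).
    rewrite /lincomb (_ : (fun u : R => _) = fun=> 0); last by apply/funext => u; rewrite mulr0 addr0.
    by move=> ->; apply/funext => z; rewrite mulN1r addNr.
  move=> a phi psi /car_SBP[f Lf ->] /car_SBP[g Lg ->]; apply/car_SBP.
  by exists (fun u => a * f u + g u); [exact: L2fun_lincomb|rewrite SB_lincomb].
split.
- move=> a phi psi chi /car_SBP[f Lf ->] /car_SBP[g Lg ->] /car_SBP[h Lh ->].
  have := SB_lincomb c a Lf Lg; rewrite /lincomb => <-.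
  by rewrite !ip_SB// ?L2prod_lincombl//; exact: L2fun_lincomb.
- move=> phi psi /car_SBP[f Lf ->] /car_SBP[g Lg ->].
  by rewrite !ip_SB// L2prod_conj.
- move=> phi /car_SBP[f Lf ->]; rewrite ip_SB// L2prod_self ler0c.
  by apply: Rintegral_ge0 => t _; exact: sqr_ge0.
- move=> phi /car_SBP[f Lf ->]; rewrite ip_SB// => /(L2prod_eq0 Lf) f0.
  rewrite (SB_ae c Lf (L2fun0 mu) f0); apply/funext => z.
  rewrite /SB (eq_cintegral mu (g := fun=> (0 : R)%:C)) => [|u]; last by rewrite mulr0.
  by rewrite cintegral_real Rintegral_cst// mul0r.
Qed.

Lemma sqnorm_SB f g : L2fun mu f -> L2fun mu g ->
  sqnorm (SBspace c) (lincomb (-1) (SB c g) (SB c f)) = L2dist mu f g.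
Proof.
move=> Lf Lg; rewrite -SB_lincomb// /sqnorm ip_SB ?L2prod_self; [|exact: L2fun_lincomb..].
by apply: eq_Rintegral => u _; rewrite mulN1r addrC.
Qed.

(** The transform is an isometry, so completeness is carried over from the Riesz-Fischer theorem. *)
Lemma complete_SB : complete (SBspace c).
Proof.
move=> v Hv cv.
have /choice[u uP] : forall n, exists f, L2fun mu f /\ v n = SB c f.
  by move=> n; have /car_SBP[f Lf e] := Hv n; exists f.
have Lu n := (uP n).1; have vE n := (uP n).2.
have HH := prehilbert_SB.
have cu : L2cauchy mu u.
  move=> e e0; have se : 0 < Num.sqrt e by rewrite sqrtr_gt0.
  have [N hN] := cv _ se; exists N => m n Nm Nn.
  have := hN m n Nm Nn; rewrite lincombBE !vE -sqnorm_SB// => lt.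
  rewrite -sqr_hnorm//; last by rewrite -!vE; exact: car_lincomb.
  by rewrite -[ltRHS](sqr_sqrtr (ltW e0)) ltr_pXn2r// nnegrE sqrtr_ge0.
have [f Lf hf] := riesz_fischer Lu cu.
exists (SB c f); first by apply/car_SBP; exists f.
apply/cvgrPdist_lt => e e0; have [N hN] := hf _ (exprn_gt0 2 e0).
exists N => // n Nn; rewrite /= lincombBE sub0r normrN ger0_norm ?sqrtr_ge0//.
rewrite -(ltr_pXn2r (n := 2))// ?nnegrE ?sqrtr_ge0 ?(ltW e0)//.
rewrite sqr_hnorm// ?vE ?sqnorm_SB//; first exact: hN.
by apply: car_lincomb => //; apply/car_SBP; [exists f|exists (u n)].
Qed.

Lemma kernel_of_SB : kernel_of (SBspace c)
  (fun z w => (c ^+ 2 * Num.sqrt pi)%:C * bargmann_kernel z w).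
Proof.
move=> w; pose k u := conjc (SBkernel c w u).
have Lk : L2fun mu k by apply: L2funJ; exact: L2fun_SBkernel.
have kE : (fun z => (c ^+ 2 * Num.sqrt pi)%:C * bargmann_kernel z w) = SB c k.
  by apply/funext => z; rewrite SB_kernel.
rewrite kE; split; first by apply/car_SBP; exists k.
by move=> phi /car_SBP[f Lf ->]; rewrite ip_SB// SB_L2prod.
Qed.

End SBspace_theory.

(** * Comparison of the two spaces *)

Section rescaled_inner_product.
Variables (R : realType) (E : Type) (H : funSpace R E) (r : R).
Hypothesis r0 : 0 < r.

(** Scaling the inner product by [r] divides the kernel by [r], and changes neither the Cauchy
    sequences nor their limits. *)
Definition rescale : funSpace R E := FunSpace (car H) (fun phi psi => r%:C * ip H phi psi).

Lemma sqnorm_rescale phi : sqnorm rescale phi = r * sqnorm H phi.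
Proof. by rewrite /sqnorm /= !ReImE mul0r subr0. Qed.

Lemma hnorm_rescale phi : hnorm rescale phi = Num.sqrt r * hnorm H phi.
Proof. by rewrite /hnorm -!/(sqnorm _ _) sqnorm_rescale sqrtrM// ltW. Qed.

Lemma prehilbert_rescale : prehilbert H -> prehilbert rescale.
Proof.
move=> [vs [h1 h2 h3 h4]]; split; first by [].
split.
- by move=> a phi psi chi p s c /=; rewrite h1//; ring.
- by move=> phi psi p s /=; rewrite h2// conjCM conjc_real.
- by move=> phi p /=; rewrite mulr_ge0 ?ler0c ?(ltW r0)// h3.
- move=> phi p /= /eqP; rewrite mulf_eq0 => /orP[/eqP[/eqP]|/eqP]; last exact: h4.
  by rewrite gt_eqF.
Qed.

Lemma complete_rescale : complete H -> complete rescale.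
Proof.
have s0 : 0 < Num.sqrt r by rewrite sqrtr_gt0.
move=> cH u Hu cu; have [|phi p cphi] := cH u Hu.
  move=> e e0; have [N hN] := cu _ (mulr_gt0 s0 e0); exists N => m n Nm Nn.
  by have := hN m n Nm Nn; rewrite hnorm_rescale ltr_pM2l.
exists phi => //; under eq_fun do rewrite hnorm_rescale.
have := cvgM (cvg_cst (Num.sqrt r)) cphi; rewrite mulr0; exact.
Qed.

Lemma kernel_of_rescale K : prehilbert H ->
  kernel_of H (fun z w => r%:C * K z w) -> kernel_of rescale K.
Proof.
move=> HH kH w; have [kw rep] := kH w.
have KE : (fun z => K z w) = lincomb (r^-1)%:C (fun z => r%:C * K z w) (fun=> 0).
  by apply/funext => z; rewrite /lincomb mulrA -realCM mulVf ?gt_eqF// mul1r addr0.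
have Kw : car H (fun z => K z w) by rewrite KE; apply: car_lincomb => //; exact: car_zero.
split=> // phi p; rewrite rep//=.
have -> : (fun z => r%:C * K z w) = lincomb r%:C (fun z => K z w) (fun=> 0).
  by apply/funext => z; rewrite /lincomb addr0.
have -> : (fun=> 0) = lincomb (-1) (fun z => K z w) (fun z => K z w).
  by apply/funext => z; rewrite /lincomb mulN1r addNr.
rewrite !ip_lincombr//; last exact: car_lincomb.
by rewrite conjc_real (rmorphN1 conjc); ring.
Qed.

End rescaled_inner_product.

(** * Completeness of the Bargmann space and the theorem *)

Section main.
Variables (R : realType) (c : R).
Hypothesis c0 : 0 < c.
Local Notation mu2 := (@lebesgue_measure R \x @lebesgue_measure R)%E.

Let r : R := c ^+ 2 * Num.sqrt pi.
Let r0 : 0 < r. Proof. by rewrite mulr_gt0 ?exprn_gt0// sqrtr_gt0 pi_gt0. Qed.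
Let SBr := rescale (SBspace c) r.
Let pSB : prehilbert SBr. Proof. exact/prehilbert_rescale/prehilbert_SB. Qed.
Let cSB : complete SBr. Proof. exact/complete_rescale/complete_SB. Qed.
Let kSB : kernel_of SBr (@bargmann_kernel R).
Proof. by apply: kernel_of_rescale => //; [exact: prehilbert_SB|exact: kernel_of_SB]. Qed.

Lemma sqnorm_bargmann (phi psi : R[i] -> R[i]) :
  sqnorm bargmann (lincomb (-1) psi phi) =
  pi^-1 * L2dist mu2 (bargmann_lift phi) (bargmann_lift psi).
Proof.
rewrite /sqnorm ip_bargmannE L2prod_self !ReImE mul0r subr0; congr (_ * _).
apply: eq_Rintegral => t _; rewrite (bargmann_lift_lincomb (-1) psi phi).
by rewrite mulN1r addrC.
Qed.

Lemma complete_bargmann : complete (@bargmann R).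
Proof.
have pB := @prehilbert_bargmann R; have kB := @kernel_of_bargmann R.
(* This instance relies on the completeness of [SBr]; its norm estimate turns Cauchy sequences of
   Bargmann functions into Cauchy sequences of [SBr]. *)
have incl := @kernel_inclusion _ _ SBr bargmann _ _ pSB cSB pB kSB kB.
move=> u Hu cu; have u1 n : car SBr (u n) by case: (incl _ (Hu n)).
have Hd m n : car bargmann (lincomb (-1) (u n) (u m)) by exact: car_lincomb.
have [|psi psi1 /(cvg_hnorm_sqnorm pSB u1 psi1) cpsi] := cSB u1.
  move=> e e0; have [N hN] := cu e e0; exists N => m n Nm Nn.
  apply: le_lt_trans (hN m n Nm Nn); rewrite lincombBE ler_wsqrtr//.
  by case: (incl _ (Hd m n)).
have epsi : entire psi.
  by have /car_SBP[f Lf ->] := psi1; exact: entire_SB.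
(* Evaluation is the inner product with a kernel function, so norm convergence in [SBr] implies
   convergence at every point. *)
have pw z : abs (u n z - psi z) @[n --> \oo] --> (0 : R).
  have [kz rep] := kSB z; set k := fun x => _ in kz rep.
  have M0 : 0 < sqnorm SBr k + 1 by rewrite ltr_wpDl// sqnorm_ge0.
  apply/cvgrPdist_lt => e e0.
  have [N hN] := cpsi _ (divr_gt0 (exprn_gt0 2 e0) M0).
  exists N => // n Nn; rewrite /= sub0r normrN ger0_norm ?abs_ge0//.
  have cd : car SBr (lincomb (-1) psi (u n)) by exact: car_lincomb.
  rewrite (_ : u n z - psi z = lincomb (-1) psi (u n) z); last by rewrite -lincombBE.
  rewrite (rep _ cd) -(ltr_pXn2r (n := 2))// ?nnegrE ?abs_ge0 ?(ltW e0)//.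
  apply: le_lt_trans (cauchy_schwarz pSB cd kz) _.
  have := hN n Nn; rewrite ltr_pdivlMr//; apply: le_lt_trans.
  by rewrite ler_wpM2l ?sqnorm_ge0// lerDl.
have p0 : 0 < (pi : R)^-1 by rewrite invr_gt0 pi_gt0.
have sq_lt (x y : R) : 0 <= y -> Num.sqrt x < y -> x < y ^+ 2.
  move=> y0; have [x0|x0 _] := leP 0 x.
    by rewrite -[in X in _ -> X](sqr_sqrtr x0) ltr_pXn2r// nnegrE sqrtr_ge0.
  exact: lt_le_trans x0 (sqr_ge0 _).
have cl : L2cauchy mu2 (fun n => bargmann_lift (u n)).
  move=> e e0; have se : 0 < Num.sqrt (pi^-1 * e) by rewrite sqrtr_gt0 mulr_gt0.
  have [N hN] := cu _ se; exists N => m n Nm Nn.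
  have := sq_lt _ _ (ltW se) (hN m n Nm Nn).
  rewrite lincombBE -/(sqnorm _ _) sqnorm_bargmann sqr_sqrtr ?ltr_pM2l//.
  by rewrite mulr_ge0// ltW.
have Lu n : L2fun mu2 (bargmann_lift (u n)) by have /car_bargmannP[] := Hu n.
(* The whole sequence converges at every point, so no subsequence is extracted: [s] is the
   identity. *)
have [|Lpsi lim] := L2_limit (f := bargmann_lift psi) Lu cl (fun k => leqnn k)
    (cmeasurable_bargmann_lift epsi).
  apply: aeW => t; rewrite -(mul0r (abs ((expR (- ((t.1 ^+ 2 + t.2 ^+ 2) / 2)))%:C : R[i]))).
  under eq_fun do rewrite /bargmann_lift -mulrBl absM.
  by apply: cvgM; [exact: pw|exact: cvg_cst].
exists psi; first exact/car_bargmannP.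
apply/cvgrPdist_lt => e e0.
have [N hN] := lim _ (divr_gt0 (exprn_gt0 2 e0) p0).
exists N => // n Nn; rewrite /= lincombBE sub0r normrN ger0_norm ?sqrtr_ge0//.
have psiB : car bargmann psi by exact/car_bargmannP.
rewrite -(ltr_pXn2r (n := 2))// ?nnegrE ?sqrtr_ge0 ?(ltW e0)//.
rewrite (sqr_hnorm pB (car_lincomb pB (-1) psiB (Hu n))).
by rewrite sqnorm_bargmann mulrC -ltr_pdivlMr// hN.
Qed.

Lemma SBspace_bargmann : car (SBspace c) = car bargmann /\
  forall phi psi, car bargmann phi -> car bargmann psi ->
    ip bargmann phi psi = r%:C * ip (SBspace c) phi psi.
Proof.
have [h1 h2] := kernel_unique_space pSB cSB (@prehilbert_bargmann R)
  complete_bargmann kSB (@kernel_of_bargmann R).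
by split=> // phi psi p s; rewrite -h2// h1.
Qed.

Lemma SB_unitary : L2_unitary (SB c) (SBspace c).
Proof.
split.
- move=> f g /L2P Lf /L2P Lg; split; first exact: SB_inj.
  exact: SB_ae.
- by [].
- by move=> a f g /L2P Lf /L2P Lg; rewrite SB_lincomb.
- by move=> f g /L2P Lf /L2P Lg; rewrite ip_SB// L2ipE.
Qed.

End main.

(** The exponents add up to 0. This is the usual normalization of the Segal-Bargmann transform, for
    which the two kernels coincide. *)
Lemma SB_constantE (R : realType) : (pi `^ (- 4^-1)) ^+ 2 * Num.sqrt pi = 1 :> R.
Proof.
have p0 : 0 < pi :> R by exact: pi_gt0.
rewrite expr2 -powRD; last by rewrite (gt_eqF p0) implybT.
rewrite -powR12_sqrt ?(ltW p0)// -powRD; last by rewrite (gt_eqF p0) implybT.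
by rewrite (_ : _ + _ = 0) ?powRr0//; field.
Qed.

Theorem theorem3p7 (R : realType) (c : R) (hc : 0 < c) :
  [/\ (* (i) *)
      L2_unitary (SB c) (SBspace c),
      (* (ii) *)
      rkhs (SBspace c),
      (* (iii): equality of kernels at c = pi^(-1/4); for any c they agree
         up to the factor c^2 sqrt(pi) *)
      (c = pi `^ (- 4^-1) -> same_reproducing_kernel (SBspace c) bargmann) /\
      (exists K, reproducing_kernel bargmann K /\
         reproducing_kernel (SBspace c)
           (fun z w => (c ^+ 2 * Num.sqrt pi)%:C * K z w)) &
      (* (iv), with the corresponding relation between the inner products *)
      car (SBspace c) = car bargmann /\
      (forall phi psi, car bargmann phi -> car bargmann psi ->
         ip bargmann phi psi
         = (c ^+ 2 * Num.sqrt pi)%:C * ip (SBspace c) phi psi)].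
Proof.
have rB := kernel_of_rkhs (@prehilbert_bargmann R) (complete_bargmann hc) (@kernel_of_bargmann R).
have rS := kernel_of_rkhs (prehilbert_SB hc) (complete_SB hc) (kernel_of_SB hc).
split.
- exact: SB_unitary.
- by case: rS.
- split; last by exists (@bargmann_kernel R).
  move=> cE; exists (@bargmann_kernel R); split=> //.
  (* Only the [c] in the scalar factor is replaced; the one in [SBspace c] stays. *)
  move: rS; rewrite [X in X ^+ 2]cE SB_constantE; congr reproducing_kernel.
  by apply/funext => z; apply/funext => w; rewrite mul1r.
- exact: SBspace_bargmann.
Qed.
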